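(* Let $a<b$ and $a\le A<B\le b$ be real numbers, let $0<\alpha,\beta<1$, let $y_a,y_b,l\in\mathbb R$, and let $L,g:[a,b]\times\mathbb R^3\to\mathbb R$ be of class $C^1$. For $y\in{}_a^{\alpha}E_b^{\beta}$ write $[y](x)=(x,y(x),{}_a^CD_x^\alpha y(x),{}_x^CD_b^\beta y(x))$ and $$J^*(y)=\int_A^B L[y](x)\,dx,\qquad I^*(y)=\int_A^B g[y](x)\,dx.$$ Let $y\in{}_a^{\alpha}E_b^{\beta}$ be a local minimum of $J^*$ when restricted to the conditions $y(a)=y_a$, $y(b)=y_b$ and $I^*(y)=l$. Assume that, along $y$, $\partial_3L$ and $\partial_3g$ have continuous right Riemann--Liouville derivatives ${}_xD_B^\alpha\partial_3L$, ${}_xD_B^\alpha\partial_3g$ on $[a,B]$, and $\partial_4L$ and $\partial_4g$ have continuous left Riemann--Liouville derivatives ${}_AD_x^\beta\partial_4L$, ${}_AD_x^\beta\partial_4g$ on $[A,b]$. If $y$ is not an extremal for $I^*$, then there exists a constant $\lambda\in\mathbb R$ such that, with $F=L+\lambda g$, $$\left\{\begin{array}{ll} \partial_2 F+{}_xD_B^\alpha\, \partial_3 F+{}_AD_x^\beta\, \partial_4 F=0 & \text{for all } x \in [A,B],\\ {}_xD_B^\alpha\, \partial_3 F -{}_xD_A^\alpha\, \partial_3 F=0 & \text{for all } x \in [a,A],\\ {}_AD_x^\beta\, \partial_4 F-{}_BD_x^\beta\, \partial_4 F=0 & \text{for all } x \in [B,b], \end{array}\right.$$ where the partial derivatives of $F$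 are evaluated at $[y](x)$.
   Context: Fractional operators. Let $0<\gamma<1$, $p<q$ real, $\Gamma$ the Euler gamma function. The left and right Riemann--Liouville derivatives of order $\gamma$ are $${}_pD_x^\gamma f(x)=\frac{1}{\Gamma(1-\gamma)}\frac{d}{dx}\int_p^x (x-t)^{-\gamma}f(t)\,dt,\qquad {}_xD_q^\gamma f(x)=\frac{-1}{\Gamma(1-\gamma)}\frac{d}{dx}\int_x^q (t-x)^{-\gamma}f(t)\,dt$$ (one-sided derivatives at endpoints). The left and right Caputo derivatives are, for absolutely continuous $f:[a,b]\to\mathbb R$, $${}_a^CD_x^\gamma f(x)=\frac{1}{\Gamma(1-\gamma)}\int_a^x (x-t)^{-\gamma}f'(t)\,dt,\qquad {}_x^CD_b^\gamma f(x)=\frac{-1}{\Gamma(1-\gamma)}\int_x^b (t-x)^{-\gamma}f'(t)\,dt,$$ with the value at $x=a$ (left) or $x=b$ (right) understood as the limit. Function space: ${}_a^{\alpha}E_b^{\beta}$ is the set of $y:[a,b]\to\mathbb R$ for which ${}_a^CD_x^\alpha y$ and ${}_x^CD_b^\beta y$ exist and are continuous on $[a,b]$. $\partial_i$ denotes the partial derivative with respect to the $i$-th variable, $i=1,2,3,4$, of a function of $(x,y,u,v)$. An expression such as ${}_xD_B^\alpha\partial_3F$ means the operator applied to the function $x\mapsto\partial_3F[y](x)$. A function $y$ is called an extremal for $I^*$ if $$\partial_2 g[y](x)+{}_xD_B^\alpha\,\partial_3 g[y](x)+{}_AD_x^\beta\,\partial_4 g[y](x)=0\quad\text{for all }x\in[A,B].$$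 Fix a norm $\|\cdot\|$ on ${}_a^{\alpha}E_b^{\beta}$ (any norm). $y$ is a local minimum of $J^*$ restricted to given conditions if it satisfies them and there is $\delta>0$ with $J^*(y)\le J^*(y_1)$ for every $y_1\in{}_a^{\alpha}E_b^{\beta}$ satisfying the same conditions with $\|y-y_1\|<\delta$. Convention: if $A=a$ the second line of the system is void; if $B=b$ the third line is void. *)

(* Defs.v *)
From HB Require Import structures.
From mathcomp Require Import all_boot all_order all_algebra.
From mathcomp Require Import all_classical all_reals all_analysis.

Set Implicit Arguments.
Unset Strict Implicit.
Unset Printing Implicit Defensive.

Import Order.TTheory GRing.Theory Num.Theory.
Import numFieldNormedType.Exports.

Local Open Scope classical_set_scope.
Local Open Scope ring_scope.

(* Functions on a closed interval [a, b] are represented by total functions    *)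
(* R -> R of which only the values on [a, b] matter.                           *)

Section FractionalOperators.
Context {R : realType}.
Implicit Types (D : set R) (f y : R -> R) (a b p q x : R) (gam : R).

Local Notation mu := (@lebesgue_measure R).

Definition Gamma (s : R) : R :=
  \int[mu]_(t in `]0%R, +oo[) (t `^ (s - 1) * expR (- t)).

(* Derivative of the restriction of f to D; on a closed interval this is the   *)
(* one-sided derivative at the endpoints.                                      *)
Definition diff_quotient f x (t : R) : R := (f t - f x) / (t - x).

Definition derivable_within D f x : Prop :=
  cvg (diff_quotient f x t @[t --> within D x^']).

Definition derive_within D f x : R :=
  lim (diff_quotient f x t @[t --> within D x^']).

Definition abs_continuous a b f : Prop :=
  forall eps : R, 0 < eps -> exists2 delta : R, 0 < delta &
    forall (n : nat) (u v : 'I_n -> R),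
      (forall i, a <= u i /\ u i <= v i /\ v i <= b) ->
      trivIset setT (fun i => `]u i, v i[%classic) ->
      \sum_(i < n) (v i - u i) < delta ->
      \sum_(i < n) `|f (v i) - f (u i)| < eps.

(* Right Riemann-Liouville derivative {}_xD_q^gam f, for f given on [p, q]:    *)
(* p only fixes the interval on which the outer derivative is taken.           *)
Definition RLright_int gam q f x : R :=
  \int[mu]_(t in `[x, q]) ((t - x) `^ (- gam) * f t).

Definition RLright_exists p gam q f x : Prop :=
  derivable_within `[p, q] (RLright_int gam q f) x.

Definition RLright p gam q f x : R :=
  (- 1 / Gamma (1 - gam)) * derive_within `[p, q] (RLright_int gam q f) x.

(* Left Riemann-Liouville derivative {}_pD_x^gam f, for f given on [p, q].     *)
Definition RLleft_int p gam f x : R :=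
  \int[mu]_(t in `[p, x]) ((x - t) `^ (- gam) * f t).

Definition RLleft_exists p gam q f x : Prop :=
  derivable_within `[p, q] (RLleft_int p gam f) x.

Definition RLleft p gam q f x : R :=
  (1 / Gamma (1 - gam)) * derive_within `[p, q] (RLleft_int p gam f) x.

Definition continuous_RLright p gam q f : Prop :=
  (forall x, x \in `[p, q] -> RLright_exists p gam q f x) /\
  {within `[p, q], continuous (RLright p gam q f)}.

Definition continuous_RLleft p gam q f : Prop :=
  (forall x, x \in `[p, q] -> RLleft_exists p gam q f x) /\
  {within `[p, q], continuous (RLleft p gam q f)}.

(* For absolutely continuous f, derive1 f is the derivative of f almost        *)
(* everywhere on [a, b]; its default value elsewhere does not affect the       *)
(* integrals.                                                                  *)
Definition Cleft_int a gam f x : R :=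
  (1 / Gamma (1 - gam)) *
  \int[mu]_(t in `[a, x]) ((x - t) `^ (- gam) * derive1 f t).

Definition Cleft a gam f x : R :=
  if x == a then lim (Cleft_int a gam f t @[t --> a^'+])
  else Cleft_int a gam f x.

Definition Cright_int gam b f x : R :=
  (- 1 / Gamma (1 - gam)) *
  \int[mu]_(t in `[x, b]) ((t - x) `^ (- gam) * derive1 f t).

Definition Cright gam b f x : R :=
  if x == b then lim (Cright_int gam b f t @[t --> b^'-])
  else Cright_int gam b f x.

Definition Cleft_exists a gam b f : Prop :=
  (forall x, x \in `]a, b] ->
     mu.-integrable `[a, x] (fun t => ((x - t) `^ (- gam) * derive1 f t)%:E)) /\
  cvg (Cleft_int a gam f t @[t --> a^'+]).

Definition Cright_exists a gam b f : Prop :=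
  (forall x, x \in `[a, b[ ->
     mu.-integrable `[x, b] (fun t => ((t - x) `^ (- gam) * derive1 f t)%:E)) /\
  cvg (Cright_int gam b f t @[t --> b^'-]).

(* The second clause, that derive1 y is a genuine derivative almost            *)
(* everywhere, follows from absolute continuity.                               *)
Definition Espace a b (alpha beta : R) : set (R -> R) :=
  [set y | [/\ abs_continuous a b y,
               {ae mu, forall t, t \in `]a, b[ -> derivable y t 1},
               Cleft_exists a alpha b y /\
               {within `[a, b], continuous (Cleft a alpha y)} &
               Cright_exists a beta b y /\
               {within `[a, b], continuous (Cright beta b y)}]].

(* Definiteness is that of functions on [a, b]; with the triangle inequality   *)
(* it makes N f depend only on the values of f on [a, b].                      *)
Definition is_norm_on a b (E : set (R -> R)) (N : (R -> R) -> R) : Prop :=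
  [/\ forall f, E f -> 0 <= N f,
      forall f, E f -> (N f = 0 <-> forall x, x \in `[a, b] -> f x = 0),
      forall (c : R) f, E f -> N (fun x => c * f x) = `|c| * N f &
      forall f h, E f -> E h -> N (fun x => f x + h x) <= N f + N h].

End FractionalOperators.

Section Functionals.
Context {R : realType}.
Implicit Types (L g P : R -> R -> R -> R -> R) (y : R -> R).
Implicit Types (a b A B alpha beta : R).

Local Notation mu := (@lebesgue_measure R).

Definition partial1 a b P (x y u v : R) : R :=
  derive_within `[a, b] (fun s => P s y u v) x.
Definition partial2 P (x y u v : R) : R := derive1 (fun s => P x s u v) y.
Definition partial3 P (x y u v : R) : R := derive1 (fun s => P x y s v) u.
Definition partial4 P (x y u v : R) : R := derive1 (fun s => P x y u s) v.

Definition continuous4 a b P : Prop :=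
  {within [set z : R * R * R * R | z.1.1.1 \in `[a, b]],
    continuous (fun z : R * R * R * R => P z.1.1.1 z.1.1.2 z.1.2 z.2)}.

Definition classC1 a b P : Prop :=
  (forall x y u v : R, x \in `[a, b] ->
     [/\ derivable_within `[a, b] (fun s => P s y u v) x,
         derivable (fun s => P x s u v) y 1,
         derivable (fun s => P x y s v) u 1 &
         derivable (fun s => P x y u s) v 1]) /\
  [/\ continuous4 a b (partial1 a b P), continuous4 a b (partial2 P),
      continuous4 a b (partial3 P) & continuous4 a b (partial4 P)].

Definition along a b alpha beta P y (x : R) : R :=
  P x (y x) (Cleft a alpha y x) (Cright beta b y x).

Definition functional a b A B alpha beta P y : R :=
  \int[mu]_(x in `[A, B]) along a b alpha beta P y x.

Definition EL a b A B alpha beta P y (x : R) : R :=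
  along a b alpha beta (partial2 P) y x
  + RLright a alpha B (along a b alpha beta (partial3 P) y) x
  + RLleft A beta b (along a b alpha beta (partial4 P) y) x.

Definition extremal a b A B alpha beta P y : Prop :=
  forall x, x \in `[A, B] -> EL a b A B alpha beta P y x = 0.

Definition admissible a b A B alpha beta g (ya yb l : R) : set (R -> R) :=
  [set y | [/\ Espace a b alpha beta y, y a = ya, y b = yb &
               functional a b A B alpha beta g y = l]].

Definition local_minimum (N : (R -> R) -> R) (J : (R -> R) -> R)
    (S : set (R -> R)) y : Prop :=
  S y /\ exists2 delta : R, 0 < delta &
    forall y1, S y1 -> N (fun x => y x - y1 x) < delta -> J y <= J y1.

End Functionals.

(* Main.v *)
(* Let [f2, f3, f4] be the partial derivatives of [P] along [y], extended by zero
   outside [A, B]. In a direction [h] with [h a = 0] and continuous derivative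
   [w], Fubini turns the first variation of the integral of [P] into the integral
   of [w * W_P] over [a, b], where the continuous function [W_P t] is the sum of
   the integral of [f2] from [t] to [b], of the right fractional integral of [f3]
   and of minus the left fractional integral of [f4]. If [W_P] is constant on
   [a, b], differentiating it on [A, B] gives the first equation, while on [a, A]
   (resp. [B, b]) only the term with [f3] (resp. [f4]) varies, and it is the
   difference of the two Riemann-Liouville integrals of the second (resp. third)
   equation, hence a constant. So [W_g] is not constant, and
   [w0 = W_g - mean W_g] is a direction vanishing at [a] and [b] along which the
   variation of the constraint is the integral of [w0 ^ 2], which is positive.
   A direction [w1] that leaves the constraint stationary is corrected into an
   admissible one by adding a small multiple of [w0], so the variation of the
   objective along [w1] is zero. With [lambda] chosen so that the variation for
   [F = L + lambda g] vanishes at [w0], it vanishes in every direction, and the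
   direction [W_F - mean W_F] shows that [W_F] is constant. *)
Require Import Defs.
From HB Require Import structures.
From mathcomp Require Import all_boot all_order all_algebra.
From mathcomp Require Import all_classical all_reals all_analysis.
From mathcomp Require Import measurable_realfun.
From mathcomp Require Import ring lra.

Set Implicit Arguments.
Unset Strict Implicit.
Unset Printing Implicit Defensive.

Import Order.TTheory GRing.Theory Num.Theory.
Import numFieldNormedType.Exports.

Local Open Scope classical_set_scope.
Local Open Scope ring_scope.

(** * Power kernels *)

(** Directions are primitives of continuous functions [w] because their Caputo derivatives are then
    fractional integrals of [w]: the last three arguments of [P] vary linearly in [w], through the
    same kernel with orders 0, [alpha] and [beta]. Fractional integration by parts thus reduces to
    Fubini, and nothing has to be differentiated before [W_P] is known to be constant. The
    coefficients, cut off at [A] and [B], jump there, but a fractional integral of a bounded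
    function is continuous, so [W_P] is continuous on all of [a, b]. As the norm is arbitrary,
    closeness to [y] comes from homogeneity and the triangle inequality on a family with two
    parameters. On that family the intermediate value theorem in one parameter takes the place of
    the implicit function theorem: it asks only for continuity in that parameter and a first-order
    expansion at the origin. *)

Section ImproperIntegral.
Context {R : realType}.
Local Notation mu := (@lebesgue_measure R).
Implicit Types (f F : R -> R) (p q b g s x : R).

(** The power kernel is unbounded at an endpoint, so the fundamental theorem is applied on compact
    intervals exhausting []p, q[] and passed to the limit by monotone convergence. Integrability of
    [f] is thus a consequence. *)
Lemma ge0_integral_oo f F p q : p < q ->
  {in `]p, q[, forall x, 0 <= f x} -> {in `]p, q[, continuous f} ->
  derivable_oo_LRcontinuous F p q -> {in `]p, q[, derive1 F =1 f} ->
  (\int[mu]_(x in `]p, q[) (f x)%:E = (F q - F p)%:E)%E.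
Proof.
move=> pq f0 cf [dF Fp Fq] F'f.
(* Dividing by 3 keeps [p + d n < q - d n] from [n = 0] on. *)
pose d (n : nat) := (q - p) / 3 / n.+1%:R.
have d0 n : 0 < d n by rewrite /d divr_gt0// divr_gt0// subr_gt0.
have d3 n : d n <= (q - p) / 3.
  by rewrite /d ler_pdivrMr// ler_peMr ?ler1n// divr_ge0// subr_ge0 ltW.
have dcvg : d n @[n --> \oo] --> 0.
  rewrite -(mulr0 ((q - p) / 3)); apply: cvgMl_tmp; exact: cvg_harmonic.
pose I (n : nat) := `[p + d n, q - d n]%classic.
have subI n x : x \in `[p + d n, q - d n] -> x \in `]p, q[.
  rewrite !in_itv/= => /andP[h1 h2]; have := d0 n; have := d3 n.
  by move=> h3 h4; apply/andP; split; lra.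
have IU : \bigcup_n I n = `]p, q[%classic.
  apply/seteqP; split => [x [n _]|x /=]; first exact: subI.
  rewrite in_itv/= => /andP[px xq].
  have m0 : 0 < Num.min (x - p) (q - x) by rewrite lt_min !subr_gt0 px xq.
  have /cvgrPdist_lt/(_ _ m0)[n _ Hn] := dcvg.
  have := Hn n (leqnn n); rewrite /= sub0r normrN gtr0_norm// lt_min => /andP[h1 h2].
  by exists n => //; rewrite /I/= in_itv/=; apply/andP; split; lra.
have mI n : measurable (I n) by exact: measurable_itv.
have ndI : nondecreasing_seq I.
  apply/nondecreasing_seqP => n; rewrite subsetEset; apply: subset_itv;
    rewrite bnd_simp ?lerD2l ?lerN2 /d ler_pM2l ?divr_gt0 ?subr_gt0//;
    by rewrite lef_pV2 ?posrE// ler_nat.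
have cfI n : {within I n, continuous f}.
  by apply: continuous_in_subspaceT => x; rewrite inE => /subI; exact: cf.
have mf n : measurable_fun (I n) (fun x => (f x)%:E).
  by apply/measurable_EFinP; apply: subspace_continuous_measurable_fun.
have f0I n x : I n x -> (0 <= (f x)%:E)%E.
  by move=> /subI xpq; rewrite lee_fin f0.
have IE n : (\int[mu]_(x in I n) (f x)%:E = (F (q - d n) - F (p + d n))%:E)%E.
  have h : p + d n < q - d n.
    by have := d3 n; lra.
  have cF x : x \in `[p + d n, q - d n] -> {for x, continuous F}.
    move=> /subI xpq; apply: differentiable_continuous.
    by apply/derivable1_diffP/dF; rewrite inE in xpq.
  rewrite /I (continuous_FTC2 h (F := F)) ?EFinB//.
  - exact: cfI.
  - split=> [x xI| |].
    + by apply: dF; apply: (subI n); apply: subset_itv_oo_cc.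
    + apply: cvg_at_right_filter; apply: cF.
      by rewrite in_itv/= lexx ltW.
    + apply: cvg_at_left_filter; apply: cF.
      by rewrite in_itv/= lexx ltW.
  - by move=> x xI; apply: F'f; apply: (subI n); apply: subset_itv_oo_cc.
have L1 := ge0_nondecreasing_set_cvg_integral (mu := mu) ndI mI mf f0I.
rewrite IU in L1.
have L2 : (F (q - d n) - F (p + d n))%:E @[n --> \oo] --> (F q - F p)%:E.
  apply: cvg_EFin; first exact: nearW.
  apply: cvgB.
  - apply: (cvg_at_leftP F q (F q)).1 => //; split => [n|].
      by rewrite gtrBl.
    by rewrite -[X in _ --> X]subr0; apply: cvgB => //; exact: cvg_cst.
  - apply: (cvg_at_rightP F p (F p)).1 => //; split => [n|].
      by rewrite ltrDl.
    by rewrite -[X in _ --> X]addr0; apply: cvgD => //; exact: cvg_cst.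
rewrite -(funext IE) in L2.
exact: cvg_unique L1 L2.
Qed.

(* For [g != 0] the value at [s = 0] is [0 `^ (- g) = 0]; for [g = 0] the kernel
   is the indicator function of [0 <= s]. *)
Definition frac_ker g s : R := if 0 <= s then s `^ (- g) else 0.

(** Primitive of the kernel, hence its mass on an interval of length [s]; doubled, it also serves as
    a modulus of continuity for fractional integrals. *)
Definition frac_prim g s : R := s `^ (1 - g) / (1 - g).

Lemma frac_ker_ge0 g s : 0 <= frac_ker g s.
Proof. by rewrite /frac_ker; case: ifP => // _; exact: powR_ge0. Qed.

Lemma frac_kerE g s : 0 <= s -> frac_ker g s = s `^ (- g).
Proof. by rewrite /frac_ker => ->. Qed.

Lemma frac_kerN g s : s < 0 -> frac_ker g s = 0.
Proof. by rewrite /frac_ker leNgt => ->. Qed.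

Lemma measurable_frac_ker g : measurable_fun setT (frac_ker g).
Proof.
apply: measurable_fun_ifT => //.
- by apply: measurable_fun_ler.
Qed.

Lemma frac_ker_nincr g s t : 0 <= g -> 0 < s -> s <= t ->
  frac_ker g t <= frac_ker g s.
Proof.
move=> g0 s0 st; rewrite !frac_kerE ?(ltW s0)//; last by rewrite (le_trans (ltW s0)).
rewrite !powRN lef_pV2 ?posrE ?powR_gt0 ?(lt_le_trans s0)//.
by apply: ge0_ler_powR => //; rewrite nnegrE ltW// (lt_le_trans s0).
Qed.

Lemma frac_prim_ndecr g s t : g < 1 -> 0 <= s -> s <= t ->
  frac_prim g s <= frac_prim g t.
Proof.
move=> g1 s0 st; rewrite ler_pM2r ?invr_gt0 ?subr_gt0//.
apply: ge0_ler_powR; rewrite ?nnegrE//; first by rewrite subr_ge0 ltW.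
exact: le_trans st.
Qed.

Lemma frac_prim0 g : g < 1 -> frac_prim g 0 = 0.
Proof. by move=> g1; rewrite /frac_prim powR0 ?mul0r// gt_eqF// subr_gt0. Qed.

Lemma frac_prim_cvg0 g : g < 1 -> frac_prim g s @[s --> 0^'+] --> 0.
Proof.
move=> g1; rewrite -[X in _ --> X](mul0r (1 - g)^-1); apply: cvgMr_tmp.
by apply: powR_cvg0; rewrite subr_gt0.
Qed.

Lemma is_derive_frac_prim g s : g < 1 -> 0 < s ->
  is_derive s 1 (frac_prim g) (s `^ (- g)).
Proof.
move=> g1 s0; have h : 1 - g != 0 by rewrite gt_eqF// subr_gt0.
have -> : frac_prim g = (1 - g)^-1 \*: (@powR R ^~ (1 - g)).
  by apply/funext => x; rewrite /frac_prim /= mulrC.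
have -> : s `^ (- g) = (1 - g)^-1 *: ((1 - g) * s `^ ((1 - g) - 1)).
  by rewrite /GRing.scale/= mulrA mulVf// mul1r addrAC subrr add0r.
by apply: is_deriveZ; exact: is_derive1_powR.
Qed.

Lemma continuous_powR g s : 0 < s -> {for s, continuous (@powR R ^~ g)}.
Proof.
by move=> s0; apply: differentiable_continuous; apply/derivable1_diffP;
  apply: derivable_powR; rewrite in_itv/= s0.
Qed.

(** Integrating up to [b] instead of [x] keeps the domain independent of [x]: the kernel vanishes
    for [t > x], and the rest is an improper integral singular at [t = x]. *)
Lemma integral_frac_ker_left g p x b : 0 <= g < 1 -> p <= x <= b ->
  (\int[mu]_(t in `[p, b]) (frac_ker g (x - t))%:E = (frac_prim g (x - p))%:E)%E.
Proof.
move=> /andP[g0 g1] /andP[px xb].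
have mk (D : set R) : measurable_fun D (fun t : R => (frac_ker g (x - t))%:E).
  apply/measurable_EFinP; apply: measurable_funTS.
  apply: measurableT_comp; first exact: measurable_frac_ker.
  exact: measurable_funB.
have -> : (\int[mu]_(t in `[p, b]) (frac_ker g (x - t))%:E =
  \int[mu]_(t in `[p, x]) (frac_ker g (x - t))%:E)%E.
  rewrite [RHS](_ : _ = \int[mu]_(t in `[p, b] `&` `[p, x]) (frac_ker g (x - t))%:E)%E.
    rewrite integral_mkcondr; apply: eq_integral => t; rewrite inE/= in_itv/= => /andP[pt tb].
    rewrite patchE; case: ifPn => //; rewrite notin_setE/= in_itv/= pt/= => /negP.
    by rewrite -ltNge => xt; rewrite frac_kerN// subr_lt0.
  congr (integral _ _ _); apply/esym/setIidr; apply: subset_itvl.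
  by rewrite bnd_simp.
move: px; rewrite le_eqVlt => /predU1P[->|px].
  by rewrite set_itv1 integral_set1 subrr frac_prim0.
rewrite -integral_itv_bndo_bndc// -integral_itv_obnd_cbnd//.
under eq_integral => t.
  rewrite inE/= in_itv/= => /andP[pt tx].
  rewrite frac_kerE ?subr_ge0 ?ltW//; over.
pose F t := - frac_prim g (x - t).
have dF t : t < x -> is_derive t 1 F ((x - t) `^ (- g)).
  move=> tx.
  have h1 : is_derive (x - t) 1 (frac_prim g) ((x - t) `^ (- g)).
    by apply: is_derive_frac_prim => //; rewrite subr_gt0.
  have h2 : is_derive t 1 (fun t => x - t) (- 1 : R).
    by rewrite -(sub0r 1); apply: is_deriveB.
  have := is_deriveN (@is_derive1_comp R (frac_prim g) (fun t => x - t) t _ _ h1 h2).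
  by rewrite mulrN1 opprK.
rewrite (ge0_integral_oo (F := F) px).
- by rewrite /F subrr frac_prim0// oppr0 sub0r opprK.
- by move=> t _; exact: powR_ge0.
- move=> t; rewrite in_itv/= => /andP[_ tx].
  apply: (@continuous_comp _ _ _ (fun t => x - t) (@powR R ^~ (- g))).
    by apply: cvgB => //; exact: cvg_cst.
  by apply: continuous_powR; rewrite subr_gt0.
- split.
  + by move=> t; rewrite in_itv/= => /andP[_ /dF[]].
  + apply: cvg_at_right_filter; apply: differentiable_continuous.
    by apply/derivable1_diffP; case: (dF p px).
  + apply: cvgN; rewrite subrr frac_prim0//.
    apply/cvg_at_leftP => u [ux uc].
    have := frac_prim_cvg0 g1 => /cvg_at_rightP; apply; split => [n|].
      by rewrite subr_gt0.
    by rewrite -(subrr x); apply: cvgB => //; exact: cvg_cst.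
- by move=> t; rewrite in_itv/= => /andP[_ /dF h]; rewrite derive1E derive_val.
Qed.

Lemma integral_frac_ker_right g p x b : 0 <= g < 1 -> p <= x <= b ->
  (\int[mu]_(t in `[p, b]) (frac_ker g (t - x))%:E = (frac_prim g (b - x))%:E)%E.
Proof.
move=> /andP[g0 g1] /andP[px xb].
have mk (D : set R) : measurable_fun D (fun t : R => (frac_ker g (t - x))%:E).
  apply/measurable_EFinP; apply: measurable_funTS.
  apply: measurableT_comp; first exact: measurable_frac_ker.
  exact: measurable_funB.
have -> : (\int[mu]_(t in `[p, b]) (frac_ker g (t - x))%:E =
  \int[mu]_(t in `[x, b]) (frac_ker g (t - x))%:E)%E.
  rewrite [RHS](_ : _ = \int[mu]_(t in `[p, b] `&` `[x, b]) (frac_ker g (t - x))%:E)%E.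
    rewrite integral_mkcondr; apply: eq_integral => t; rewrite inE/= in_itv/= => /andP[pt tb].
    rewrite patchE; case: ifPn => //; rewrite notin_setE/= in_itv/= tb andbT => /negP.
    by rewrite -ltNge => xt; rewrite frac_kerN// subr_lt0.
  congr (integral _ _ _); apply/esym/setIidr; apply: subset_itvr; by rewrite bnd_simp.
move: xb; rewrite le_eqVlt => /predU1P[->|xb].
  by rewrite set_itv1 integral_set1 subrr frac_prim0.
rewrite -integral_itv_bndo_bndc// -integral_itv_obnd_cbnd//.
under eq_integral => t.
  rewrite inE/= in_itv/= => /andP[xt tb].
  rewrite frac_kerE ?subr_ge0 ?ltW//; over.
pose F t := frac_prim g (t - x).
have dF t : x < t -> is_derive t 1 F ((t - x) `^ (- g)).
  move=> tx.
  have h1 : is_derive (t - x) 1 (frac_prim g) ((t - x) `^ (- g)).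
    by apply: is_derive_frac_prim => //; rewrite subr_gt0.
  have h2 : is_derive t 1 (fun t => t - x) (1 : R).
    by rewrite -[X in is_derive _ _ _ X](subr0 1); apply: is_deriveB.
  have := @is_derive1_comp R (frac_prim g) (fun t => t - x) t _ _ h1 h2.
  by rewrite mulr1.
rewrite (ge0_integral_oo (F := F) xb).
- by rewrite /F subrr frac_prim0// subr0.
- by move=> t _; exact: powR_ge0.
- move=> t; rewrite in_itv/= => /andP[tx _].
  apply: (@continuous_comp _ _ _ (fun t => t - x) (@powR R ^~ (- g))).
    by apply: cvgB => //; exact: cvg_cst.
  by apply: continuous_powR; rewrite subr_gt0.
- split.
  + by move=> t; rewrite in_itv/= => /andP[/dF[]].
  + rewrite /F subrr frac_prim0//.
    apply/cvg_at_rightP => u [ux uc].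
    have := frac_prim_cvg0 g1 => /cvg_at_rightP; apply; split => [n|].
      by rewrite subr_gt0.
    by rewrite -(subrr x); apply: cvgB => //; exact: cvg_cst.
  + apply: cvg_at_left_filter; apply: differentiable_continuous.
    by apply/derivable1_diffP; case: (dF b xb).
- by move=> t; rewrite in_itv/= => /andP[/dF h _]; rewrite derive1E derive_val.
Qed.

End ImproperIntegral.

(** * Real-valued integrals, integral operators with a nonnegative kernel *)

Section RealIntegrals.
Context {R : realType}.
Local Notation mu := (@lebesgue_measure R).
Implicit Types (D E : set (measurableTypeR R)) (f h u v : R -> R) (a b c x : R).

Definition rintegrable D f := mu.-integrable D (EFin \o f).

Lemma rintegrableZl D c f : measurable D -> rintegrable D f -> rintegrable D (fun x => c * f x).
Proof. by move=> mD fi; have := integrableZl mD c fi; exact: eq_integrable. Qed.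

Lemma rintegrableD D f h : measurable D -> rintegrable D f -> rintegrable D h ->
  rintegrable D (fun x => f x + h x).
Proof. by move=> mD fi hi; have := integrableD mD fi hi; exact: eq_integrable. Qed.

Lemma rintegrableB D f h : measurable D -> rintegrable D f -> rintegrable D h ->
  rintegrable D (fun x => f x - h x).
Proof. by move=> mD fi hi; have := integrableB mD fi hi; exact: eq_integrable. Qed.

Lemma rintegrableS D E f : measurable D -> measurable E -> D `<=` E ->
  rintegrable E f -> rintegrable D f.
Proof. by move=> mD mE DE fi; exact: integrableS fi. Qed.

Lemma eq_rintegrable D f h : measurable D -> {in D, f =1 h} -> rintegrable D f -> rintegrable D h.
Proof. by move=> mD fh; apply: eq_integrable => // x xD /=; rewrite fh. Qed.

Lemma rintegrable_measurable D f : rintegrable D f -> measurable_fun D f.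
Proof. by move=> fi; apply/measurable_EFinP; exact: measurable_int fi. Qed.

Lemma Rintegral_lin D f h r s : measurable D -> rintegrable D f -> rintegrable D h ->
  \int[mu]_(x in D) (r * f x + s * h x) =
  r * \int[mu]_(x in D) f x + s * \int[mu]_(x in D) h x.
Proof.
move=> mD fi hi.
rewrite (RintegralD mD (rintegrableZl r mD fi) (rintegrableZl s mD hi)).
by rewrite (RintegralZl r mD fi) (RintegralZl s mD hi).
Qed.

(** This class contains the continuous functions on [a, b] and their cut-offs to [A, B], which jump
    at [A] and [B]; multiplication by a member preserves integrability of a singular kernel. *)
Definition bounded_mfun D f :=
  measurable_fun D f /\ exists M, forall x, D x -> `|f x| <= M.

Lemma bounded_mfun_gt0 D f : bounded_mfun D f ->
  exists2 M, 0 < M & forall x, D x -> `|f x| <= M.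
Proof.
move=> [_ [M hM]]; exists (`|M| + 1); first by rewrite ltr_wpDl.
by move=> x /hM /le_trans; apply; rewrite (le_trans (ler_norm _))// lerDl.
Qed.

Lemma bounded_mfun_bounded D f : bounded_mfun D f -> [bounded f x | x in D].
Proof.
move=> [_ [M hM]]; exists M; split; first exact: num_real.
by move=> z Mz x /hM /le_trans; apply; exact: ltW.
Qed.

Lemma bounded_mfunS D E f : measurable E -> D `<=` E ->
  bounded_mfun E f -> bounded_mfun D f.
Proof.
move=> mE DE [mf [M hM]]; split; first exact: measurable_funS mf.
by exists M => x /DE /hM.
Qed.

Lemma bounded_mfun_mul D f h :
  bounded_mfun D f -> bounded_mfun D h -> bounded_mfun D (fun x => f x * h x).
Proof.
move=> [mf [M hM]] [mh [K hK]]; split; first exact: measurable_funM.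
exists (M * K) => x Dx; rewrite normrM.
by apply: ler_pM => //; [exact: hM|exact: hK].
Qed.

Lemma bounded_mfunD D f h :
  bounded_mfun D f -> bounded_mfun D h -> bounded_mfun D (fun x => f x + h x).
Proof.
move=> [mf [M hM]] [mh [K hK]]; split; first exact: measurable_funD.
exists (M + K) => x Dx; apply: (le_trans (ler_normD _ _)).
by apply: lerD; [exact: hM|exact: hK].
Qed.

Lemma bounded_mfun_cst D c : bounded_mfun D (fun=> c).
Proof. by split => //; exists `|c|. Qed.

Lemma bounded_mfunZ D c f : bounded_mfun D f -> bounded_mfun D (fun x => c * f x).
Proof. by move=> bf; apply: bounded_mfun_mul => //; exact: bounded_mfun_cst. Qed.

Lemma bounded_mfun_within_continuous a b f :
  {within `[a, b], continuous f} -> bounded_mfun `[a, b] f.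
Proof.
move=> cf; split; first by apply: subspace_continuous_measurable_fun.
have /compact_bounded[M [_ hM]] := continuous_compact cf (@segment_compact _ a b).
exists (M + 1) => x /= xab; apply: hM; first by rewrite ltrDl.
by exists x.
Qed.

Lemma eq_bounded_mfun D f h : {in D, f =1 h} -> bounded_mfun D f -> bounded_mfun D h.
Proof.
move=> fh [mf [M hM]]; split; first exact: eq_measurable_fun mf.
by exists M => x Dx; rewrite -fh ?inE//; exact: hM.
Qed.

Lemma bounded_mfun_restrict D E f : measurable D -> measurable E ->
  bounded_mfun (D `&` E) f -> bounded_mfun D (f \_ E).
Proof.
move=> mD mE [mf [M hM]]; split; first exact/measurable_restrict.
exists `|M| => x Dx; rewrite patchE; case: ifPn => [|_].
  by rewrite inE => Ex; rewrite (le_trans (hM _ _))// ler_norm.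
by rewrite normr0.
Qed.

Lemma rintegrable_bounded D f : measurable D -> (mu D < +oo)%E ->
  bounded_mfun D f -> rintegrable D f.
Proof.
move=> mD Dfin bf; apply: measurable_bounded_integrable => //; first by case: bf.
exact: bounded_mfun_bounded.
Qed.

Lemma mu_itvcc a b : a <= b -> mu `[a, b] = (b - a)%:E.
Proof.
move=> ab; rewrite lebesgue_measure_itv/= lte_fin; case: ltP => //= ba.
by have -> : a = b by [apply/le_anti; rewrite ab ba]; rewrite subrr.
Qed.

Lemma mu_itvcc_fin a b : (mu `[a, b] < +oo)%E.
Proof. by rewrite lebesgue_measure_itv/=; case: ifPn => //; rewrite ltry. Qed.

Lemma rintegrable_bounded_itv a b f : bounded_mfun `[a, b] f -> rintegrable `[a, b] f.
Proof. by apply: rintegrable_bounded => //; exact: mu_itvcc_fin. Qed.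

Lemma rintegrable_mul_bounded D k f : measurable D -> rintegrable D k -> bounded_mfun D f ->
  rintegrable D (fun x => k x * f x).
Proof.
move=> mD ki bf.
have := integrableMl mD ki bf.1 (bounded_mfun_bounded bf).
exact: eq_integrable.
Qed.

Lemma EFin_Rintegral D f : measurable D -> rintegrable D f ->
  ((\int[mu]_(x in D) f x)%:E = \int[mu]_(x in D) (f x)%:E)%E.
Proof. by move=> mD fi; rewrite /Rintegral fineK//; exact: integrable_fin_num. Qed.

Lemma Rintegral_cst_itv a b c : a <= b ->
  \int[mu]_(x in `[a, b]) c = c * (b - a).
Proof. by move=> ab; rewrite Rintegral_cst// [X in fine X](mu_itvcc ab). Qed.

Lemma le_normr_Rintegral_bound a b f c : a <= b -> rintegrable `[a, b] f ->
  (forall x, `[a, b]%classic x -> `|f x| <= c) ->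
  `|\int[mu]_(x in `[a, b]) f x| <= c * (b - a).
Proof.
move=> ab fi fc; rewrite -Rintegral_cst_itv//.
apply: (le_trans (le_normr_Rintegral _ fi)) => //.
apply: le_Rintegral => //; first exact: integrable_norm.
by apply: rintegrable_bounded_itv; exact: bounded_mfun_cst.
Qed.

Lemma integral_restrict_EFin D f : measurable D -> rintegrable D f ->
  (\int[mu]_x ((f \_ D) x)%:E = (\int[mu]_(x in D) f x)%:E)%E.
Proof.
move=> mD fi; rewrite EFin_Rintegral// [RHS]integral_mkcond.
by apply: eq_integral => x _; rewrite restrict_EFin.
Qed.

Section Kernel.
Variables (a b C : R) (k : R -> R -> R).
Hypothesis ab : a <= b.
Local Notation D := (`[a, b]%classic : set R).
Hypothesis k0 : forall x t, 0 <= k x t.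
Hypothesis mk : measurable_fun setT (fun z : R * R => k z.1 z.2).
Hypothesis ik : forall x, D x -> rintegrable D (k x).
Hypothesis ik' : forall t, D t -> rintegrable D (k ^~ t).
Hypothesis kC : forall x, D x -> \int[mu]_(t in D) k x t <= C.

(** Fubini for an unbounded kernel: the uniform bound [C] on the mass of [k x] makes the double
    integral absolutely convergent. *)
Lemma Rintegral_kernel_swap u v : bounded_mfun D u -> bounded_mfun D v ->
  \int[mu]_(x in D) (u x * \int[mu]_(t in D) (k x t * v t)) =
  \int[mu]_(t in D) (v t * \int[mu]_(x in D) (k x t * u x)).
Proof.
move=> bu bv.
have mD : measurable D by [].
(* Extension by zero turns the square into the whole plane, where Fubini is applied. *)
pose f (z : R * R) : R := (u \_ D) z.1 * k z.1 z.2 * (v \_ D) z.2.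
have mf : measurable_fun setT (fun z => (f z)%:E).
  apply/measurable_EFinP; apply: measurable_funM; first apply: measurable_funM => //.
    by apply: measurableT_comp => //; apply/(measurable_restrictT _ mD); case: bu.
  by apply: measurableT_comp => //; apply/(measurable_restrictT _ mD); case: bv.
have fx x : (\int[mu]_t (f (x, t))%:E =
    (((fun x => u x * \int[mu]_(t in D) (k x t * v t)) \_ D) x)%:E)%E.
  have [Dx|Dx] := pselect (D x); last first.
    rewrite patchE memNset//; apply: integral0_eq => t _.
    by rewrite /f /= patchE memNset// !mul0r.
  have ikv : rintegrable D (fun t => k x t * v t) by apply: rintegrable_mul_bounded => //; exact: ik.
  rewrite [in RHS]patchE mem_set// -RintegralZl// -integral_restrict_EFin//; last exact: rintegrableZl.
  apply: eq_integral => t _; rewrite /f/= !patchE mem_set//; case: ifP => _.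
    by rewrite mulrA.
  by rewrite mulr0.
have ft t : (\int[mu]_x (f (x, t))%:E =
    (((fun t => v t * \int[mu]_(x in D) (k x t * u x)) \_ D) t)%:E)%E.
  have [Dt|Dt] := pselect (D t); last first.
    rewrite patchE memNset//; apply: integral0_eq => x _.
    by rewrite /f /= [X in _ * X]patchE memNset// !mulr0.
  have iku : rintegrable D (fun x => k x t * u x) by apply: rintegrable_mul_bounded => //; exact: ik'.
  rewrite [in RHS]patchE mem_set// -RintegralZl// -integral_restrict_EFin//; last exact: rintegrableZl.
  apply: eq_integral => x _; rewrite /f/= !patchE (mem_set Dt)//; case: ifP => _.
    by congr EFin; ring.
  by rewrite !mul0r.
have [Mu Mu0 hu] := bounded_mfun_gt0 bu.
have [Mv Mv0 hv] := bounded_mfun_gt0 bv.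
(* By Tonelli: the inner integral of the absolute value is at most [Mu * Mv * C] on [D] and zero
   elsewhere. *)
have fi : (mu \x mu)%E.-integrable setT (fun z => (f z)%:E).
  apply/integrable12ltyP => //.
  apply: (@le_lt_trans _ _ (\int[mu]_x ((cst (Mu * Mv * C) \_ D) x)%:E)%E); last first.
    rewrite integral_restrict_EFin// ?ltry//.
    by apply: rintegrable_bounded_itv; exact: bounded_mfun_cst.
  apply: ge0_le_integral => //.
  - by move=> x _; exact: integral_ge0.
  - apply: (@measurable_fun_fubini_tonelli_F _ _ _ _ _ mu (abse \o (fun z => (f z)%:E))) => //=.
    exact: measurableT_comp.
  - apply/measurable_EFinP; apply/(measurable_restrictT _ mD).
    exact: measurable_cst.
  move=> x _ /=; have [Dx|Dx] := pselect (D x); last first.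
    rewrite patchE memNset// integral0_eq// => t _.
    by rewrite /f /= patchE memNset// !mul0r normr0.
  rewrite [in leRHS]patchE mem_set//=.
  have ikM : rintegrable D (fun t => Mu * Mv * k x t) by apply: rintegrableZl => //; exact: ik.
  apply: (@le_trans _ _ (\int[mu]_t (((fun t => Mu * Mv * k x t) \_ D) t)%:E)%E).
    apply: ge0_le_integral => //.
    - apply/measurable_EFinP; apply: measurableT_comp => //.
      apply/measurable_EFinP; apply: (measurableT_comp mf); exact: pair1_measurable.
    - apply/measurable_EFinP; apply/(measurable_restrictT _ mD).
      exact: rintegrable_measurable ikM.
    move=> t _; rewrite /f/= lee_fin !patchE mem_set//; case: ifPn => [|_]; last first.
      by rewrite mulr0 normr0.
    rewrite inE => Dt; rewrite !normrM (ger0_norm (k0 _ _)) mulrAC ler_wpM2r//.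
    by apply: ler_pM => //; [exact: hu|exact: hv].
  rewrite integral_restrict_EFin// lee_fin RintegralZl//; last exact: ik.
  by apply: ler_wpM2l; [rewrite mulr_ge0 ?ltW|exact: kC].
rewrite [LHS]Rintegral_mkcond [RHS]Rintegral_mkcond; congr fine.
transitivity (\int[mu]_x \int[mu]_t (f (x, t))%:E)%E.
  by apply: eq_integral => x _; rewrite fx.
by rewrite (Fubini fi); apply: eq_integral => t _; rewrite ft.
Qed.

End Kernel.

(** If [x] is sent to [k x] with modulus of continuity [H] in the L1 sense, pairing with a function
    bounded by [M] has modulus [M * H]. Ordered pairs suffice, and [H] is then only evaluated at
    positive arguments. *)
Lemma continuous_Rintegral_kernel a b (k : R -> R -> R) (H : R -> R) f :
  (forall x, `[a, b]%classic x -> rintegrable `[a, b] (k x)) ->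
  (forall x y, a <= x -> x < y -> y <= b ->
     \int[mu]_(t in `[a, b]) `|k y t - k x t| <= H (y - x)) ->
  H s @[s --> 0^'+] --> 0 -> bounded_mfun `[a, b] f ->
  {within `[a, b], continuous (fun x => \int[mu]_(t in `[a, b]) (k x t * f t))}.
Proof.
move=> ik kH H0 bf; have [M M0 hM] := bounded_mfun_gt0 bf.
have ikf x : `[a, b]%classic x -> rintegrable `[a, b] (fun t => k x t * f t).
  by move=> xab; apply: rintegrable_mul_bounded => //; exact: ik.
have le_kH x y : a <= x -> x < y -> y <= b ->
  `|\int[mu]_(t in `[a, b]) (k y t * f t) - \int[mu]_(t in `[a, b]) (k x t * f t)|
    <= M * H (y - x).
  move=> ax xy yb.
  have Dx : `[a, b]%classic x by rewrite /= in_itv/= ax (le_trans (ltW xy)).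
  have Dy : `[a, b]%classic y by rewrite /= in_itv/= yb (le_trans ax (ltW xy)).
  have ikB := rintegrableB (measurable_itv _) (ik _ Dy) (ik _ Dx).
  rewrite -RintegralB//; [|exact: ikf|exact: ikf].
  under eq_Rintegral do rewrite -mulrBl.
  have ikBf : rintegrable `[a, b] (fun t => (k y t - k x t) * f t).
    exact: rintegrable_mul_bounded.
  apply: (le_trans (le_normr_Rintegral _ ikBf)) => //.
  apply: (@le_trans _ _ (\int[mu]_(t in `[a, b]) (M * `|k y t - k x t|))).
    apply: le_Rintegral => //.
    - exact: integrable_norm ikBf.
    - by apply: rintegrableZl => //; exact: integrable_norm ikB.
    - by move=> t tab; rewrite normrM mulrC ler_wpM2r//; exact: hM.
  rewrite RintegralZl//; last exact: integrable_norm ikB.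
  by apply: ler_wpM2l; [exact: ltW|exact: kH].
apply/subspace_continuousP => x0 x0ab; apply/cvgrPdist_le => /= e e0.
have eM : 0 < e / M by rewrite divr_gt0.
have /cvgrPdist_le/(_ _ eM)[d /= d0 dH] := H0.
have hH s : 0 < s -> s < d -> M * H s <= e.
  move=> s0 sd; rewrite -ler_pdivlMl// mulrC.
  have := dH s; rewrite /ball_/= sub0r normrN gtr0_norm// => /(_ sd s0).
  by rewrite sub0r normrN; apply: le_trans; exact: ler_norm.
rewrite near_withinE; near=> x => xab; rewrite /from_subspace /=.
have xd : `|x0 - x| < d by near: x; exact: (@cvgr_dist_lt _ _ _ _ _ id x0).
move: x0ab xab; rewrite /= !in_itv/= => /andP[ax0 x0b] /andP[ax xb].
have [xx0|xx0|<-] := ltgtP x x0; last by rewrite subrr normr0 ltW.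
- apply: (le_trans (le_kH _ _ _ _ _)) => //; apply: hH; first by rewrite subr_gt0.
  by move: xd; rewrite gtr0_norm ?subr_gt0.
- rewrite distrC; apply: (le_trans (le_kH _ _ _ _ _)) => //; apply: hH.
    by rewrite subr_gt0.
  by move: xd; rewrite distrC gtr0_norm ?subr_gt0.
Unshelve. all: by end_near. Qed.

End RealIntegrals.

(** * Fractional integrals of bounded functions *)

Section FractionalIntegrals.
Context {R : realType}.
Local Notation mu := (@lebesgue_measure R).
Implicit Types (f h u v w : R -> R) (a b p q g x y t : R).

(** The Riemann-Liouville integral of order [1 - g], up to the factor [1 / Gamma (1 - g)]. The fixed
    domain makes the left and right versions transposes of each other, and gives a meaning to points
    [x] outside [a, b]. *)
Definition fint_left a b g f x : R :=
  \int[mu]_(t in `[a, b]) (frac_ker g (x - t) * f t).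

Definition fint_right a b g f x : R :=
  \int[mu]_(t in `[a, b]) (frac_ker g (t - x) * f t).

Lemma measurable_frac_ker_left g :
  measurable_fun setT (fun z : R * R => frac_ker g (z.1 - z.2)).
Proof.
apply: (measurableT_comp (measurable_frac_ker g)).
by apply: measurable_funB; [exact: measurable_fst|exact: measurable_snd].
Qed.

Lemma rintegrable_frac_ker_left a b g x : 0 <= g < 1 -> a <= x <= b ->
  rintegrable `[a, b] (fun t => frac_ker g (x - t)).
Proof.
move=> g01 xab; apply/integrableP; split.
  apply/measurable_EFinP; apply: measurable_funTS.
  by apply: measurableT_comp; [exact: measurable_frac_ker|exact: measurable_funB].
under eq_integral do rewrite /= ger0_norm ?frac_ker_ge0//.
by rewrite integral_frac_ker_left// ltry.
Qed.

Lemma rintegrable_frac_ker_right a b g x : 0 <= g < 1 -> a <= x <= b ->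
  rintegrable `[a, b] (fun t => frac_ker g (t - x)).
Proof.
move=> g01 xab; apply/integrableP; split.
  apply/measurable_EFinP; apply: measurable_funTS.
  by apply: measurableT_comp; [exact: measurable_frac_ker|exact: measurable_funB].
under eq_integral do rewrite /= ger0_norm ?frac_ker_ge0//.
by rewrite integral_frac_ker_right// ltry.
Qed.

Lemma Rintegral_frac_ker_left a b g x : 0 <= g < 1 -> a <= x <= b ->
  \int[mu]_(t in `[a, b]) frac_ker g (x - t) = frac_prim g (x - a).
Proof. by move=> g01 xab; rewrite /Rintegral integral_frac_ker_left. Qed.

Lemma Rintegral_frac_ker_right a b g x : 0 <= g < 1 -> a <= x <= b ->
  \int[mu]_(t in `[a, b]) frac_ker g (t - x) = frac_prim g (b - x).
Proof. by move=> g01 xab; rewrite /Rintegral integral_frac_ker_right. Qed.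

(** Fractional integration by parts: [frac_ker g (x - t)], read as a function of [x], is the kernel
    of the right integral at [t]. Its mass in [t] is [frac_prim g (x - a)], largest at [x = b],
    whence the constant. *)
Lemma fint_swap a b g u v : a <= b -> 0 <= g < 1 ->
  bounded_mfun `[a, b] u -> bounded_mfun `[a, b] v ->
  \int[mu]_(x in `[a, b]) (u x * fint_left a b g v x) =
  \int[mu]_(t in `[a, b]) (v t * fint_right a b g u t).
Proof.
move=> ab g01 bu bv.
apply: (@Rintegral_kernel_swap _ _ _ (frac_prim g (b - a)) (fun x t => frac_ker g (x - t))) => //.
- by move=> x t; exact: frac_ker_ge0.
- exact: measurable_frac_ker_left.
- by move=> x /= xab; apply: rintegrable_frac_ker_left; rewrite ?in_itv in xab.
- by move=> x /= xab; apply: rintegrable_frac_ker_right; rewrite ?in_itv in xab.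
- move=> x /=; rewrite in_itv/= => /andP[ax xb].
  rewrite Rintegral_frac_ker_left ?ax//; case/andP: g01 => _ g1.
  by apply: frac_prim_ndecr; rewrite ?subr_ge0// lerD2r.
Qed.

(* Pointwise, [|k y t - k x t| <= k x t - k y t + 2 * 1_(x <= t) * k y t] for
   [k x t = frac_ker g (x - t)] and [x < y]; the first two terms integrate to a
   nonpositive number. *)
Lemma frac_ker_left_modulus a b g x y : 0 <= g < 1 -> a <= x -> x < y -> y <= b ->
  \int[mu]_(t in `[a, b]) `|frac_ker g (y - t) - frac_ker g (x - t)|
    <= 2 * frac_prim g (y - x).
Proof.
move=> g01 ax xy yb; have /andP[g0 g1] := g01.
have xab : a <= x <= b by rewrite ax (le_trans (ltW xy)).
have yab : a <= y <= b by rewrite yb (le_trans ax (ltW xy)).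
have kx := rintegrable_frac_ker_left g01 xab.
have ky := rintegrable_frac_ker_left g01 yab.
have abE : `[a, b] `&` `[x, b] = `[x, b]%classic :> set R.
  by apply/setIidr; apply: subset_itvr; rewrite bnd_simp.
have kp : rintegrable `[a, b] ((fun t => frac_ker g (y - t)) \_ `[x, b]).
  rewrite /rintegrable -restrict_EFin; apply/integrable_restrict => //; rewrite abE.
  by apply: rintegrable_frac_ker_left => //; rewrite (ltW xy).
have kxy := rintegrableB (measurable_itv _) kx ky.
have k2 := rintegrableZl 2 (measurable_itv _) kp.
apply: (@le_trans _ _ (\int[mu]_(t in `[a, b]) ((frac_ker g (x - t) - frac_ker g (y - t))
   + 2 * ((fun t => frac_ker g (y - t)) \_ `[x, b]) t))).
  apply: le_Rintegral => //.
  - exact: integrable_norm (rintegrableB (measurable_itv _) ky kx).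
  - exact: rintegrableD.
  move=> t; rewrite /= in_itv/= => /andP[at_ tb]; rewrite patchE.
  case: ifPn => [_|].
    rewrite (le_trans (ler_normB _ _))// !ger0_norm ?frac_ker_ge0//; lra.
  rewrite notin_setE/= in_itv/= tb andbT => /negP; rewrite -ltNge => tx.
  rewrite mulr0 addr0 distrC ger0_norm// subr_ge0; apply: frac_ker_nincr => //.
    by rewrite subr_gt0.
  by rewrite lerD2r ltW.
rewrite RintegralD// RintegralB// RintegralZl// -Rintegral_mkcondr abE.
rewrite !Rintegral_frac_ker_left ?(ltW xy)//.
rewrite gerDr subr_le0; apply: frac_prim_ndecr; rewrite ?subr_ge0//.
by rewrite lerD2r ltW.
Qed.

(** Mirror image of [frac_ker_left_modulus]: for [t > y] the kernel of the nearer point [y]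
    dominates, so [x] and [y] exchange roles and the kernel of [x] on [x, y] is counted twice. *)
Lemma frac_ker_right_modulus a b g x y : 0 <= g < 1 -> a <= x -> x < y -> y <= b ->
  \int[mu]_(t in `[a, b]) `|frac_ker g (t - y) - frac_ker g (t - x)|
    <= 2 * frac_prim g (y - x).
Proof.
move=> g01 ax xy yb; have /andP[g0 g1] := g01.
have xab : a <= x <= b by rewrite ax (le_trans (ltW xy)).
have yab : a <= y <= b by rewrite yb (le_trans ax (ltW xy)).
have kx := rintegrable_frac_ker_right g01 xab.
have ky := rintegrable_frac_ker_right g01 yab.
have abE : `[a, b] `&` `[a, y] = `[a, y]%classic :> set R.
  by apply/setIidr; apply: subset_itvl; rewrite bnd_simp.
have kp : rintegrable `[a, b] ((fun t => frac_ker g (t - x)) \_ `[a, y]).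
  rewrite /rintegrable -restrict_EFin; apply/integrable_restrict => //; rewrite abE.
  by apply: rintegrable_frac_ker_right => //; rewrite ax (ltW xy).
have kxy := rintegrableB (measurable_itv _) ky kx.
have k2 := rintegrableZl 2 (measurable_itv _) kp.
apply: (@le_trans _ _ (\int[mu]_(t in `[a, b]) ((frac_ker g (t - y) - frac_ker g (t - x))
   + 2 * ((fun t => frac_ker g (t - x)) \_ `[a, y]) t))).
  apply: le_Rintegral => //.
  - exact: integrable_norm kxy.
  - exact: rintegrableD.
  move=> t; rewrite /= in_itv/= => /andP[at_ tb]; rewrite patchE.
  case: ifPn => [_|].
    rewrite (le_trans (ler_normB _ _))// !ger0_norm ?frac_ker_ge0//; lra.
  rewrite notin_setE/= in_itv/= at_ /= => /negP; rewrite -ltNge => yt.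
  rewrite mulr0 addr0 ger0_norm// subr_ge0; apply: frac_ker_nincr => //.
    by rewrite subr_gt0.
  by rewrite lerD2l lerN2 ltW.
rewrite RintegralD// RintegralB// RintegralZl// -Rintegral_mkcondr abE.
rewrite (Rintegral_frac_ker_right g01 yab) (Rintegral_frac_ker_right g01 xab).
rewrite Rintegral_frac_ker_right ?ax ?(ltW xy)//.
rewrite gerDr subr_le0; apply: frac_prim_ndecr; rewrite ?subr_ge0//.
by rewrite lerD2l lerN2 ltW.
Qed.

Lemma frac_modulus_cvg0 g : g < 1 -> 2 * frac_prim g s @[s --> 0^'+] --> (0 : R).
Proof.
move=> g1; rewrite -[X in _ --> X](mulr0 2); apply: cvgMl_tmp.
exact: frac_prim_cvg0.
Qed.

Lemma continuous_fint_left a b g f : 0 <= g < 1 -> bounded_mfun `[a, b] f ->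
  {within `[a, b], continuous (fint_left a b g f)}.
Proof.
move=> g01 bf; have /andP[_ g1] := g01.
apply: (@continuous_Rintegral_kernel _ _ _ (fun x t => frac_ker g (x - t))
  (fun s => 2 * frac_prim g s)) => //.
- by move=> x /= xab; apply: rintegrable_frac_ker_left; rewrite ?in_itv in xab.
- by move=> x y; exact: frac_ker_left_modulus.
- exact: frac_modulus_cvg0.
Qed.

Lemma continuous_fint_right a b g f : 0 <= g < 1 -> bounded_mfun `[a, b] f ->
  {within `[a, b], continuous (fint_right a b g f)}.
Proof.
move=> g01 bf; have /andP[_ g1] := g01.
apply: (@continuous_Rintegral_kernel _ _ _ (fun x t => frac_ker g (t - x))
  (fun s => 2 * frac_prim g s)) => //.
- by move=> x /= xab; apply: rintegrable_frac_ker_right; rewrite ?in_itv in xab.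
- by move=> x y; exact: frac_ker_right_modulus.
- exact: frac_modulus_cvg0.
Qed.

Lemma fint_left_lin a b g f h r s x : 0 <= g < 1 ->
  bounded_mfun `[a, b] f -> bounded_mfun `[a, b] h -> a <= x <= b ->
  fint_left a b g (fun t => r * f t + s * h t) x =
  r * fint_left a b g f x + s * fint_left a b g h x.
Proof.
move=> g01 bf bh xab; have ki := rintegrable_frac_ker_left g01 xab.
have mab : measurable (`[a, b]%classic : set (measurableTypeR R)) by exact: measurable_itv.
rewrite -(Rintegral_lin r s mab (rintegrable_mul_bounded mab ki bf)
  (rintegrable_mul_bounded mab ki bh)).
by apply: eq_Rintegral => t _; ring.
Qed.

Lemma fint_right_lin a b g f h r s x : 0 <= g < 1 ->
  bounded_mfun `[a, b] f -> bounded_mfun `[a, b] h -> a <= x <= b ->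
  fint_right a b g (fun t => r * f t + s * h t) x =
  r * fint_right a b g f x + s * fint_right a b g h x.
Proof.
move=> g01 bf bh xab; have ki := rintegrable_frac_ker_right g01 xab.
have mab : measurable (`[a, b]%classic : set (measurableTypeR R)) by exact: measurable_itv.
rewrite -(Rintegral_lin r s mab (rintegrable_mul_bounded mab ki bf)
  (rintegrable_mul_bounded mab ki bh)).
by apply: eq_Rintegral => t _; ring.
Qed.

(** Moves the cut-off from the integrand to the domain, the form in which the identities for [x]
    inside, before or beyond [p, q] apply. *)
Lemma fint_left_restrict a b p q g f x : a <= p -> q <= b ->
  fint_left a b g (f \_ `[p, q]) x = fint_left p q g f x.
Proof.
move=> ap qb; rewrite /fint_left.
have -> : `[p, q]%classic = `[a, b] `&` `[p, q] :> set R.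
  by apply/esym/setIidr; apply: subset_itv; rewrite bnd_simp.
rewrite Rintegral_mkcondr; apply: eq_Rintegral => t tab.
by rewrite !patchE in_setI tab/=; case: ifP; rewrite // mulr0.
Qed.

Lemma fint_right_restrict a b p q g f x : a <= p -> q <= b ->
  fint_right a b g (f \_ `[p, q]) x = fint_right p q g f x.
Proof.
move=> ap qb; rewrite /fint_right.
have -> : `[p, q]%classic = `[a, b] `&` `[p, q] :> set R.
  by apply/esym/setIidr; apply: subset_itv; rewrite bnd_simp.
rewrite Rintegral_mkcondr; apply: eq_Rintegral => t tab.
by rewrite !patchE in_setI tab/=; case: ifP; rewrite // mulr0.
Qed.

Lemma fint_left_in p q g f x : p <= x <= q ->
  fint_left p q g f x = RLleft_int p g f x.
Proof.
move=> /andP[px xq]; rewrite /RLleft_int.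
have -> : `[p, x]%classic = `[p, q] `&` `[p, x] :> set R.
  by apply/esym/setIidr; apply: subset_itvl; rewrite bnd_simp.
rewrite Rintegral_mkcondr; apply: eq_Rintegral => t; rewrite inE/= in_itv/= => /andP[pt tq].
rewrite patchE; case: ifPn; rewrite ?inE ?notin_setE/= in_itv/= pt/=.
  by move=> tx; rewrite frac_kerE ?subr_ge0.
by move=> /negP; rewrite -ltNge => xt; rewrite frac_kerN ?mul0r// subr_lt0.
Qed.

Lemma fint_right_in p q g f x : p <= x <= q ->
  fint_right p q g f x = RLright_int g q f x.
Proof.
move=> /andP[px xq]; rewrite /RLright_int.
have -> : `[x, q]%classic = `[p, q] `&` `[x, q] :> set R.
  by apply/esym/setIidr; apply: subset_itvr; rewrite bnd_simp.
rewrite Rintegral_mkcondr; apply: eq_Rintegral => t; rewrite inE/= in_itv/= => /andP[pt tq].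
rewrite patchE; case: ifPn; rewrite ?inE ?notin_setE/= in_itv/= tq ?andbT.
  by move=> tx; rewrite frac_kerE ?subr_ge0.
by move=> /negP; rewrite -ltNge => xt; rewrite frac_kerN ?mul0r// subr_lt0.
Qed.

(** Each [t > p] lies to the right of [x], where the kernel vanishes. At [t = x = p] it is 1 when
    [g = 0], hence a singleton rather than the empty set. *)
Lemma fint_left_out p q g f x : x <= p -> fint_left p q g f x = 0.
Proof.
move=> xp; have [pq|qp] := leP p q; last first.
  by rewrite /fint_left set_itv_ge ?bnd_simp -?ltNge// Rintegral_set0.
rewrite (_ : fint_left _ _ _ _ _ = \int[mu]_(t in [set p]) (frac_ker g (x - t) * f t)).
  exact: Rintegral_set1.
have -> : [set p] = `[p, q] `&` [set p] :> set R.
  by apply/esym/setIidr => _ ->; rewrite /= in_itv/= lexx.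
rewrite Rintegral_mkcondr; apply: eq_Rintegral => t; rewrite inE/= in_itv/= => /andP[pt tq].
rewrite patchE; case: ifPn => //; rewrite notin_setE/= => /eqP tp.
by rewrite frac_kerN ?mul0r// subr_lt0 (le_lt_trans xp)// lt_neqAle eq_sym tp.
Qed.

Lemma fint_right_out p q g f x : q <= x -> fint_right p q g f x = 0.
Proof.
move=> qx; have [pq|qp] := leP p q; last first.
  by rewrite /fint_right set_itv_ge ?bnd_simp -?ltNge// Rintegral_set0.
rewrite (_ : fint_right _ _ _ _ _ = \int[mu]_(t in [set q]) (frac_ker g (t - x) * f t)).
  exact: Rintegral_set1.
have -> : [set q] = `[p, q] `&` [set q] :> set R.
  by apply/esym/setIidr => _ ->; rewrite /= in_itv/= lexx andbT.
rewrite Rintegral_mkcondr; apply: eq_Rintegral => t; rewrite inE/= in_itv/= => /andP[pt tq].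
rewrite patchE; case: ifPn => //; rewrite notin_setE/= => /eqP tp.
by rewrite frac_kerN ?mul0r// subr_lt0 (lt_le_trans _ qx)// lt_neqAle tp.
Qed.

Lemma rintegrable_RLleft g p x f : 0 <= g < 1 -> p <= x ->
  bounded_mfun `[p, x] f -> rintegrable `[p, x] (fun t => (x - t) `^ (- g) * f t).
Proof.
move=> g01 px bf.
have := rintegrable_mul_bounded (measurable_itv _)
  (@rintegrable_frac_ker_left p x g x g01 _) bf.
rewrite px lexx => /(_ isT); apply: eq_rintegrable => //.
by move=> t; rewrite inE/= in_itv/= => /andP[_ tx]; rewrite frac_kerE// subr_ge0.
Qed.

Lemma rintegrable_RLright g x q f : 0 <= g < 1 -> x <= q ->
  bounded_mfun `[x, q] f -> rintegrable `[x, q] (fun t => (t - x) `^ (- g) * f t).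
Proof.
move=> g01 px bf.
have := rintegrable_mul_bounded (measurable_itv _)
  (@rintegrable_frac_ker_right x q g x g01 _) bf.
rewrite px lexx => /(_ isT); apply: eq_rintegrable => //.
by move=> t; rewrite inE/= in_itv/= => /andP[tx _]; rewrite frac_kerE// subr_ge0.
Qed.

(** Beyond [q] the integral keeps the memory of [p, q] only, which is the difference of the
    integrals started at [p] and at [q]; this produces the difference in the third equation. *)
Lemma fint_left_split p q g f x : 0 <= g < 1 -> p <= q -> q <= x ->
  bounded_mfun `[p, x] f ->
  fint_left p q g f x = RLleft_int p g f x - RLleft_int q g f x.
Proof.
move=> g01 pq qx bf.
have px := le_trans pq qx.
have fi := rintegrable_RLleft g01 px bf.
have fi' : rintegrable `[q, x] (fun t => (x - t) `^ (- g) * f t).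
  by apply: rintegrableS fi => //; apply: subset_itvr; rewrite bnd_simp.
have -> : fint_left p q g f x = \int[mu]_(t in `[p, q]) ((x - t) `^ (- g) * f t).
  apply: eq_Rintegral => t; rewrite inE/= in_itv/= => /andP[pt tq].
  by rewrite frac_kerE// subr_ge0 (le_trans tq).
rewrite /RLleft_int -(Rintegral_itv_obnd_cbnd (r := q)); last first.
  by apply: rintegrableS fi' => //; exact: subset_itv_oc_cc.
rewrite -(Rintegral_itvB (a := BLeft p) (b := BRight x) (x := q)) ?bnd_simp//.
by rewrite opprB addrC subrK.
Qed.

Lemma fint_right_split p q g f x : 0 <= g < 1 -> x <= p -> p <= q ->
  bounded_mfun `[x, q] f ->
  fint_right p q g f x = RLright_int g q f x - RLright_int g p f x.
Proof.
move=> g01 xp pq bf.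
have xq := le_trans xp pq.
have fi := rintegrable_RLright g01 xq bf.
have fi' : rintegrable `[p, q] (fun t => (t - x) `^ (- g) * f t).
  by apply: rintegrableS fi => //; apply: subset_itvr; rewrite bnd_simp.
have -> : fint_right p q g f x = \int[mu]_(t in `[p, q]) ((t - x) `^ (- g) * f t).
  apply: eq_Rintegral => t; rewrite inE/= in_itv/= => /andP[pt tq].
  by rewrite frac_kerE// subr_ge0 (le_trans xp).
rewrite /RLright_int -(Rintegral_itv_obnd_cbnd (r := p)); last first.
  by apply: rintegrableS fi' => //; exact: subset_itv_oc_cc.
by rewrite -(Rintegral_itvB (a := BLeft x) (b := BRight q) (x := p)) ?bnd_simp.
Qed.

End FractionalIntegrals.

(** * Derivability of a continuous function is a Borel property *)

Section Clamp.
Context {R : realType}.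
Implicit Types (f : R -> R) (a b x : R).

(* The projection of the line onto [a, b]. *)
Definition clamp a b x : R := (a + b + `|x - a| - `|x - b|) / 2.

Lemma clamp_id a b x : a <= x <= b -> clamp a b x = x.
Proof.
move=> /andP[ax xb]; rewrite /clamp ger0_norm ?subr_ge0// ler0_norm ?subr_le0//.
by lra.
Qed.

Lemma clamp_itv a b x : a <= b -> a <= clamp a b x <= b.
Proof.
move=> ab; rewrite /clamp.
have [xa|ax] := ler0P (x - a); have [xb|bx] := ler0P (x - b); lra.
Qed.

Lemma continuous_clamp a b : continuous (clamp a b).
Proof.
move=> x; apply: cvgMr_tmp; apply: cvgB.
  apply: cvgD; first exact: cvg_cst.
  by apply: cvg_norm; apply: cvgB => //; exact: cvg_cst.
by apply: cvg_norm; apply: cvgB => //; exact: cvg_cst.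
Qed.

(** Extending by the boundary values trades continuity within [a, b] for continuity on the line, as
    required of directions [w] and by [measurable_derivable]. *)
Lemma continuous_comp_clamp a b f : a <= b ->
  {within `[a, b], continuous f} -> continuous (f \o clamp a b).
Proof.
move=> ab /subspace_continuousP cf x.
have cx : `[a, b]%classic (clamp a b x) by rewrite /= in_itv/= clamp_itv.
apply: (@cvg_comp _ _ _ (clamp a b) f _ (within `[a, b] (nbhs (clamp a b x)))).
  move=> A wA.
  have H : \forall z \near x, `[a, b]%classic (clamp a b z) -> A (clamp a b z).
    exact: continuous_clamp wA.
  change (\forall z \near x, A (clamp a b z)).
  by apply: filterS H => z; apply; rewrite /= in_itv/= clamp_itv.
exact: cf.
Qed.

End Clamp.

Section Derivability.
Context {R : realType}.
Implicit Types (f : R -> R) (a b t : R).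

(** The Cauchy criterion removes the unknown limit. Radii [1 / (m + 1)] keep the outer quantifiers
    countable, and the non-strict bound gives a closed condition on [t] for fixed [h], [k]. *)
Lemma derivable_cauchyP f t : derivable f t 1 <->
  forall n, exists m, forall h k : R, 0 < `|h| < m.+1%:R^-1 -> 0 < `|k| < m.+1%:R^-1 ->
    `|(f (h + t) - f t) / h - (f (k + t) - f t) / k| <= n.+1%:R^-1.
Proof.
have qE h : h^-1 *: (f (h *: 1 + t) - f t) = (f (h + t) - f t) / h.
  by rewrite /GRing.scale/= mulr1 mulrC.
split=> [ft n|H].
- have e0 : 0 < n.+1%:R^-1 / 2 :> R by rewrite divr_gt0// invr_gt0.
  have /cvg_ex[/= l /cvgrPdist_le/(_ _ e0)[d /= d0 dl]] := ft.
  have [m md] : exists m, m.+1%:R^-1 < d.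
    by have [m] := ltr_add_invr (y := 0) d0; rewrite add0r; exists m.
  exists m => h k /andP[h0 hm] /andP[k0 km].
  have := dl h; rewrite /ball_/= sub0r normrN -normr_gt0 qE.
  move=> /(_ (lt_trans hm md) h0) h1.
  have := dl k; rewrite /ball_/= sub0r normrN -normr_gt0 qE.
  move=> /(_ (lt_trans km md) k0) h2.
  rewrite (splitr n.+1%:R^-1) -(subrKA l).
  by rewrite (le_trans (ler_normD _ _))// lerD// distrC.
- apply/cauchy_cvgP; apply: cauchy_exP => e e0.
  have [n ne] : exists n, n.+1%:R^-1 < e.
    by have [n] := ltr_add_invr (y := 0) e0; rewrite add0r; exists n.
  have [m Hm] := H n.
  (* Any admissible increment would do: its difference quotient is the centre of the ball required
     by the Cauchy property. *)
  pose k : R := m.+1%:R^-1 / 2.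
  have k0 : 0 < k by rewrite divr_gt0// invr_gt0.
  exists ((f (k + t) - f t) / k).
  exists (m.+1%:R^-1) => /=; first by rewrite invr_gt0.
  move=> h /=; rewrite sub0r normrN => hm h0.
  apply: (le_lt_trans _ ne); rewrite qE; apply: Hm.
    rewrite gtr0_norm// k0/= /k ltr_pdivrMr// ltr_pMr ?invr_gt0//; lra.
  by rewrite normr_gt0 h0.
Qed.

(** By the Cauchy criterion the set is a countable intersection of countable unions of closed sets;
    the intersection over the increments is uncountable, but of closed sets. *)
Lemma measurable_derivable f : continuous f ->
  measurable [set t | derivable f t 1].
Proof.
move=> cf; rewrite (_ : [set t | _] = \bigcap_n \bigcup_m
   \bigcap_(z in [set z : R * R | 0 < `|z.1| < m.+1%:R^-1 /\ 0 < `|z.2| < m.+1%:R^-1])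
     [set t | `|(f (z.1 + t) - f t) / z.1 - (f (z.2 + t) - f t) / z.2| <= n.+1%:R^-1]).
  apply: bigcapT_measurable => n; apply: bigcupT_measurable => m.
  apply: closed_measurable; apply: closed_bigI => z _.
  apply: (@preimage_closed _ _
    (fun t => `|(f (z.1 + t) - f t) / z.1 - (f (z.2 + t) - f t) / z.2|)
    [set x | x <= n.+1%:R^-1]); last exact: closed_le.
  move=> t _.
  have c1 h : continuous (fun t => (f (h + t) - f t) / h).
    move=> s; apply: cvgMr_tmp; apply: cvgB; last exact: cf.
    apply: continuous_comp; last exact: cf.
    by apply: cvgD => //; exact: cvg_cst.
  by apply: cvg_norm; apply: cvgB; exact: c1.
apply/seteqP; split => t /=.
  by move=> /derivable_cauchyP H n _; have [m Hm] := H n; exists m => // -[h k]/= []; exact: Hm.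
move=> H; apply/derivable_cauchyP => n; have [//|m _ Hm] := H n; exists m => h k hm km.
exact: (Hm (h, k)).
Qed.

Lemma derive1_ndv f t : ~ derivable f t 1 -> derive1 f t = 0.
Proof. by move=> nd; rewrite derive1E /derive dvgP. Qed.

(** Inside []a, b[], [f] agrees locally with its continuous clamped extension. At [a] and [b]
    derivability depends on values of [f] outside the interval, but these are only two points. *)
Lemma measurable_derivable_itv a b f : a <= b -> {within `[a, b], continuous f} ->
  measurable (`[a, b] `&` [set t | derivable f t 1]).
Proof.
move=> ab cf.
have m1 x (A : set R) : measurable ([set x] `&` A).
  have [Ax|Ax] := pselect (A x).
    rewrite (_ : _ `&` _ = [set x]); first exact: measurable_set1.
    by apply/seteqP; split => [z []//|z ->].
  rewrite (_ : _ `&` _ = set0); first exact: measurable0.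
  by apply/seteqP; split => [z [->]//|z].
have -> : `[a, b] `&` [set t | derivable f t 1] =
  (`]a, b[ `&` [set t | derivable (f \o clamp a b) t 1]) `|`
  ([set a] `&` [set t | derivable f t 1]) `|` ([set b] `&` [set t | derivable f t 1]).
  have E t : t \in `]a, b[ -> {near t, f =1 f \o clamp a b}.
    move=> tab; have := near_in_itvoo tab; apply: filterS => s; rewrite in_itv/= => /andP[as_ sb].
    by rewrite clamp_id// !ltW.
  have E' t : t \in `]a, b[ -> derivable f t 1 <-> derivable (f \o clamp a b) t 1.
    move=> tab; split; apply: near_eq_derivable; first exact: E.
    by have := E _ tab; apply: filterS => s ->.
  apply/seteqP; split => t /=.
    move=> [tab ft]; have [ta|ta] := eqVneq t a; first by left; right.
    have [tb|tb] := eqVneq t b; first by right.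
    have tab' : t \in `]a, b[.
      move: tab; rewrite !in_itv/= => /andP[at_ tb'].
      by rewrite !lt_neqAle at_ tb' tb eq_sym ta.
    by left; left; split; [exact: tab'|exact: (proj1 (E' _ tab') ft)].
  move=> [[[tab ft]|[ta ft]]|[tb ft]]; split.
  - exact: subset_itv_oo_cc.
  - exact: (proj2 (E' _ tab) ft).
  - by rewrite ta in_itv/= lexx.
  - exact: ft.
  - by rewrite tb in_itv/= lexx ab.
  - exact: ft.
apply: measurableU; [|exact: m1]. apply: measurableU; [|exact: m1].
apply: measurableI; first exact: measurable_itv.
by apply: measurable_derivable; exact: continuous_comp_clamp.
Qed.

End Derivability.

(** * Perturbation by a primitive *)

Section Primitive.
Context {R : realType}.
Local Notation mu := (@lebesgue_measure R).
Implicit Types (y w : R -> R) (a b t x g : R).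

(* Starting from [a - 1] makes the derivative at [a] a two-sided one. *)
Definition prim a w x : R :=
  \int[mu]_(t in `[a - 1, x]) w t - \int[mu]_(t in `[a - 1, a]) w t.

Lemma bounded_mfun_continuous a b w : continuous w -> bounded_mfun `[a, b] w.
Proof.
by move=> cw; apply: bounded_mfun_within_continuous; exact: continuous_subspaceT.
Qed.

Lemma rintegrable_continuous a b w : continuous w -> rintegrable `[a, b] w.
Proof. by move=> cw; apply: rintegrable_bounded_itv; exact: bounded_mfun_continuous. Qed.

Lemma is_derive_prim a w x : continuous w -> a - 1 < x -> is_derive x 1 (prim a w) (w x).
Proof.
move=> cw ax.
have xx1 : x < x + 1 by rewrite ltrDl.
have [dF F'] := continuous_FTC1_closed xx1
  (rintegrable_continuous (a - 1) (x + 1) cw) ax (cw x).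
rewrite -[X in is_derive _ _ _ X]subr0; apply: is_deriveB.
by apply: DeriveDef; [exact: dF|rewrite -derive1E; exact: F'].
Qed.

Lemma prim_id a w : prim a w a = 0.
Proof. by rewrite /prim subrr. Qed.

Lemma primB a w u v : continuous w -> a <= u -> u <= v ->
  prim a w v - prim a w u = \int[mu]_(t in `[u, v]) w t.
Proof.
move=> cw au uv; rewrite /prim opprB addrA subrK Rintegral_itvB ?bnd_simp//.
- rewrite Rintegral_itv_obnd_cbnd//.
  apply: rintegrableS (rintegrable_continuous u v cw) => //.
  exact: subset_itv_oc_cc.
- exact: rintegrable_continuous.
- by rewrite lerBlDr (le_trans au)// lerDl.
Qed.

Lemma primE a w x : continuous w -> a <= x -> prim a w x = \int[mu]_(t in `[a, x]) w t.
Proof. by move=> cw ax; rewrite -(primB cw (lexx a) ax) prim_id subr0. Qed.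

(** Order 0 puts the direction itself on the same footing as its Caputo derivatives. *)
Lemma prim_fint a b w x : continuous w -> a <= x <= b -> prim a w x = fint_left a b 0 w x.
Proof.
move=> cw /[dup] xab /andP[ax xb]; rewrite primE// fint_left_in//.
by apply: eq_Rintegral => t _; rewrite oppr0 powRr0 mul1r.
Qed.

Lemma prim_lin a w1 w2 r s x : continuous w1 -> continuous w2 ->
  prim a (fun t => r * w1 t + s * w2 t) x = r * prim a w1 x + s * prim a w2 x.
Proof.
move=> c1 c2; rewrite /prim !Rintegral_lin//; try exact: rintegrable_continuous.
by ring.
Qed.

Lemma continuous_lin w1 w2 r s : continuous w1 -> continuous w2 ->
  continuous (fun t => r * w1 t + s * w2 t).
Proof.
by move=> c1 c2 t; apply: cvgD; apply: cvgMl_tmp; [exact: c1|exact: c2].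
Qed.

Lemma abs_continuous_add_prim a b y w : a <= b -> continuous w ->
  abs_continuous a b y -> abs_continuous a b (fun x => y x + prim a w x).
Proof.
move=> ab cw acy.
have [M M0 hM] := bounded_mfun_gt0 (bounded_mfun_continuous a b cw).
have lip u v : a <= u -> u <= v -> v <= b -> `|prim a w v - prim a w u| <= M * (v - u).
  move=> au uv vb.
  rewrite primB//.
  apply: le_normr_Rintegral_bound => //; first exact: rintegrable_continuous.
  move=> x xuv; apply: hM; move: x xuv; apply: subset_itv; by rewrite bnd_simp.
move=> e e0; have e20 : 0 < e / 2 by rewrite divr_gt0.
have [d d0 hd] := acy _ e20.
exists (Num.min d (e / 2 / M)); first by rewrite lt_min d0 divr_gt0.
move=> n u v huv tI; rewrite lt_min => /andP[sd sM].
have h1 := hd n u v huv tI sd.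
rewrite (splitr e); apply: le_lt_trans (ltrD h1 _); last first.
  by move: sM; rewrite ltr_pdivlMr// mulrC; exact.
rewrite mulr_sumr -big_split/=; apply: ler_sum => i _.
have [au [uv vb]] := huv i.
rewrite opprD addrACA (le_trans (ler_normD _ _))// lerD2l; exact: lip.
Qed.

(** Where [y] is not derivable, neither is the sum, since the primitive is; both derivatives then
    take the default value 0. With [w] cut off, the identity holds at every such [t], not just
    almost everywhere. *)
Lemma derive1_add_prim a y w t : continuous w -> a - 1 < t ->
  derive1 (fun x => y x + prim a w x) t =
  derive1 y t + (w \_ [set t | derivable y t 1]) t.
Proof.
move=> cw at_; have dp := is_derive_prim cw at_.
have dp1 : derivable (prim a w) t 1 by case: dp.
rewrite patchE; case: ifPn; rewrite ?inE ?notin_setE/= => dy.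
  by rewrite !derive1E (deriveD dy dp1) (@derive_val _ _ _ _ _ _ _ dp).
have ndp : ~ derivable (fun x => y x + prim a w x) t 1.
  move=> dyp; apply: dy; have := derivableB dyp dp1.
  rewrite (_ : _ - _ = y); first exact.
  by apply/funext => x /=; rewrite !fctE addrK.
by rewrite (derive1_ndv dy) (derive1_ndv ndp) addr0.
Qed.

Lemma ae_neq t : {ae mu, forall x, x != t}.
Proof.
exists [set t]; split; [exact: measurable_set1|exact: lebesgue_measure_set1|].
by move=> x /= /negP/negPn/eqP.
Qed.

(* Measurability is with respect to the Borel sets, so a null set cannot be
   ignored; but [derive1] is [0] where [y] is not derivable, whence the
   restriction of [w] in [derive1_add_prim]. *)
Lemma integral_derive1_add_prim a b (S : set (measurableTypeR R)) (k y w : R -> R) :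
  a <= b -> measurable S -> S `<=` `[a, b] -> continuous w ->
  {within `[a, b], continuous y} ->
  {ae mu, forall t, t \in `]a, b[ -> derivable y t 1} ->
  rintegrable S k -> rintegrable S (fun t => k t * derive1 y t) ->
  rintegrable S (fun t => k t * derive1 (fun x => y x + prim a w x) t) /\
  \int[mu]_(t in S) (k t * derive1 (fun x => y x + prim a w x) t) =
  \int[mu]_(t in S) (k t * derive1 y t) + \int[mu]_(t in S) (k t * w t).
Proof.
move=> ab mS Sab cw cy aey ik iky.
pose w' := w \_ (`[a, b] `&` [set t | derivable y t 1]).
have E : {in S, (fun t => k t * derive1 y t + k t * w' t) =1
    (fun t => k t * derive1 (fun x => y x + prim a w x) t)}.
  move=> t; rewrite inE => /Sab tab.
  rewrite derive1_add_prim//; last first.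
    by move: tab; rewrite /= in_itv/= => /andP[? _]; lra.
  by rewrite /w' !patchE in_setI mem_set// mulrDr.
have mD := measurable_derivable_itv ab cy.
have bw' : bounded_mfun S w'.
  apply: (bounded_mfunS (E := `[a, b]) _ Sab) => //.
  apply: bounded_mfun_restrict => //.
  apply: bounded_mfunS (bounded_mfun_continuous a b cw) => //.
have ikw' : rintegrable S (fun t => k t * w' t) by exact: rintegrable_mul_bounded.
have ikw : rintegrable S (fun t => k t * w t).
  apply: rintegrable_mul_bounded => //.
  by apply: (bounded_mfunS (E := `[a, b]) _ Sab) => //; exact: bounded_mfun_continuous.
split; first by apply: eq_rintegrable E _ => //; exact: rintegrableD.
rewrite -(eq_Rintegral _ E) RintegralD//; congr (_ + _); congr fine.
(* On [S], [w'] can differ from [w] only at [a], at [b] and on the null set where [y] is not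
   derivable. *)
apply: ae_eq_integral => //.
- by apply/measurable_EFinP; exact: rintegrable_measurable ikw'.
- by apply/measurable_EFinP; exact: rintegrable_measurable ikw.
- have F : Filter (almost_everywhere mu) := ae_filter_ringOfSetsType mu.
  move: aey (ae_neq a) (ae_neq b); apply: (@filterS3 _ _ F) => t dy ta tb St.
  have tab : t \in `]a, b[.
    have := Sab _ St; rewrite /= !in_itv/= => /andP[h1 h2].
    by rewrite !lt_neqAle h1 h2 tb eq_sym ta.
  rewrite /w' patchE mem_set//; split; [exact: Sab|exact: dy].
Qed.

End Primitive.

(** * Stability of the function space under these perturbations *)

Section EspaceAddPrim.
Context {R : realType}.
Local Notation mu := (@lebesgue_measure R).
Implicit Types (y w : R -> R) (a b t x g : R).

Lemma abs_continuous_within a b y : abs_continuous a b y ->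
  {within `[a, b], continuous y}.
Proof.
move=> acy; apply/subspace_continuousP => x xab; apply/cvgrPdist_lt => e e0.
have [d d0 hd] := acy e e0.
rewrite near_withinE; near=> z => zab.
have zd : `|x - z| < d by near: z; exact: (@cvgr_dist_lt _ _ _ _ _ id x).
rewrite /from_subspace.
(* Absolute continuity is applied to a single interval, for which disjointness is trivial. *)
have tI1 (A : 'I_1 -> set R) : trivIset setT A by move=> i j _ _ _; rewrite !ord1.
move: xab zab; rewrite /= !in_itv/= => /andP[ax xb] /andP[az zb].
have [xz|zx] := leP x z.
  rewrite distrC.
  have := hd 1%N (fun=> x) (fun=> z) _ (tI1 _); rewrite !big_ord1; apply => //.
  by move: zd; rewrite distrC ger0_norm ?subr_ge0.
have := hd 1%N (fun=> z) (fun=> x) _ (tI1 _); rewrite !big_ord1; apply.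
  by move=> _; rewrite (ltW zx).
by move: zd; rewrite gtr0_norm ?subr_gt0.
Unshelve. all: by end_near. Qed.

Lemma rintegrable_powR_left g p x : 0 <= g < 1 -> p <= x ->
  rintegrable `[p, x] (fun t => (x - t) `^ (- g)).
Proof.
move=> g01 px; have := rintegrable_RLleft g01 px (bounded_mfun_cst _ 1).
by apply: eq_rintegrable => // t _; rewrite mulr1.
Qed.

Lemma rintegrable_powR_right g x q : 0 <= g < 1 -> x <= q ->
  rintegrable `[x, q] (fun t => (t - x) `^ (- g)).
Proof.
move=> g01 px; have := rintegrable_RLright g01 px (bounded_mfun_cst _ 1).
by apply: eq_rintegrable => // t _; rewrite mulr1.
Qed.

(** On []a, b]] this is linearity of the integral. At [a] the Caputo derivative is a limit: the
    fractional integral of [w] is continuous and vanishes at [a], so the value there is unchanged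
    and the formula persists. *)
Lemma Cleft_add_prim a b g y w : a < b -> 0 <= g < 1 ->
  {within `[a, b], continuous y} ->
  {ae mu, forall t, t \in `]a, b[ -> derivable y t 1} ->
  Cleft_exists a g b y -> {within `[a, b], continuous (Cleft a g y)} ->
  continuous w ->
  [/\ Cleft_exists a g b (fun x => y x + prim a w x),
      {in `[a, b], Cleft a g (fun x => y x + prim a w x) =1
        (fun x => Cleft a g y x + 1 / Gamma (1 - g) * fint_left a b g w x)} &
      {within `[a, b], continuous (Cleft a g (fun x => y x + prim a w x))}].
Proof.
move=> ab g01 cy aey [iy cvy] cCy cw.
set h := (fun x => y x + prim a w x).
have bw : bounded_mfun `[a, b] w by exact: bounded_mfun_continuous.
have cw' := continuous_fint_left g01 bw.
have step x : x \in `]a, b] ->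
    mu.-integrable `[a, x] (fun t => ((x - t) `^ (- g) * derive1 h t)%:E) /\
    Cleft_int a g h x = Cleft_int a g y x + 1 / Gamma (1 - g) * fint_left a b g w x.
  rewrite in_itv/= => /andP[ax xb].
  have [] := @integral_derive1_add_prim R a b `[a, x] (fun t => (x - t) `^ (- g))
    y w (ltW ab) (measurable_itv _) _ cw cy aey _ _.
  - by apply: subset_itvl; rewrite bnd_simp.
  - by apply: rintegrable_powR_left => //; exact: ltW.
  - by apply: iy; rewrite in_itv/= ax.
  move=> i1 e1; split; first exact: i1.
  rewrite /Cleft_int e1 mulrDr; congr (_ + _ * _).
  by rewrite fint_left_in ?(ltW ax)// xb.
have neq : \forall t \near a^'+, Cleft_int a g y t + 1 / Gamma (1 - g) * fint_left a b g w t =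
    Cleft_int a g h t.
  near=> t; apply/esym; apply: (step t _).2; rewrite in_itv/=; apply/andP; split => //.
  by near: t; exact: nbhs_right_le.
have [_ cwa _] := (continuous_within_itvP (fint_left a b g w) ab).1 cw'.
have cva : Cleft_int a g h t @[t --> a^'+] --> lim (Cleft_int a g y t @[t --> a^'+]).
  rewrite -[X in _ --> X]addr0; apply: cvg_trans; first exact: (near_eq_cvg neq).
  apply: cvgD => //.
  rewrite -(mulr0 (1 / Gamma (1 - g))) -(@fint_left_out R a b g w a)//.
  exact: cvgMl_tmp.
have E : {in `[a, b], Cleft a g h =1
        (fun x => Cleft a g y x + 1 / Gamma (1 - g) * fint_left a b g w x)}.
  have limE := cvg_lim (@norm_hausdorff _ _) cva.
  move=> x xab; have /andP[ax xb] : a <= x <= b by rewrite in_itv in xab.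
  rewrite /Cleft; have [xa|xa] := eqVneq x a.
    by rewrite xa (fint_left_out _ _ _ (lexx a)) mulr0 addr0; exact: limE.
  by apply: (step x _).2; rewrite in_itv/= xb lt_neqAle eq_sym xa ax.
split; [|exact: E|].
- split; first by move=> x /step[].
  by apply/cvg_ex; exists (lim (Cleft_int a g y t @[t --> a^'+])); exact: cva.
- apply: (@subspace_eq_continuous _ _ _
    (fun x => Cleft a g y x + 1 / Gamma (1 - g) * fint_left a b g w x)).
    by move=> x; rewrite inE => xab; rewrite /from_subspace E.
  apply: (@within_continuousD _ _ _ _ (Cleft a g y)); first exact: cCy.
  by move=> x; apply: cvgMl_tmp; exact: cw'.
Unshelve. all: by end_near. Qed.

Lemma Cright_add_prim a b g y w : a < b -> 0 <= g < 1 ->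
  {within `[a, b], continuous y} ->
  {ae mu, forall t, t \in `]a, b[ -> derivable y t 1} ->
  Cright_exists a g b y -> {within `[a, b], continuous (Cright g b y)} ->
  continuous w ->
  [/\ Cright_exists a g b (fun x => y x + prim a w x),
      {in `[a, b], Cright g b (fun x => y x + prim a w x) =1
        (fun x => Cright g b y x + -1 / Gamma (1 - g) * fint_right a b g w x)} &
      {within `[a, b], continuous (Cright g b (fun x => y x + prim a w x))}].
Proof.
move=> ab g01 cy aey [iy cvy] cCy cw.
set h := (fun x => y x + prim a w x).
have bw : bounded_mfun `[a, b] w by exact: bounded_mfun_continuous.
have cw' := continuous_fint_right g01 bw.
have step x : x \in `[a, b[ ->
    mu.-integrable `[x, b] (fun t => ((t - x) `^ (- g) * derive1 h t)%:E) /\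
    Cright_int g b h x = Cright_int g b y x + -1 / Gamma (1 - g) * fint_right a b g w x.
  rewrite in_itv/= => /andP[ax xb].
  have [] := @integral_derive1_add_prim R a b `[x, b] (fun t => (t - x) `^ (- g))
    y w (ltW ab) (measurable_itv _) _ cw cy aey _ _.
  - by apply: subset_itvr; rewrite bnd_simp.
  - by apply: rintegrable_powR_right => //; exact: ltW.
  - by apply: iy; rewrite in_itv/= ax.
  move=> i1 e1; split; first exact: i1.
  rewrite /Cright_int e1 mulrDr; congr (_ + _ * _).
  by rewrite fint_right_in ?(ltW xb)// ax.
have neq : \forall t \near b^'-, Cright_int g b y t + -1 / Gamma (1 - g) * fint_right a b g w t =
    Cright_int g b h t.
  near=> t; apply/esym; apply: (step t _).2; rewrite in_itv/=; apply/andP; split => //.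
  by near: t; exact: nbhs_left_ge.
have [_ _ cwb] := (continuous_within_itvP (fint_right a b g w) ab).1 cw'.
have cvb : Cright_int g b h t @[t --> b^'-] --> lim (Cright_int g b y t @[t --> b^'-]).
  rewrite -[X in _ --> X]addr0; apply: cvg_trans; first exact: (near_eq_cvg neq).
  apply: cvgD => //.
  rewrite -(mulr0 (-1 / Gamma (1 - g))) -(@fint_right_out R a b g w b)//.
  exact: cvgMl_tmp.
have E : {in `[a, b], Cright g b h =1
        (fun x => Cright g b y x + -1 / Gamma (1 - g) * fint_right a b g w x)}.
  have limE := cvg_lim (@norm_hausdorff _ _) cvb.
  move=> x xab; have /andP[ax xb] : a <= x <= b by rewrite in_itv in xab.
  rewrite /Cright; have [xE|xE] := eqVneq x b.
    by rewrite xE (fint_right_out _ _ _ (lexx b)) mulr0 addr0; exact: limE.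
  by apply: (step x _).2; rewrite in_itv/= ax lt_neqAle xE xb.
split; [|exact: E|].
- split; first by move=> x /step[].
  by apply/cvg_ex; exists (lim (Cright_int g b y t @[t --> b^'-])); exact: cvb.
- apply: (@subspace_eq_continuous _ _ _
    (fun x => Cright g b y x + -1 / Gamma (1 - g) * fint_right a b g w x)).
    by move=> x; rewrite inE => xab; rewrite /from_subspace E.
  apply: (@within_continuousD _ _ _ _ (Cright g b y)); first exact: cCy.
  by move=> x; apply: cvgMl_tmp; exact: cw'.
Unshelve. all: by end_near. Qed.

Lemma Espace_add_prim a b alpha beta y w : a < b ->
  0 <= alpha < 1 -> 0 <= beta < 1 -> Espace a b alpha beta y -> continuous w ->
  [/\ Espace a b alpha beta (fun x => y x + prim a w x),
      {in `[a, b], Cleft a alpha (fun x => y x + prim a w x) =1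
        (fun x => Cleft a alpha y x + 1 / Gamma (1 - alpha) * fint_left a b alpha w x)} &
      {in `[a, b], Cright beta b (fun x => y x + prim a w x) =1
        (fun x => Cright beta b y x + -1 / Gamma (1 - beta) * fint_right a b beta w x)}].
Proof.
move=> ab a01 b01 [acy aey [eL cL] [eR cR]] cw.
have cy := abs_continuous_within acy.
have [eL' EL cL'] := Cleft_add_prim ab a01 cy aey eL cL cw.
have [eR' ER cR'] := Cright_add_prim ab b01 cy aey eR cR cw.
split; [split|exact: EL|exact: ER].
- exact: abs_continuous_add_prim (ltW ab) cw acy.
- have F : Filter (almost_everywhere mu) := ae_filter_ringOfSetsType mu.
  apply: filterS aey => t dy tab; apply: derivableD; first exact: dy.
  have at_ : a - 1 < t by move: tab; rewrite in_itv/= => /andP[? _]; lra.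
  by case: (is_derive_prim cw at_).
- by split; [exact: eL'|exact: cL'].
- by split; [exact: eR'|exact: cR'].
Qed.

(** Base point for [Espace_prim]: the axioms of [is_norm_on] speak of members of the space, so the
    directions themselves must belong to it. *)
Lemma Espace0 a b alpha beta : Espace a b alpha beta (fun=> 0 : R).
Proof.
have d0 t : derive1 (fun=> 0 : R) t = 0 by rewrite derive1_cst.
have L0 : Cleft_int a alpha (fun=> 0 : R) = fun=> 0.
  apply/funext => x; rewrite /Cleft_int (_ : Rintegral _ _ _ = 0) ?mulr0//.
  by under eq_Rintegral do rewrite d0 mulr0; rewrite /Rintegral integral0_eq.
have R0 : Cright_int beta b (fun=> 0 : R) = fun=> 0.
  apply/funext => x; rewrite /Cright_int (_ : Rintegral _ _ _ = 0) ?mulr0//.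
  by under eq_Rintegral do rewrite d0 mulr0; rewrite /Rintegral integral0_eq.
have CL0 : Cleft a alpha (fun=> 0 : R) = fun=> 0.
  by apply/funext => x; rewrite /Cleft L0 lim_cst ?if_same//; exact: norm_hausdorff.
have CR0 : Cright beta b (fun=> 0 : R) = fun=> 0.
  by apply/funext => x; rewrite /Cright R0 lim_cst ?if_same//; exact: norm_hausdorff.
have i0 (k : R -> R) (S : set (measurableTypeR R)) :
    mu.-integrable S (fun t => (k t * derive1 (fun=> 0 : R) t)%:E).
  rewrite (_ : (fun t => _) = cst 0%E); first exact: integrable0.
  by apply/funext => t; rewrite d0 mulr0.
split.
- move=> e e0; exists 1 => // n u v _ _ _.
  by rewrite big1// => i _; rewrite subrr normr0.
- by apply: aeW => t _; exact: derivable_cst.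
- split; last by rewrite CL0; exact: cst_continuous.
  by split; [move=> x _; exact: i0|rewrite L0; exact: is_cvg_cst].
- split; last by rewrite CR0; exact: cst_continuous.
  by split; [move=> x _; exact: i0|rewrite R0; exact: is_cvg_cst].
Qed.

Lemma Espace_prim a b alpha beta w : a < b -> 0 <= alpha < 1 -> 0 <= beta < 1 ->
  continuous w -> Espace a b alpha beta (prim a w).
Proof.
move=> ab a01 b01 cw.
have [] := Espace_add_prim ab a01 b01 (Espace0 a b alpha beta) cw.
by rewrite (_ : (fun x => 0 + prim a w x) = prim a w)//; apply/funext => x; rewrite add0r.
Qed.

End EspaceAddPrim.

(** * Functions of class C1 along a curve *)

Section ClassC1.
Context {R : realType}.
Implicit Types (P G : R -> R -> R -> R -> R) (a b A B x y u v e : R).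

(** An epsilon-delta form with one bound per variable, suited to mean value arguments that move one
    variable at a time. *)
Definition cont4 a b G := forall x y u v, a <= x <= b -> forall e, 0 < e ->
  exists2 d : R, 0 < d & forall x' y' u' v', a <= x' <= b ->
    `|x' - x| < d -> `|y' - y| < d -> `|u' - u| < d -> `|v' - v| < d ->
    `|G x' y' u' v' - G x y u v| < e.

Lemma continuous4_cont4 a b G : continuous4 a b G -> cont4 a b G.
Proof.
move=> /subspace_continuousP cG x y u v xab e e0.
have := cG (x, y, u, v); rewrite /= in_itv/= => /(_ xab) /cvgrPdist_lt/(_ _ e0).
rewrite near_withinE => /nbhs_ballP[d /= d0 H].
exists d => // x' y' u' v' xab' hx hy hu hv.
rewrite distrC; apply: (H (x', y', u', v')); last by rewrite /= in_itv.
by do 3?split => //=; rewrite /ball/= distrC.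
Qed.

(** Locating [c] by its distance to [x] treats increments of both signs at once. *)
Lemma mean_value (f : R -> R) x r : (forall z, derivable f z 1) ->
  exists2 c, `|c - x| <= `|r| & f (x + r) - f x = derive1 f c * r.
Proof.
move=> df.
have df' (z : R) : is_derive z 1 f (derive1 f z) by apply: DeriveDef; [exact: df|rewrite derive1E].
have cf (i : interval R) : {within [set` i], continuous f}.
  by apply: derivable_within_continuous => z _; exact: df.
have [r0|r0] := leP 0 r.
  have [|c] := @MVT_segment R f (derive1 f) x (x + r) _ (fun z _ => df' z) (cf _).
    by rewrite lerDl.
  rewrite in_itv/= => /andP[xc cx] E; exists c; last by rewrite E addrAC subrr add0r.
  by rewrite !ger0_norm ?subr_ge0// lerBlDl.
have [|c] := @MVT_segment R f (derive1 f) (x + r) x _ (fun z _ => df' z) (cf _).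
  by rewrite gerDl ltW.
rewrite in_itv/= => /andP[xc cx] E; exists c.
  by rewrite ler0_norm ?subr_le0// ltr0_norm// opprB lerBlDr -lerBlDl opprK.
apply: oppr_inj; rewrite opprB E -mulrN; congr (_ * _); ring.
Qed.

(** Near [x] the difference quotient stays within 1 of its limit [l], so [f] moves by at most
    [|l| + 1] times the displacement. *)
Lemma derivable_within_cvg (D : set R) (f : R -> R) x : derivable_within D f x ->
  forall e, 0 < e -> exists2 d : R, 0 < d &
    forall t, D t -> `|t - x| < d -> `|f t - f x| < e.
Proof.
move=> /cvg_ex[/= l /cvgrPdist_lt/(_ _ ltr01)].
rewrite near_withinE => -[d /= d0 dl] e e0.
have l1 : 0 < `|l| + 1 by rewrite ltr_wpDl.
exists (Num.min d (e / (`|l| + 1))); first by rewrite lt_min d0 divr_gt0.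
move=> t Dt; rewrite lt_min => /andP[td te].
have [->|tx] := eqVneq t x; first by rewrite subrr normr0.
have := dl t; rewrite /ball_/= distrC => /(_ td tx Dt); rewrite /diff_quotient => h.
have tx0 : 0 < `|t - x| by rewrite normr_gt0 subr_eq0.
have -> : f t - f x = (f t - f x) / (t - x) * (t - x) by rewrite divfK// subr_eq0.
rewrite normrM; apply: (@le_lt_trans _ _ ((`|l| + 1) * `|t - x|)).
  rewrite ler_wpM2r// -[X in `|X|](subrK l) (le_trans (ler_normD _ _))//.
  by rewrite addrC lerD2l distrC ltW.
by rewrite mulrC -ltr_pdivlMr.
Qed.

(** [classC1] requires continuity of the partial derivatives only, so joint continuity of [P] is
    proved: [y], [u] and [v] are moved in turn by the mean value theorem, and [x] last, by
    derivability at the base point. *)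
Lemma classC1_cont4 a b P : classC1 a b P -> cont4 a b P.
Proof.
move=> [dP [_ /continuous4_cont4 c2 /continuous4_cont4 c3 /continuous4_cont4 c4]].
move=> x y u v xab e e0.
have xab' : x \in `[a, b] by rewrite in_itv.
have [d2 d20 h2] := c2 x y u v xab 1 ltr01.
have [d3 d30 h3] := c3 x y u v xab 1 ltr01.
have [d4 d40 h4] := c4 x y u v xab 1 ltr01.
have e20 : 0 < e / 2 by rewrite divr_gt0.
have [d1' _ _ _] := dP x y u v xab'.
have [d1 d10 h1] := derivable_within_cvg d1' e20.
(* Near the base point each partial derivative stays within 1 of its value there, hence is bounded
   by [M]. *)
pose M := `|partial2 P x y u v| + `|partial3 P x y u v| + `|partial4 P x y u v| + 1.
have n2 := normr_ge0 (partial2 P x y u v).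
have n3 := normr_ge0 (partial3 P x y u v).
have n4 := normr_ge0 (partial4 P x y u v).
have M0 : 0 < M by exact: (ltr_wpDl (addr_ge0 (addr_ge0 n2 n3) n4) ltr01).
have M2 : `|partial2 P x y u v| <= M - 1.
  by rewrite /M addrK -addrA lerDl (addr_ge0 n3 n4).
have M3 : `|partial3 P x y u v| <= M - 1.
  by rewrite /M addrK addrAC lerDr (addr_ge0 n2 n4).
have M4 : `|partial4 P x y u v| <= M - 1.
  by rewrite /M addrK lerDr (addr_ge0 n2 n3).
(* Half of [e] is for the move in [x]; the three other moves, each at most [M * d], share the other
   half. *)
pose d := Num.min (Num.min d1 d2) (Num.min (Num.min d3 d4) (e / 2 / M / 3)).
have dE : [/\ d <= d1, d <= d2, d <= d3, d <= d4 & d <= e / 2 / M / 3].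
  by rewrite /d; split; rewrite !ge_min lexx ?orbT.
have d0 : 0 < d by rewrite /d !lt_min d10 d20 d30 d40 !divr_gt0.
case: dE => dd1 dd2 dd3 dd4 de.
exists d => // x' y' u' v' xab1 hx hy hu hv.
have xab1' : x' \in `[a, b] by rewrite in_itv.
have bnd (p r : R) : `|p - r| < 1 -> `|r| <= M - 1 -> `|p| <= M.
  move=> pr rM; rewrite -(subrK r p) (le_trans (ler_normD _ _))//.
  by rewrite -(subrKC 1 M) lerD// ltW.
have n0 (z : R) : `|z - z| < d by rewrite subrr normr0.
have [_ D2 D3 D4] := dP x' y' u' v' xab1'.
have [k2 k2y E2] := @mean_value (fun s => P x' s u' v') y (y' - y)
  (fun z => (let: And4 _ h _ _ := dP x' z u' v' xab1' in h)).
have [k3 k3u E3] := @mean_value (fun s => P x' y s v') u (u' - u)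
  (fun z => (let: And4 _ _ h _ := dP x' y z v' xab1' in h)).
have [k4 k4v E4] := @mean_value (fun s => P x' y u s) v (v' - v)
  (fun z => (let: And4 _ _ _ h := dP x' y u z xab1' in h)).
rewrite !subrKC in E2 E3 E4.
have B2 : `|derive1 (fun s => P x' s u' v') k2| <= M.
  apply: (bnd _ (partial2 P x y u v)).
    apply: (h2 x' k2 u' v') => //.
    - exact: lt_le_trans dd2.
    - exact: le_lt_trans (lt_le_trans hy dd2).
    - exact: lt_le_trans dd2.
    - exact: lt_le_trans dd2.
  exact: M2.
have B3 : `|derive1 (fun s => P x' y s v') k3| <= M.
  apply: (bnd _ (partial3 P x y u v)).
    apply: (h3 x' y k3 v') => //.
    - exact: lt_le_trans dd3.
    - exact: lt_le_trans (n0 _) dd3.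
    - exact: le_lt_trans (lt_le_trans hu dd3).
    - exact: lt_le_trans dd3.
  exact: M3.
have B4 : `|derive1 (fun s => P x' y u s) k4| <= M.
  apply: (bnd _ (partial4 P x y u v)).
    apply: (h4 x' y u k4) => //.
    - exact: lt_le_trans dd4.
    - exact: lt_le_trans (n0 _) dd4.
    - exact: lt_le_trans (n0 _) dd4.
    - exact: le_lt_trans (lt_le_trans hv dd4).
  exact: M4.
have F (r s : R) : `|r| <= M -> `|s| < d -> `|r * s| <= e / 2 / 3.
  move=> rM sd; rewrite normrM.
  apply: (@le_trans _ _ (M * (e / 2 / M / 3))).
    by apply: ler_pM => //; apply: ltW; exact: lt_le_trans sd de.
  by rewrite mulrC mulrAC divfK// gt_eqF.
have G1 := h1 x' xab1' (lt_le_trans hx dd1).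
have -> : P x' y' u' v' - P x y u v = (P x' y' u' v' - P x' y u' v') +
  (P x' y u' v' - P x' y u v') + (P x' y u v' - P x' y u v) + (P x' y u v - P x y u v).
  by ring.
rewrite E2 E3 E4 (splitr e).
apply: le_lt_trans (ler_normD _ _) _; apply: ler_ltD G1.
have -> : e / 2 = e / 2 / 3 + e / 2 / 3 + e / 2 / 3 by field.
apply: le_trans (ler_normD _ _) _; apply: lerD; last exact: F.
by apply: le_trans (ler_normD _ _) _; apply: lerD; exact: F.
Qed.

Lemma cont4_within a b A B G (q1 q2 q3 : R -> R) : a <= A -> B <= b -> cont4 a b G ->
  {within `[A, B], continuous q1} -> {within `[A, B], continuous q2} ->
  {within `[A, B], continuous q3} ->
  {within `[A, B], continuous (fun x => G x (q1 x) (q2 x) (q3 x))}.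
Proof.
move=> aA Bb cG /subspace_continuousP c1 /subspace_continuousP c2 /subspace_continuousP c3.
apply/subspace_continuousP => x xAB; apply/cvgrPdist_lt => e e0.
have sub z : `[A, B]%classic z -> a <= z <= b.
  by rewrite /= in_itv/= => /andP[Az zB]; rewrite (le_trans aA) ?(le_trans zB).
have [d d0 hd] := cG x (q1 x) (q2 x) (q3 x) (sub _ xAB) e e0.
have h0 : \forall z \near within `[A, B] (nbhs x), `|x - z| < d.
  by apply: cvg_within; apply/nbhs_ballP; exists d.
have /cvgrPdist_lt/(_ _ d0) h1 := c1 x xAB.
have /cvgrPdist_lt/(_ _ d0) h2 := c2 x xAB.
have /cvgrPdist_lt/(_ _ d0) h3 := c3 x xAB.
have hAB : \forall z \near within `[A, B] (nbhs x), `[A, B]%classic z.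
  by rewrite near_withinE; near=> z.
near=> z; rewrite distrC; apply: hd; first by apply: sub; near: z.
- by rewrite distrC; near: z.
- by rewrite distrC; near: z.
- by rewrite distrC; near: z.
- by rewrite distrC; near: z.
Unshelve. all: by end_near. Qed.

(** [G] need not be uniformly continuous on the unbounded domain, but compactness of [A, B] gives
    one radius valid along the whole curve. *)
Lemma cont4_uniform a b A B G (q1 q2 q3 : R -> R) : a <= A -> B <= b -> cont4 a b G ->
  {within `[A, B], continuous q1} -> {within `[A, B], continuous q2} ->
  {within `[A, B], continuous q3} ->
  forall e, 0 < e -> exists2 d : R, 0 < d & forall x, A <= x <= B -> forall r1 r2 r3,
    `|r1| < d -> `|r2| < d -> `|r3| < d ->
    `|G x (q1 x + r1) (q2 x + r2) (q3 x + r3) - G x (q1 x) (q2 x) (q3 x)| < e.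
Proof.
move=> aA Bb cG /subspace_continuousP c1 /subspace_continuousP c2 /subspace_continuousP c3 e e0.
have sub z : `[A, B]%classic z -> a <= z <= b.
  by rewrite /= in_itv/= => /andP[Az zB]; rewrite (le_trans aA) ?(le_trans zB).
pose Q (d x : R) := forall r1 r2 r3,
    `|r1| < d -> `|r2| < d -> `|r3| < d ->
    `|G x (q1 x + r1) (q2 x + r2) (q3 x + r3) - G x (q1 x) (q2 x) (q3 x)| < e.
have /near_covering_withinP cov := (compact_near_coveringP _).1 (@segment_compact R A B).
have H : \forall d \near (0 : R)^'+, `[A, B] `<=` Q d.
  apply: cov => x xAB.
  (* Shifted and unshifted values at [z] are both compared with the value at [x]. Likewise the
     radius [n] is shared between the variation of the curve from [x] to [z] and the shift. *)
  have e20 : 0 < e / 2 by rewrite divr_gt0.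
  have [n n0 hn] := cG x (q1 x) (q2 x) (q3 x) (sub _ xAB) (e / 2) e20.
  have n20 : 0 < n / 2 by rewrite divr_gt0.
  have h0 : \forall z \near x, `|x - z| < n by apply/nbhs_ballP; exists n.
  have h1 : \forall z \near x, `[A, B]%classic z -> `|q1 x - q1 z| < n / 2.
    by have := c1 x xAB; move=> /cvgrPdist_lt/(_ _ n20); rewrite near_withinE.
  have h2 : \forall z \near x, `[A, B]%classic z -> `|q2 x - q2 z| < n / 2.
    by have := c2 x xAB; move=> /cvgrPdist_lt/(_ _ n20); rewrite near_withinE.
  have h3 : \forall z \near x, `[A, B]%classic z -> `|q3 x - q3 z| < n / 2.
    by have := c3 x xAB; move=> /cvgrPdist_lt/(_ _ n20); rewrite near_withinE.
  near=> z d; move=> /= zAB r1 r2 r3 hr1 hr2 hr3.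
  have zab := sub _ zAB.
  have dn : d < n / 2 by near: d; exact: nbhs_right_lt.
  have zx : `|z - x| < n by rewrite distrC; near: z.
  have z1 : `|q1 x - q1 z| < n / 2 by move: zAB; near: z.
  have z2 : `|q2 x - q2 z| < n / 2 by move: zAB; near: z.
  have z3 : `|q3 x - q3 z| < n / 2 by move: zAB; near: z.
  have T (p p' r : R) : `|p - p'| < n / 2 -> `|r| < d -> `|p' + r - p| < n.
    move=> pp rd; rewrite (splitr n) addrAC (le_lt_trans (ler_normD _ _))// ltrD//.
      by rewrite distrC.
    exact: lt_trans rd dn.
  have T' (p p' : R) : `|p - p'| < n / 2 -> `|p' - p| < n.
    by rewrite distrC => h; apply: (lt_trans h); rewrite ltr_pdivrMr// ltr_pMr// ltr1n.
  have a1 := hn z (q1 z + r1) (q2 z + r2) (q3 z + r3) zab zx (T _ _ _ z1 hr1) (T _ _ _ z2 hr2) (T _ _ _ z3 hr3).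
  have a2 := hn z (q1 z) (q2 z) (q3 z) zab zx (T' _ _ z1) (T' _ _ z2) (T' _ _ z3).
  rewrite (splitr e) -(subrKA (G x (q1 x) (q2 x) (q3 x))).
  by rewrite (le_lt_trans (ler_normD _ _))// ltrD// distrC.
have : \forall d \near (0 : R)^'+, 0 < d /\ `[A, B] `<=` Q d.
  by apply: filterS2 (nbhs_right_gt (0 : R)) H => d.
move=> /filter_ex[d [d0 Hd]]; exists d; first exact: d0.
by move=> x xAB; apply: Hd; rewrite /= in_itv.
Unshelve. all: by end_near. Qed.

(** One variable is moved at a time, each partial derivative being within [e] of its value on the
    curve. Uniformity in [x] is what permits integration over [A, B]. *)
Lemma classC1_expansion a b A B P (q1 q2 q3 : R -> R) : a <= A -> B <= b ->
  classC1 a b P ->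
  {within `[A, B], continuous q1} -> {within `[A, B], continuous q2} ->
  {within `[A, B], continuous q3} ->
  forall e, 0 < e -> exists2 d : R, 0 < d & forall x, A <= x <= B -> forall r1 r2 r3,
    `|r1| < d -> `|r2| < d -> `|r3| < d ->
    `|P x (q1 x + r1) (q2 x + r2) (q3 x + r3) - P x (q1 x) (q2 x) (q3 x) -
      (partial2 P x (q1 x) (q2 x) (q3 x) * r1 +
       partial3 P x (q1 x) (q2 x) (q3 x) * r2 +
       partial4 P x (q1 x) (q2 x) (q3 x) * r3)| <= e * (`|r1| + `|r2| + `|r3|).
Proof.
move=> aA Bb [dP [_ /continuous4_cont4 p2 /continuous4_cont4 p3 /continuous4_cont4 p4]] c1 c2 c3 e e0.
have [d2 d20 h2] := cont4_uniform aA Bb p2 c1 c2 c3 e0.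
have [d3 d30 h3] := cont4_uniform aA Bb p3 c1 c2 c3 e0.
have [d4 d40 h4] := cont4_uniform aA Bb p4 c1 c2 c3 e0.
pose d := Num.min d2 (Num.min d3 d4).
have [dd2 dd3 dd4] : [/\ d <= d2, d <= d3 & d <= d4].
  by rewrite /d; split; rewrite !ge_min lexx ?orbT.
have d0 : 0 < d by rewrite /d !lt_min d20 d30 d40.
exists d => // x xAB r1 r2 r3 hr1 hr2 hr3.
have xab : x \in `[a, b].
  by case/andP: xAB => Ax xB; rewrite in_itv/= (le_trans aA)//= (le_trans xB).
set Y := q1 x; set U := q2 x; set V := q3 x.
have [k2 k2y E2] := @mean_value (fun s => P x s (U + r2) (V + r3)) Y r1
  (fun z => (let: And4 _ h _ _ := dP x z (U + r2) (V + r3) xab in h)).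
have [k3 k3u E3] := @mean_value (fun s => P x Y s (V + r3)) U r2
  (fun z => (let: And4 _ _ h _ := dP x Y z (V + r3) xab in h)).
have [k4 k4v E4] := @mean_value (fun s => P x Y U s) V r3
  (fun z => (let: And4 _ _ _ h := dP x Y U z xab in h)).
have z0 : `|0 : R| < d by rewrite normr0.
have B2 : `|derive1 (fun s => P x s (U + r2) (V + r3)) k2 - partial2 P x Y U V| <= e.
  have := h2 x xAB (k2 - Y) r2 r3; rewrite subrKC => /(_ _ _ _)/ltW; apply.
  - exact: le_lt_trans (lt_le_trans hr1 dd2).
  - exact: lt_le_trans dd2.
  - exact: lt_le_trans dd2.
have B3 : `|derive1 (fun s => P x Y s (V + r3)) k3 - partial3 P x Y U V| <= e.
  have := h3 x xAB 0 (k3 - U) r3; rewrite subrKC addr0 => /(_ _ _ _)/ltW; apply.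
  - exact: lt_le_trans dd3.
  - exact: le_lt_trans (lt_le_trans hr2 dd3).
  - exact: lt_le_trans dd3.
have B4 : `|derive1 (fun s => P x Y U s) k4 - partial4 P x Y U V| <= e.
  have := h4 x xAB 0 0 (k4 - V); rewrite subrKC !addr0 => /(_ _ _ _)/ltW; apply.
  - exact: lt_le_trans dd4.
  - exact: lt_le_trans dd4.
  - exact: le_lt_trans (lt_le_trans hr3 dd4).
have -> : P x (Y + r1) (U + r2) (V + r3) - P x Y U V -
    (partial2 P x Y U V * r1 + partial3 P x Y U V * r2 + partial4 P x Y U V * r3) =
  (P x (Y + r1) (U + r2) (V + r3) - P x Y (U + r2) (V + r3) - partial2 P x Y U V * r1) +
  (P x Y (U + r2) (V + r3) - P x Y U (V + r3) - partial3 P x Y U V * r2) +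
  (P x Y U (V + r3) - P x Y U V - partial4 P x Y U V * r3) by ring.
rewrite E2 E3 E4 -!mulrBl !mulrDr.
apply: le_trans (ler_normD _ _) _; apply: lerD.
  apply: le_trans (ler_normD _ _) _; apply: lerD.
    by rewrite normrM; apply: ler_wpM2r; [exact: normr_ge0|exact: B2].
  by rewrite normrM; apply: ler_wpM2r; [exact: normr_ge0|exact: B3].
by rewrite normrM; apply: ler_wpM2r; [exact: normr_ge0|exact: B4].
Qed.

End ClassC1.

(** * First variation *)

Section FirstVariation.
Context {R : realType}.
Local Notation mu := (@lebesgue_measure R).
Variables (a b A B alpha beta : R).
Hypotheses (hab : a < b) (haA : a <= A) (hAB : A < B) (hBb : B <= b).
Hypotheses (halpha : 0 <= alpha < 1) (hbeta : 0 <= beta < 1).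
Implicit Types (P : R -> R -> R -> R -> R) (y w : R -> R) (s t x e : R).

Local Notation ca := (1 / Gamma (1 - alpha)).
Local Notation cb := (-1 / Gamma (1 - beta)).
Local Notation along := (along a b alpha beta).
Local Notation J P := (functional a b A B alpha beta P).

Let mab : measurable (`[a, b]%classic : set (measurableTypeR R)).
Proof. exact: measurable_itv. Qed.
Let mAB : measurable (`[A, B]%classic : set (measurableTypeR R)).
Proof. exact: measurable_itv. Qed.
Let subAB : `[A, B] `<=` (`[a, b]%classic : set R).
Proof. by apply: subset_itv; rewrite bnd_simp. Qed.

Lemma along_within P y : Espace a b alpha beta y -> cont4 a b P ->
  {within `[a, b], continuous (along P y)}.
Proof.
move=> [/abs_continuous_within cy _ [_ cL] [_ cR]] cP.
exact: (cont4_within (lexx a) (lexx b) cP cy cL cR).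
Qed.

(* The integrand of the first variation in the direction [prim a w], whose
   values on [a, b] are those of [fint_left a b 0 w]. *)
Definition variation_density P y w x : R :=
  along (partial2 P) y x * fint_left a b 0 w x +
  along (partial3 P) y x * (ca * fint_left a b alpha w x) +
  along (partial4 P) y x * (cb * fint_right a b beta w x).

Definition first_variation P y w : R := \int[mu]_(x in `[A, B]) variation_density P y w x.

Lemma within_continuousM_fun (S : set R) (f h : R -> R) :
  {within S, continuous f} -> {within S, continuous h} ->
  {within S, continuous (fun x => f x * h x)}.
Proof. by move=> cf ch x; apply: cvgM; [exact: cf|exact: ch]. Qed.

Lemma within_continuousD_fun (S : set R) (f h : R -> R) :
  {within S, continuous f} -> {within S, continuous h} ->
  {within S, continuous (fun x => f x + h x)}.
Proof. by move=> cf ch x; apply: cvgD; [exact: cf|exact: ch]. Qed.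

Lemma within_continuousZ_fun (S : set R) (f : R -> R) (c : R) :
  {within S, continuous f} -> {within S, continuous (fun x => c * f x)}.
Proof. by move=> cf x; apply: cvgMl_tmp; exact: cf. Qed.

Section Base.
Variables (P : R -> R -> R -> R -> R) (y : R -> R).
Hypotheses (hP : classC1 a b P) (hy : Espace a b alpha beta y).

Let c2 : cont4 a b (partial2 P). Proof. by case: hP => _ [_ /continuous4_cont4]. Qed.
Let c3 : cont4 a b (partial3 P). Proof. by case: hP => _ [_ _ /continuous4_cont4]. Qed.
Let c4 : cont4 a b (partial4 P). Proof. by case: hP => _ [_ _ _ /continuous4_cont4]. Qed.

Lemma within_variation_density w : continuous w ->
  {within `[a, b], continuous (variation_density P y w)}.
Proof.
move=> cw; have bw : bounded_mfun `[a, b] w by exact: bounded_mfun_continuous.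
apply: within_continuousD_fun; first apply: within_continuousD_fun.
- apply: within_continuousM_fun; first exact: along_within.
  by apply: continuous_fint_left => //; rewrite lexx ltr01.
- apply: within_continuousM_fun; first exact: along_within.
  by apply: within_continuousZ_fun; exact: continuous_fint_left.
- apply: within_continuousM_fun; first exact: along_within.
  by apply: within_continuousZ_fun; exact: continuous_fint_right.
Qed.

Lemma along_add_prim w x : continuous w -> a <= x <= b ->
  along P (fun x => y x + prim a w x) x =
  P x (y x + fint_left a b 0 w x) (Cleft a alpha y x + ca * fint_left a b alpha w x)
    (Cright beta b y x + cb * fint_right a b beta w x).
Proof.
move=> cw xab; have xab' : x \in `[a, b] by rewrite in_itv.
have [_ EL ER] := Espace_add_prim hab halpha hbeta hy cw.
by rewrite /Defs.along EL// ER// (prim_fint cw xab).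
Qed.

(** Differentiability at the origin jointly in [(s, t)]: a constrained perturbation uses both
    parameters, so directional derivatives would not be enough. *)
Lemma functional_expansion w1 w2 : continuous w1 -> continuous w2 ->
  forall e, 0 < e -> exists2 d : R, 0 < d & forall s t, `|s| < d -> `|t| < d ->
    `|J P (fun x => y x + prim a (fun z => s * w1 z + t * w2 z) x) - J P y -
      (s * first_variation P y w1 + t * first_variation P y w2)| <= e * (`|s| + `|t|).
Proof.
move=> cw1 cw2 e e0.
have bw1 : bounded_mfun `[a, b] w1 by exact: bounded_mfun_continuous.
have bw2 : bounded_mfun `[a, b] w2 by exact: bounded_mfun_continuous.
have h0 : 0 <= (0 : R) < 1 by rewrite lexx ltr01.
have bd (f : R -> R) : {within `[a, b], continuous f} ->
    exists2 M, 0 < M & forall x, a <= x <= b -> `|f x| <= M.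
  move=> /bounded_mfun_within_continuous/bounded_mfun_gt0[M M0 hM].
  by exists M => // x xab; apply: hM; rewrite /= in_itv.
have [M1 M10 hM1] := bd _ (continuous_fint_left h0 bw1).
have [M2 M20 hM2] := bd _ (continuous_fint_left h0 bw2).
have [M3 M30 hM3] := bd _ (within_continuousZ_fun (c := ca) (continuous_fint_left halpha bw1)).
have [M4 M40 hM4] := bd _ (within_continuousZ_fun (c := ca) (continuous_fint_left halpha bw2)).
have [M5 M50 hM5] := bd _ (within_continuousZ_fun (c := cb) (continuous_fint_right hbeta bw1)).
have [M6 M60 hM6] := bd _ (within_continuousZ_fun (c := cb) (continuous_fint_right hbeta bw2)).
(* A common bound for the increments that [w1] and [w2] induce in the three arguments. *)
pose M := M1 + M2 + (M3 + M4) + (M5 + M6).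
have M0 : 0 < M by rewrite /M !addr_gt0.
have MM : [/\ M1 <= M, M2 <= M, M3 <= M & [/\ M4 <= M, M5 <= M & M6 <= M]].
  by rewrite /M; split; [..|split]; lra.
clearbody M.
case: MM => MM1 MM2 MM3 [MM4 MM5 MM6].
(* Each of the three increments is at most [M * (|s| + |t|)], and integration contributes the length
   [B - A]. *)
pose e' := e / (3 * M * (B - A)).
have BA0 : 0 < B - A by rewrite subr_gt0.
have e'0 : 0 < e' by rewrite divr_gt0// !mulr_gt0.
have [cy cL cR] : [/\ {within `[A, B], continuous y},
    {within `[A, B], continuous (Cleft a alpha y)} &
    {within `[A, B], continuous (Cright beta b y)}].
  have [/abs_continuous_within cy _ [_ cL] [_ cR]] := hy.
  split; [exact: continuous_subspaceW cy|exact: continuous_subspaceW cL|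
    exact: continuous_subspaceW cR].
have [d d0 hd] := classC1_expansion haA hBb hP cy cL cR e'0.
exists (d / (2 * M)); first by rewrite divr_gt0// mulr_gt0.
move=> s t sd td.
pose w z := s * w1 z + t * w2 z.
have cw : continuous w by exact: continuous_lin.
have [hyw _ _] := Espace_add_prim hab halpha hbeta hy cw.
have cP := classC1_cont4 hP.
have i1 : rintegrable `[A, B] (along P (fun x => y x + prim a w x)).
  apply: rintegrableS mAB mab subAB _; apply: rintegrable_bounded_itv.
  by apply: bounded_mfun_within_continuous; exact: along_within.
have i2 : rintegrable `[A, B] (along P y).
  apply: rintegrableS mAB mab subAB _; apply: rintegrable_bounded_itv.
  by apply: bounded_mfun_within_continuous; exact: along_within.
have iv v : continuous v -> rintegrable `[A, B] (variation_density P y v).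
  move=> cv; apply: rintegrableS mAB mab subAB _; apply: rintegrable_bounded_itv.
  by apply: bounded_mfun_within_continuous; exact: within_variation_density.
have i3 := rintegrableD mAB (rintegrableZl s mAB (iv _ cw1)) (rintegrableZl t mAB (iv _ cw2)).
have i12 := rintegrableB mAB i1 i2.
rewrite /first_variation -(Rintegral_lin s t mAB (iv _ cw1) (iv _ cw2)).
rewrite /functional -(RintegralB mAB i1 i2) -(RintegralB mAB i12 i3).
have -> : e * (`|s| + `|t|) = e' * (3 * (M * (`|s| + `|t|))) * (B - A).
  rewrite /e'; field; by rewrite !gt_eqF.
apply: le_normr_Rintegral_bound; [exact: ltW|exact: rintegrableB|].
move=> x; rewrite /= in_itv/= => xAB.
have xab : a <= x <= b.
  by case/andP: xAB => Ax xB; rewrite (le_trans haA)//= (le_trans xB).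
rewrite along_add_prim//.
rewrite (fint_left_lin s t h0 bw1 bw2 xab) (fint_left_lin s t halpha bw1 bw2 xab).
rewrite (fint_right_lin s t hbeta bw1 bw2 xab).
pose r1 := s * fint_left a b 0 w1 x + t * fint_left a b 0 w2 x.
pose r2 := ca * (s * fint_left a b alpha w1 x + t * fint_left a b alpha w2 x).
pose r3 := cb * (s * fint_right a b beta w1 x + t * fint_right a b beta w2 x).
have st : `|s| + `|t| < d / M.
  have -> : d / M = d / (2 * M) + d / (2 * M) by field; rewrite gt_eqF.
  exact: ltrD.
have linE (p2 p3 p4 u1 u2 v1 v2 z1 z2 k l : R) :
    s * (p2 * u1 + p3 * (k * v1) + p4 * (l * z1)) + t * (p2 * u2 + p3 * (k * v2) + p4 * (l * z2)) =
    p2 * (s * u1 + t * u2) + p3 * (k * (s * v1 + t * v2)) + p4 * (l * (s * z1 + t * z2)).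
  by ring.
have rle (p q : R) : `|p| <= M -> `|q| <= M -> `|s * p + t * q| <= M * (`|s| + `|t|).
  move=> pM qM; apply: le_trans (ler_normD _ _) _; rewrite !normrM mulrDr.
  by rewrite !(mulrC M) lerD// ler_wpM2l.
have rlt (p : R) : `|p| <= M * (`|s| + `|t|) -> `|p| < d.
  by move=> h; apply: le_lt_trans h _; rewrite mulrC -ltr_pdivlMr.
have R1 : `|r1| <= M * (`|s| + `|t|).
  by apply: rle; [exact: le_trans (hM1 _ xab) MM1|exact: le_trans (hM2 _ xab) MM2].
have R2 : `|r2| <= M * (`|s| + `|t|).
  rewrite /r2 mulrDr !(mulrCA ca).
  by apply: rle; [exact: le_trans (hM3 _ xab) MM3|exact: le_trans (hM4 _ xab) MM4].
have R3 : `|r3| <= M * (`|s| + `|t|).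
  rewrite /r3 mulrDr !(mulrCA cb).
  by apply: rle; [exact: le_trans (hM5 _ xab) MM5|exact: le_trans (hM6 _ xab) MM6].
have := hd x xAB r1 r2 r3 (rlt _ R1) (rlt _ R2) (rlt _ R3).
have -> : s * variation_density P y w1 x + t * variation_density P y w2 x =
   along (partial2 P) y x * r1 + along (partial3 P) y x * r2 + along (partial4 P) y x * r3.
  exact: linE.
move=> H; apply: le_trans H _; apply: ler_wpM2l; first exact: ltW.
have -> : 3 * (M * (`|s| + `|t|)) = M * (`|s| + `|t|) + M * (`|s| + `|t|) + M * (`|s| + `|t|) by ring.
exact: lerD (lerD R1 R2) R3.
Qed.

End Base.

(** At [t0] the functional is expanded around the already perturbed curve [y'], not around [y];
    tolerance 1 yields a local Lipschitz bound [|D| + 1]. *)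
Lemma functional_path_continuous P y w1 w2 s : classC1 a b P -> Espace a b alpha beta y ->
  continuous w1 -> continuous w2 ->
  continuous (fun t => J P (fun x => y x + prim a (fun z => s * w1 z + t * w2 z) x)).
Proof.
move=> hP hy cw1 cw2 t0.
have cw := continuous_lin (r := s) (s := t0) cw1 cw2.
have [hy' _ _] := Espace_add_prim hab halpha hbeta hy cw.
have [d d0 hd] := functional_expansion hP hy' cw1 cw2 ltr01.
set y' := (fun x => y x + _) in hy' hd *.
have E t : (fun x => y x + prim a (fun z => s * w1 z + t * w2 z) x) =
    (fun x => y' x + prim a (fun z => 0 * w1 z + (t - t0) * w2 z) x).
  by apply/funext => x; rewrite /y' !prim_lin//; ring.
set D := first_variation P y' w2 in hd.
apply/cvgrPdist_le => e e0.
have D1 : 0 < `|D| + 1 by rewrite ltr_wpDl.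
near=> t.
have td : `|t - t0| < d.
  by rewrite distrC; near: t; exact: (@cvgr_dist_lt _ _ _ _ _ id t0).
have te : `|t - t0| <= e / (`|D| + 1).
  by rewrite distrC; near: t; apply: (@cvgr_dist_le _ _ _ _ _ id t0) => //; exact: divr_gt0.
have := hd 0 (t - t0); rewrite normr0 => /(_ d0 td); rewrite !add0r mul1r mul0r add0r -(E t).
move=> h; rewrite distrC.
apply: (@le_trans _ _ (`|t - t0| * (`|D| + 1))); last by rewrite -ler_pdivlMr.
rewrite -[X in `|X|](subrK ((t - t0) * D)).
apply: le_trans (ler_normD _ _) _; apply: le_trans (lerD h (lexx _)) _.
by rewrite normrM mulrDr mulr1 addrC.
Unshelve. all: by end_near. Qed.

End FirstVariation.

(** * Lagrange multiplier *)

Section Multiplier.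
Context {R : realType}.
Implicit Types (I J : R -> R -> R) (s t e l : R).

(* If [j1 < 0], the intermediate value theorem applied to [I s] on [- k s, k s]
   yields a constrained point where [J s t < J0], for [k] and then [s] small. *)
Lemma constrained_min_slope_ge0 I J l (J0 d0 j1 j0 : R) : 0 < d0 ->
  (forall s, continuous (I s)) ->
  (forall e, 0 < e -> exists2 d : R, 0 < d & forall s t, `|s| < d -> `|t| < d ->
     `|I s t - l - (s * 0 + t * d0)| <= e * (`|s| + `|t|)) ->
  (forall e, 0 < e -> exists2 d : R, 0 < d & forall s t, `|s| < d -> `|t| < d ->
     `|J s t - J0 - (s * j1 + t * j0)| <= e * (`|s| + `|t|)) ->
  (exists2 d : R, 0 < d & forall s t, `|s| < d -> `|t| < d -> I s t = l -> J0 <= J s t) ->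
  0 <= j1.
Proof.
move=> d00 cI hI hJ [d1 d10 hmin]; rewrite leNgt; apply/negP => j10.
(* The correction [t] will satisfy [|t| <= k * s]; this [k] makes its cost in [J] at most a quarter
   of the gain [- s * j1], and [k <= 1] keeps [|t| <= s]. *)
pose k := Num.min 1 (- j1 / 4 / (`|j0| + 1)).
have J1 : 0 < `|j0| + 1 by rewrite ltr_wpDl.
have k0 : 0 < k by rewrite /k lt_min ltr01 !divr_gt0// oppr_gt0.
have k1 : k <= 1 by rewrite /k ge_min lexx.
have kj : k * `|j0| <= - j1 / 4.
  apply: (@le_trans _ _ (k * (`|j0| + 1))).
    by rewrite ler_wpM2l ?(ltW k0)// lerDl.
  by rewrite -ler_pdivlMr// /k ge_min lexx orbT.
clearbody k.
(* With [|s| + |t| <= 2 * s], the error in [I] is at most half of the main term [k * s * d0], which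
   fixes the signs at [k * s] and [- (k * s)]. The tolerance [- j1 / 8] costs another quarter of the
   gain in [J]. *)
have eI0 : 0 < k * d0 / 4 by rewrite !divr_gt0// mulr_gt0.
have eJ0 : 0 < - j1 / 8 by rewrite divr_gt0// oppr_gt0.
have [d2 d20 h2] := hI _ eI0.
have [d3 d30 h3] := hJ _ eJ0.
pose s := Num.min d1 (Num.min d2 d3) / 2.
have dd0 : 0 < Num.min d1 (Num.min d2 d3) by rewrite !lt_min d10 d20 d30.
have s0 : 0 < s by rewrite /s divr_gt0.
have sd : [/\ s < d1, s < d2 & s < d3].
  have : s < Num.min d1 (Num.min d2 d3) by rewrite /s ltr_pdivrMr// ltr_pMr// ltr1n.
  by rewrite !lt_min => /andP[? /andP[? ?]].
clearbody s; case: sd => sd1 sd2 sd3.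
have ks : k * s <= s by rewrite ler_piMl// ltW.
have ks0 : 0 < k * s by rewrite mulr_gt0.
have ns : `|s| = s by rewrite gtr0_norm.
have nks : `|k * s| = k * s by rewrite gtr0_norm.
have Ipos : l <= I s (k * s).
  have := h2 s (k * s); rewrite ns nks => /(_ sd2 (le_lt_trans ks sd2)).
  rewrite ler_norml mulr0 add0r => /andP[H _].
  have H1 : k * d0 / 4 * (s + k * s) <= k * d0 / 4 * (s + s).
    by rewrite ler_wpM2l ?(ltW eI0)// lerD2l.
  have E1 : k * d0 / 4 * (s + s) = k * s * d0 / 2 by field.
  have P1 : 0 < k * s * d0 by rewrite mulr_gt0.
  move: H H1 E1 P1; clear; set u := k * s * d0; set v := _ / 4 * _; set z := _ / 4 * _; lra.
have Ineg : I s (- (k * s)) <= l.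
  have := h2 s (- (k * s)); rewrite ns normrN nks => /(_ sd2 (le_lt_trans ks sd2)).
  rewrite ler_norml mulr0 add0r mulNr => /andP[_ H].
  have H1 : k * d0 / 4 * (s + k * s) <= k * d0 / 4 * (s + s).
    by rewrite ler_wpM2l ?(ltW eI0)// lerD2l.
  have E1 : k * d0 / 4 * (s + s) = k * s * d0 / 2 by field.
  have P1 : 0 < k * s * d0 by rewrite mulr_gt0.
  move: H H1 E1 P1; clear; set u := k * s * d0; set v := _ / 4 * _; set z := _ / 4 * _; lra.
have [|||t tks It] := @IVT R (I s) (- (k * s)) (k * s) l.
- by rewrite ge0_cp// ltW.
- by apply: continuous_subspaceT; exact: cI.
- by rewrite ge_min Ineg le_max Ipos orbT.
have tn : `|t| <= k * s by move: tks; rewrite in_itv/= ler_norml.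
have ts : `|t| <= s by exact: le_trans tn ks.
have := hmin s t; rewrite ns => /(_ sd1 (le_lt_trans ts sd1) It) HJ.
have := h3 s t; rewrite ns => /(_ sd3 (le_lt_trans ts sd3)).
rewrite ler_norml => /andP[_ H].
have H1 : - j1 / 8 * (s + `|t|) <= - j1 / 8 * (s + s).
  by rewrite ler_wpM2l ?(ltW eJ0)// lerD2l.
have H2 : t * j0 <= s * (- j1 / 4).
  apply: le_trans (ler_norm _) _; rewrite normrM.
  apply: (@le_trans _ _ (k * s * `|j0|)); first by rewrite ler_wpM2r.
  by rewrite mulrAC mulrC ler_wpM2l// ltW.
have P1 : s * j1 < 0 by rewrite pmulr_rlt0.
have E1 : - j1 / 8 * (s + s) = - (s * j1) / 4 by field.
have E2 : s * (- j1 / 4) = - (s * j1) / 4 by field.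
move: HJ H H1 H2 P1 E1 E2; clear.
set u := s * j1; set v := t * j0; set p := J s t; set q := _ * (s + _); set r := _ * (s + s); set z := s * (_ / _); lra.
Qed.

(** The constraint is stationary in [s], so the hypotheses survive the reflection of [s], which
    reverses the sign of [j1]. *)
Lemma constrained_min_slope_eq0 I J l (J0 d0 j1 j0 : R) : 0 < d0 ->
  (forall s, continuous (I s)) ->
  (forall e, 0 < e -> exists2 d : R, 0 < d & forall s t, `|s| < d -> `|t| < d ->
     `|I s t - l - (s * 0 + t * d0)| <= e * (`|s| + `|t|)) ->
  (forall e, 0 < e -> exists2 d : R, 0 < d & forall s t, `|s| < d -> `|t| < d ->
     `|J s t - J0 - (s * j1 + t * j0)| <= e * (`|s| + `|t|)) ->
  (exists2 d : R, 0 < d & forall s t, `|s| < d -> `|t| < d -> I s t = l -> J0 <= J s t) ->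
  j1 = 0.
Proof.
move=> d00 cI hI hJ hmin; apply/le_anti/andP; split; last first.
  exact: constrained_min_slope_ge0 d00 cI hI hJ hmin.
rewrite -oppr_ge0.
apply: (@constrained_min_slope_ge0 (fun s => I (- s)) (fun s => J (- s)) l J0 d0 _ j0 d00).
- by move=> s; exact: cI.
- move=> e /hI[d dp hd]; exists d => // s t sd td.
  have := hd (- s) t; rewrite normrN => /(_ sd td); rewrite !mulr0; exact.
- move=> e /hJ[d dp hd]; exists d => // s t sd td.
  have := hd (- s) t; rewrite normrN => /(_ sd td); rewrite mulNr mulrN; exact.
- case: hmin => d dp hd; exists d => // s t sd td.
  by apply: hd; rewrite ?normrN.
Qed.

End Multiplier.

(** * The density of the first variation *)

Section EulerFunction.
Context {R : realType}.
Local Notation mu := (@lebesgue_measure R).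
Variables (a b A B alpha beta : R).
Hypotheses (hab : a < b) (haA : a <= A) (hAB : A < B) (hBb : B <= b).
Hypotheses (halpha : 0 <= alpha < 1) (hbeta : 0 <= beta < 1).
Implicit Types (P : R -> R -> R -> R -> R) (y w : R -> R) (s t x e : R).

Local Notation ca := (1 / Gamma (1 - alpha)).
Local Notation cb := (-1 / Gamma (1 - beta)).
Local Notation along := (along a b alpha beta).

(* The density of the first variation with respect to [w], obtained by moving
   the fractional integrals off [w] with [fint_swap]. *)
Definition euler_fun P y t : R :=
  fint_right a b 0 (along (partial2 P) y \_ `[A, B]) t +
  ca * fint_right a b alpha (along (partial3 P) y \_ `[A, B]) t +
  cb * fint_left a b beta (along (partial4 P) y \_ `[A, B]) t.

Section Base.
Variables (P : R -> R -> R -> R -> R) (y : R -> R).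
Hypotheses (hP : classC1 a b P) (hy : Espace a b alpha beta y).

Lemma bounded_along G : cont4 a b G -> bounded_mfun `[a, b] (along G y).
Proof.
by move=> cG; apply: bounded_mfun_within_continuous; exact: along_within.
Qed.

Lemma bounded_along_restrict G : cont4 a b G -> bounded_mfun `[a, b] (along G y \_ `[A, B]).
Proof.
move=> cG; apply: bounded_mfun_restrict => //.
by apply: bounded_mfunS (bounded_along cG) => //; exact: subIsetl.
Qed.

Let c2 : cont4 a b (partial2 P). Proof. by case: hP => _ [_ /continuous4_cont4]. Qed.
Let c3 : cont4 a b (partial3 P). Proof. by case: hP => _ [_ _ /continuous4_cont4]. Qed.
Let c4 : cont4 a b (partial4 P). Proof. by case: hP => _ [_ _ _ /continuous4_cont4]. Qed.
Let h0 : 0 <= (0 : R) < 1. Proof. by rewrite lexx ltr01. Qed.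

Lemma within_euler_fun : {within `[a, b], continuous (euler_fun P y)}.
Proof.
apply: within_continuousD_fun; first apply: within_continuousD_fun.
- by apply: continuous_fint_right => //; exact: bounded_along_restrict.
- by apply: within_continuousZ_fun; apply: continuous_fint_right => //; exact: bounded_along_restrict.
- by apply: within_continuousZ_fun; apply: continuous_fint_left => //; exact: bounded_along_restrict.
Qed.

Lemma first_variationE w : continuous w ->
  first_variation a b A B alpha beta P y w = \int[mu]_(t in `[a, b]) (w t * euler_fun P y t).
Proof.
move=> cw.
have bw : bounded_mfun `[a, b] w by exact: bounded_mfun_continuous.
have b2 := bounded_along_restrict c2.
have b3 := bounded_along_restrict c3.
have b4 := bounded_along_restrict c4.
set f2 := _ \_ _ in b2; set f3 := _ \_ _ in b3; set f4 := _ \_ _ in b4.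
have bc (f : R -> R) : {within `[a, b], continuous f} -> bounded_mfun `[a, b] f.
  exact: bounded_mfun_within_continuous.
have mab : measurable (`[a, b]%classic : set (measurableTypeR R)) by exact: measurable_itv.
have i2 := rintegrable_bounded_itv (bounded_mfun_mul b2 (bc _ (continuous_fint_left h0 bw))).
have i3 := rintegrable_bounded_itv (bounded_mfun_mul b3 (bc _ (continuous_fint_left halpha bw))).
have i4 := rintegrable_bounded_itv (bounded_mfun_mul b4 (bc _ (continuous_fint_right hbeta bw))).
have k2 := rintegrable_bounded_itv (bounded_mfun_mul bw (bc _ (continuous_fint_right h0 b2))).
have k3 := rintegrable_bounded_itv (bounded_mfun_mul bw (bc _ (continuous_fint_right halpha b3))).
have k4 := rintegrable_bounded_itv (bounded_mfun_mul bw (bc _ (continuous_fint_left hbeta b4))).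
have hab' := ltW hab.
(* The factors 1 give a sum of three terms the shape of two nested uses of [Rintegral_lin]. *)
have id1 (p2 p3 p4 u v z k l : R) : p2 * u + p3 * (k * v) + p4 * (l * z) =
  1 * (1 * (p2 * u) + k * (p3 * v)) + l * (p4 * z) by ring.
have id2 (u v z k l : R) : 0 = 1 * (1 * (0 * u) + k * (0 * v)) + l * (0 * z) by ring.
have id3 (p u v z k l : R) : 1 * (1 * (p * u) + k * (p * v)) + l * (p * z) =
  p * (u + k * v + l * z) by ring.
transitivity (\int[mu]_(x in `[a, b]) ((1 * (1 * (f2 x * fint_left a b 0 w x) + ca * (f3 x * fint_left a b alpha w x))) +
   cb * (f4 x * fint_right a b beta w x))).
  (* The fractional integrals at a point of [A, B] see [w] as far as [a] or [b], so the swap must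
     take place on [a, b], with coefficients cut off. *)
  rewrite /first_variation; have -> : `[A, B]%classic = `[a, b] `&` `[A, B] :> set R.
    by apply/esym/setIidr; apply: subset_itv; rewrite bnd_simp.
  rewrite Rintegral_mkcondr; apply: eq_Rintegral => x xab.
  rewrite patchE /f2 /f3 /f4 !patchE; case: ifPn => _; [exact: id1|exact: id2].
rewrite (Rintegral_lin _ _ mab (rintegrableD mab (rintegrableZl 1 mab i2) (rintegrableZl ca mab i3)) i4).
rewrite (Rintegral_lin _ _ mab i2 i3).
rewrite [X in 1 * (1 * X + _) + _](fint_swap hab' h0 b2 bw).
rewrite [X in _ * (_ + ca * X) + _](fint_swap hab' halpha b3 bw).
rewrite -[X in _ + cb * X](fint_swap hab' hbeta bw b4).
transitivity (\int[mu]_(x in `[a, b]) ((1 * (1 * (w x * fint_right a b 0 f2 x) + ca * (w x * fint_right a b alpha f3 x))) +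
   cb * (w x * fint_left a b beta f4 x))).
  rewrite (Rintegral_lin _ _ mab (rintegrableD mab (rintegrableZl 1 mab k2) (rintegrableZl ca mab k3)) k4).
  by rewrite (Rintegral_lin _ _ mab k2 k3).
by apply: eq_Rintegral => x _; exact: id3.
Qed.

End Base.
End EulerFunction.

(** * Mean values and the du Bois-Reymond argument *)

Section ZeroIntegral.
Context {R : realType}.
Local Notation mu := (@lebesgue_measure R).
Implicit Types (f : R -> R) (a b x : R).

(** A positive value [f x0] would keep [f] above [f x0 / 2] on an interval of positive length. *)
Lemma ge0_Rintegral_eq0 a b f : a < b -> {within `[a, b], continuous f} ->
  (forall x, a <= x <= b -> 0 <= f x) ->
  \int[mu]_(x in `[a, b]) f x = 0 -> forall x, a <= x <= b -> f x = 0.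
Proof.
move=> ab cf f0 If x0 x0ab; apply/le_anti; rewrite f0// andbT leNgt; apply/negP => fx0.
have x0ab' : `[a, b]%classic x0 by rewrite /= in_itv.
have f20 : 0 < f x0 / 2 by rewrite divr_gt0.
have /subspace_continuousP/(_ _ x0ab')/cvgrPdist_lt/(_ _ f20) := cf.
rewrite near_withinE => /nbhs_ballP[d /= d0 hd].
have {}hd z : a <= z <= b -> `|x0 - z| < d -> f x0 / 2 <= f z.
  move=> zab zd; have := hd z zd; rewrite /= in_itv/= => /(_ zab).
  by rewrite /from_subspace ltr_norml => /andP[_ H]; apply: ltW; move: H; clear; lra.
(* Truncation at [a] and [b] covers an endpoint [x0]; the radius [d / 2] stays inside the open
   ball. *)
pose p := Num.max a (x0 - d / 2); pose q := Num.min b (x0 + d / 2).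
have ap : a <= p by rewrite /p le_max lexx.
have qb : q <= b by rewrite /q ge_min lexx.
have d20 : 0 < d / 2 by rewrite divr_gt0.
have /andP[ax0 x0b] := x0ab.
have pq : p < q.
  rewrite /p /q lt_min !gt_max ab/=; apply/andP; split.
    by rewrite (lt_le_trans _ x0b)// ltrBlDr ltrDl.
  by rewrite (le_lt_trans ax0) ?ltrDl//=; move: d20; clear; lra.
have mab : measurable (`[a, b]%classic : set (measurableTypeR R)) by exact: measurable_itv.
have mpq : measurable (`[p, q]%classic : set (measurableTypeR R)) by exact: measurable_itv.
have fi : rintegrable `[a, b] f.
  by apply: rintegrable_bounded_itv; exact: bounded_mfun_within_continuous.
have sub : `[p, q] `<=` (`[a, b]%classic : set R) by apply: subset_itv; rewrite bnd_simp.
have fi' : rintegrable `[p, q] f by exact: rintegrableS fi.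
have H1 : f x0 / 2 * (q - p) <= \int[mu]_(x in `[p, q]) f x.
  rewrite -Rintegral_cst_itv; last exact: ltW.
  apply: le_Rintegral => //.
    by apply: rintegrable_bounded_itv; exact: bounded_mfun_cst.
  move=> z; rewrite /= in_itv/= => /andP[pz zq]; apply: hd.
    by rewrite (le_trans ap)//= (le_trans zq).
  have h1 : x0 - d / 2 <= z by apply: le_trans pz; rewrite /p le_max lexx orbT.
  have h2 : z <= x0 + d / 2 by apply: le_trans zq _; rewrite /q ge_min lexx orbT.
  rewrite ltr_norml; move: h1 h2 d0; clear; move=> *; apply/andP; split; lra.
have H2 : \int[mu]_(x in `[p, q]) f x <= \int[mu]_(x in `[a, b]) f x.
  have -> : `[p, q]%classic = `[a, b] `&` `[p, q] :> set R by apply/esym/setIidr.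
  rewrite Rintegral_mkcondr; apply: le_Rintegral => //.
    rewrite -restrict_EFin; apply/integrable_restrict => //.
    by rewrite setIidr.
  move=> z; rewrite /= in_itv/= => zab; rewrite patchE; case: ifP => // _; exact: f0.
have : 0 < f x0 / 2 * (q - p) by rewrite mulr_gt0// subr_gt0.
by rewrite ltNge (le_trans H1)// -If.
Qed.

Definition mean a b f : R := (\int[mu]_(x in `[a, b]) f x) / (b - a).

(** A direction for [prim]: [clamp] makes it continuous on the line, and the zero mean over [a, b]
    makes its primitive vanish at [b]. *)
Definition centered a b f x : R := f (clamp a b x) - mean a b f.

Lemma continuous_centered a b f : a <= b -> {within `[a, b], continuous f} ->
  continuous (centered a b f).
Proof.
move=> ab cf x; apply: cvgB; last exact: cvg_cst.
exact: (continuous_comp_clamp ab cf).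
Qed.

Lemma centeredE a b f x : a <= x <= b -> centered a b f x = f x - mean a b f.
Proof. by move=> xab; rewrite /centered clamp_id. Qed.

Lemma Rintegral_centered a b f : a < b -> {within `[a, b], continuous f} ->
  \int[mu]_(x in `[a, b]) centered a b f x = 0.
Proof.
move=> ab cf.
have mab : measurable (`[a, b]%classic : set (measurableTypeR R)) by exact: measurable_itv.
have fi : rintegrable `[a, b] f.
  by apply: rintegrable_bounded_itv; exact: bounded_mfun_within_continuous.
have ci : rintegrable `[a, b] (fun=> mean a b f).
  by apply: rintegrable_bounded_itv; exact: bounded_mfun_cst.
transitivity (\int[mu]_(x in `[a, b]) (f x - mean a b f)).
  by apply: eq_Rintegral => x; rewrite inE/= in_itv/= => xab; rewrite centeredE.
rewrite (RintegralB mab fi ci) (Rintegral_cst_itv _ (ltW ab)).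
by rewrite /mean divfK ?subrr// gt_eqF// subr_gt0.
Qed.

(** Centered functions are orthogonal to constants, so the mean may be subtracted from the second
    factor. *)
Lemma Rintegral_centered_mul a b f : a < b -> {within `[a, b], continuous f} ->
  \int[mu]_(x in `[a, b]) (centered a b f x * f x) =
  \int[mu]_(x in `[a, b]) (f x - mean a b f) ^+ 2.
Proof.
move=> ab cf.
have mab : measurable (`[a, b]%classic : set (measurableTypeR R)) by exact: measurable_itv.
have bf := bounded_mfun_within_continuous cf.
have bc : bounded_mfun `[a, b] (centered a b f).
  by apply: bounded_mfun_continuous; apply: continuous_centered => //; exact: ltW.
have i1 := rintegrable_bounded_itv (bounded_mfun_mul bc bf).
have i2 := rintegrable_bounded_itv bc.
transitivity (\int[mu]_(x in `[a, b])
    (1 * (centered a b f x * f x) + (- mean a b f) * centered a b f x)).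
  rewrite (Rintegral_lin 1 (- mean a b f) mab i1 i2) (Rintegral_centered ab cf).
  by rewrite mulr0 addr0 mul1r.
apply: eq_Rintegral => x; rewrite inE/= in_itv/= => xab; rewrite (centeredE _ xab).
by ring.
Qed.

Lemma Rintegral_sqr_mean_eq0 a b f : a < b -> {within `[a, b], continuous f} ->
  \int[mu]_(x in `[a, b]) (f x - mean a b f) ^+ 2 = 0 ->
  forall x, a <= x <= b -> f x = mean a b f.
Proof.
move=> ab cf I0 x xab; apply/eqP; rewrite -subr_eq0 -sqrf_eq0; apply/eqP.
apply: (ge0_Rintegral_eq0 ab _ _ I0 xab); last by move=> z _; exact: sqr_ge0.
have cB : {within `[a, b], continuous (fun x => f x - mean a b f)}.
  by move=> z; apply: cvgB; [exact: cf|exact: cvg_cst].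
exact: (within_continuousM_fun cB cB).
Qed.

End ZeroIntegral.

(** * The multiplier rule at a local minimum *)

Section LagrangeMultiplier.
Context {R : realType}.
Local Notation mu := (@lebesgue_measure R).
Variables (a b A B alpha beta ya yb l : R).
Hypotheses (hab : a < b) (haA : a <= A) (hAB : A < B) (hBb : B <= b).
Hypotheses (halpha : 0 <= alpha < 1) (hbeta : 0 <= beta < 1).
Variables (L g : R -> R -> R -> R -> R) (N : (R -> R) -> R) (y : R -> R).
Hypotheses (hL : classC1 a b L) (hg : classC1 a b g).
Hypothesis hN : is_norm_on a b (Espace a b alpha beta) N.
Hypothesis hmin : local_minimum N (functional a b A B alpha beta L)
  (admissible a b A B alpha beta g ya yb l) y.

Local Notation E := (Espace a b alpha beta).
Local Notation J := (functional a b A B alpha beta).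
Local Notation dJ P := (first_variation a b A B alpha beta P y).
Local Notation W P := (euler_fun a b A B alpha beta P y).

Let hy : E y. Proof. by case: hmin => -[]. Qed.

(** Turns minimality for [N] into minimality in [(s, t)]: the difference of the curves is [- s] and
    [- t] times two fixed elements of the space, so its norm is linearly small. *)
Lemma local_minimum_path w1 w2 : continuous w1 -> continuous w2 ->
  prim a w1 b = 0 -> prim a w2 b = 0 ->
  exists2 d : R, 0 < d & forall s t, `|s| < d -> `|t| < d ->
    J g (fun x => y x + prim a (fun z => s * w1 z + t * w2 z) x) = l ->
    J L y <= J L (fun x => y x + prim a (fun z => s * w1 z + t * w2 z) x).
Proof.
move=> c1 c2 p1 p2; have [[_ yA yB yl] [del del0 hdel]] := hmin.
have [N0 _ NZ ND] := hN.
have Ep w : continuous w -> E (prim a w) by move=> cw; exact: Espace_prim.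
(* A multiple of a primitive is the primitive of a multiple, hence in the space. *)
have EZ r w : continuous w -> E (fun x => r * prim a w x).
  move=> cw; have -> : (fun x => r * prim a w x) = prim a (fun z => r * w z + 0 * w z).
    by apply/funext => x; rewrite prim_lin// mul0r addr0.
  by apply: Ep; exact: continuous_lin.
(* The summand 1 makes [M] positive and the final estimate strict. *)
pose M := N (prim a w1) + N (prim a w2) + 1.
have n1 := N0 _ (Ep _ c1); have n2 := N0 _ (Ep _ c2).
have M0 : 0 < M by rewrite ltr_wpDl// addr_ge0.
exists (del / M); first by rewrite divr_gt0.
move=> s t sd td Jl.
have cw := continuous_lin (r := s) (s := t) c1 c2.
have [hy1 _ _] := Espace_add_prim hab halpha hbeta hy cw.
apply: hdel.
  split => //; first by rewrite prim_id addr0.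
  by rewrite prim_lin// p1 p2 !mulr0 !addr0.
rewrite (_ : (fun x => _) = fun x => (- s) * prim a w1 x + (- t) * prim a w2 x); last first.
  by apply/funext => x; rewrite prim_lin//; ring.
apply: le_lt_trans (ND _ _ (EZ _ _ c1) (EZ _ _ c2)) _.
rewrite (NZ _ _ (Ep _ c1)) (NZ _ _ (Ep _ c2)) !normrN.
have K : del / M * M = del by rewrite divfK// gt_eqF.
rewrite -[ltRHS]K {2}/M !mulrDr mulr1.
apply: ltr_pwDr; first by rewrite divr_gt0.
by apply: lerD; apply: ler_wpM2r => //; exact: ltW.
Qed.

Lemma lagrange_multiplier : ~ (exists c, forall x, a <= x <= b -> W g x = c) ->
  exists lambda c, forall x, a <= x <= b -> W L x + lambda * W g x = c.
Proof.
move=> ncst.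
have mab : measurable (`[a, b]%classic : set (measurableTypeR R)) by exact: measurable_itv.
have cWg : {within `[a, b], continuous (W g)} by exact: within_euler_fun.
have cWL : {within `[a, b], continuous (W L)} by exact: within_euler_fun.
pose w0 := centered a b (W g).
have cw0 : continuous w0 by apply: continuous_centered => //; exact: ltW.
have vE P (w : R -> R) : classC1 a b P -> continuous w -> dJ P w = \int[mu]_(t in `[a, b]) (w t * W P t).
  by move=> hP cw; exact: first_variationE.
have vlin P (w w' : R -> R) (r s : R) : classC1 a b P -> continuous w -> continuous w' ->
    dJ P (fun z => r * w z + s * w' z) = r * dJ P w + s * dJ P w'.
  move=> hP cw cw'; rewrite !vE//; last exact: continuous_lin.
  have bW : bounded_mfun `[a, b] (W P).
    by apply: bounded_mfun_within_continuous; exact: within_euler_fun.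
  rewrite -(Rintegral_lin r s mab
    (rintegrable_bounded_itv (bounded_mfun_mul (bounded_mfun_continuous a b cw) bW))
    (rintegrable_bounded_itv (bounded_mfun_mul (bounded_mfun_continuous a b cw') bW))).
  by apply: eq_Rintegral => x _; rewrite mulrDl !mulrA.
have d00 : 0 < dJ g w0.
  rewrite vE// (Rintegral_centered_mul hab cWg) lt_neqAle Rintegral_ge0 ?andbT; last first.
    by move=> x _; exact: sqr_ge0.
  apply/eqP => /esym I0; apply: ncst; exists (mean a b (W g)).
  exact: Rintegral_sqr_mean_eq0.
pose lambda := - dJ L w0 / dJ g w0.
pose V x := W L x + lambda * W g x.
have cV : {within `[a, b], continuous V}.
  exact: (within_continuousD_fun cWL (within_continuousZ_fun (c := lambda) cWg)).
pose wF := centered a b V.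
have cwF : continuous wF by apply: continuous_centered => //; exact: ltW.
(* [w1] is the projection of [wF] onto the kernel of [dJ g] along [w0]. *)
pose k := dJ g wF / dJ g w0.
pose w1 z := 1 * wF z + (- k) * w0 z.
have cw1 : continuous w1 by exact: continuous_lin.
have p0 : prim a w0 b = 0 by rewrite primE ?ltW// Rintegral_centered.
have pF : prim a wF b = 0 by rewrite primE ?ltW// Rintegral_centered.
have p1 : prim a w1 b = 0 by rewrite prim_lin// p0 pF !mulr0 addr0.
have dg1 : dJ g w1 = 0.
  by rewrite /w1 vlin// /k mul1r mulNr divfK ?subrr// gt_eqF.
have dL1 : dJ L w1 = 0.
  have yl : J g y = l by case: hmin => -[].
  apply: (@constrained_min_slope_eq0 _
    (fun s t => J g (fun x => y x + prim a (fun z => s * w1 z + t * w0 z) x))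
    (fun s t => J L (fun x => y x + prim a (fun z => s * w1 z + t * w0 z) x))
    l (J L y) (dJ g w0) (dJ L w1) (dJ L w0) d00).
  - move=> s; exact: (functional_path_continuous hab haA hAB hBb halpha hbeta (s := s) hg hy cw1 cw0).
  - move=> e e0.
    have := functional_expansion hab haA hAB hBb halpha hbeta hg hy cw1 cw0 e0.
    by rewrite dg1 yl.
  - move=> e e0.
    exact: (functional_expansion hab haA hAB hBb halpha hbeta hL hy cw1 cw0 e0).
  - exact: local_minimum_path.
have idE (p u v r : R) : p * (u + r * v) = 1 * (p * u) + r * (p * v) by ring.
have cancelE (p q r : R) : 1 * (r / q * p) + (- p / q) * r = 0.
  by rewrite mul1r mulNr mulNr mulrAC (mulrC r) mulrAC subrr.
have dF : \int[mu]_(t in `[a, b]) (wF t * V t) = 0.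
  have bL := bounded_mfun_mul (bounded_mfun_continuous a b cwF) (bounded_mfun_within_continuous cWL).
  have bg := bounded_mfun_mul (bounded_mfun_continuous a b cwF) (bounded_mfun_within_continuous cWg).
  transitivity (1 * dJ L wF + lambda * dJ g wF).
    rewrite !vE// -(Rintegral_lin 1 lambda mab (rintegrable_bounded_itv bL) (rintegrable_bounded_itv bg)).
    by apply: eq_Rintegral => x _; exact: idE.
  (* Stationarity along [w1] transfers the variation of [L] from [wF] to [w0], where [lambda] was
     chosen to cancel it. *)
  have dLF : dJ L wF = k * dJ L w0.
    by move: dL1; rewrite /w1 vlin// mul1r mulNr => /subr0_eq.
  rewrite dLF; exact: cancelE.
exists lambda, (mean a b V); apply: Rintegral_sqr_mean_eq0 => //.
by rewrite -Rintegral_centered_mul.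
Qed.

End LagrangeMultiplier.

(** * Positivity of the Gamma function *)

Section GammaPositive.
Context {R : realType}.
Local Notation mu := (@lebesgue_measure R).

(** A divergent real integral would have the value 0, so integrability comes first: the integrand is
    dominated by [t ^ (- g)] on []0, 1]] and by the exponential density beyond 1. *)
Lemma Gamma_gt0 (g : R) : 0 <= g < 1 -> 0 < Gamma (1 - g).
Proof.
move=> g01; have /andP[g0 g1] := g01.
have E : 1 - g - 1 = - g by rewrite addrAC subrr add0r.
pose f (t : R) := t `^ (- g) * expR (- t).
rewrite /Gamma E -/f.
have m0 : measurable (`]0, +oo[%classic : set (measurableTypeR R)) by exact: measurable_itv.
have m1 : measurable (`[0, 1]%classic : set (measurableTypeR R)) by exact: measurable_itv.
have m2 : measurable (`[1, 2]%classic : set (measurableTypeR R)) by exact: measurable_itv.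
have mf (D : set (measurableTypeR R)) : measurable_fun D f.
  apply: measurable_funTS; apply: measurable_funM => //.
  exact: measurableT_comp.
have ki : rintegrable `]0, +oo[ ((fun t => frac_ker g (t - 0)) \_ `[0, 1]).
  rewrite /rintegrable -restrict_EFin; apply/integrable_restrict => //.
  apply: (rintegrableS (E := `[0, 1])) => //; first exact: measurableI.
  by apply: rintegrable_frac_ker_right; rewrite // lexx ler01.
have ei : rintegrable `]0, +oo[ (@exponential_pdf R 1).
  apply: (rintegrableS (E := setT)) => //.
  by apply: integrable_exponential_pdf.
have fi : rintegrable `]0, +oo[ f.
  apply: le_integrable (rintegrableD m0 ki ei) => //.
    exact/measurable_EFinP.
  move=> t; rewrite /= in_itv/= andbT => t0; rewrite lee_fin.
  rewrite [X in X <= _]ger0_norm; last by rewrite mulr_ge0 ?powR_ge0 ?expR_ge0.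
  rewrite ger0_norm; last first.
    rewrite addr_ge0 ?exponential_pdf_ge0// patchE; case: ifP => // _.
    exact: frac_ker_ge0.
  have pdfE : exponential_pdf 1 t = expR (- t).
    by rewrite /exponential_pdf patchE mem_set/= ?in_itv/= ?andbT ?ltW// mul1r mulN1r.
  rewrite pdfE patchE; case: ifPn; rewrite ?inE ?notin_setE/= in_itv/= (ltW t0)/=.
    move=> t1; rewrite subr0 (frac_kerE _ (ltW t0)) ler_wpDr ?expR_ge0//.
    by rewrite /f ler_piMr ?powR_ge0// -expR0 ler_expR oppr_le0 ltW.
  move=> /negP; rewrite -ltNge => t1; rewrite [X in X + _](_ : _ = 0)// add0r.
  rewrite /f ler_piMl ?expR_ge0// powRN invf_le1 ?powR_gt0//.
  apply: (@le_trans _ _ (1 `^ g)); first by rewrite powR1.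
  by apply: ge0_ler_powR; rewrite ?nnegrE//; exact: ltW.
have fi2 : rintegrable `[1, 2] f.
  apply: rintegrableS fi => // t; rewrite /= !in_itv/= andbT => /andP[t1 _].
  exact: lt_le_trans t1.
(* The integrand decreases, so its value at 2 bounds it below on [1, 2], an interval of length 1. *)
have c0 : 0 < 2 `^ (- g) * expR (- 2 : R) by rewrite mulr_gt0 ?powR_gt0 ?expR_gt0.
apply: (lt_le_trans c0).
have f0 t : 0 <= f t by rewrite mulr_ge0 ?powR_ge0 ?expR_ge0.
apply: (@le_trans _ _ (\int[mu]_(t in `[1, 2]) f t)).
  have -> : 2 `^ (- g) * expR (- 2 : R) = \int[mu]_(t in `[1, 2]) (2 `^ (- g) * expR (- 2 : R)).
    by rewrite Rintegral_cst_itv ?ler1n//; ring.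
  apply: le_Rintegral => //.
    by apply: rintegrable_bounded_itv; exact: bounded_mfun_cst.
  move=> t; rewrite /= in_itv/= => /andP[t1 t2].
  apply: ler_pM; rewrite ?powR_ge0 ?expR_ge0 ?ler_expR ?lerN2//.
  rewrite !powRN lef_pV2 ?posrE ?powR_gt0 ?(lt_le_trans ltr01 t1)//.
  by apply: ge0_ler_powR; rewrite ?nnegrE// (le_trans ler01 t1).
have -> : `[1, 2]%classic = `]0, +oo[ `&` `[1, 2] :> set (measurableTypeR R).
  apply/esym/setIidr => t; rewrite /= !in_itv/= andbT => /andP[t1 _].
  exact: lt_le_trans t1.
rewrite Rintegral_mkcondr; apply: le_Rintegral => //.
  rewrite -restrict_EFin; apply/integrable_restrict => //.
  apply: (rintegrableS (E := `[1, 2])) => //; first exact: measurableI.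
by move=> t _; rewrite patchE; case: ifP => // _; exact: f0.
Qed.

End GammaPositive.

(** * Derivatives within an interval *)

Section DeriveWithin.
Context {R : realType}.
Implicit Types (D S : set R) (f h : R -> R) (p q x d c : R).

(** Existence and value in a single relation, so that linear combinations and changes of interval
    carry both. *)
Definition has_derive_within D f x d : Prop :=
  diff_quotient f x t @[t --> within D x^'] --> d.

(** Limits are unique along proper filters only: a nondegenerate interval approaches each of its
    points from inside, from the right if [x < q] and from the left at [q]. *)
Lemma within_dnbhs_itv_proper p q x : p < q -> p <= x <= q ->
  ProperFilter (within `[p, q] x^').
Proof.
move=> pq /andP[px xq]; apply: Build_ProperFilter => -[e /= e0 H].
have [xq'|qx] := ltP x q.
  pose t := Num.min q (x + e / 2).
  have xt : x < t by rewrite /t lt_min xq' ltrDl divr_gt0.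
  apply: (H t); last 2 first.
  - by rewrite gt_eqF.
  - by rewrite /= in_itv/= (le_trans px (ltW xt))/= /t ge_min lexx.
  rewrite /= ltr0_norm ?subr_lt0// opprB ltrBlDl.
  apply: (@le_lt_trans _ _ (x + e / 2)); first by rewrite /t ge_min lexx orbT.
  by rewrite ltrD2l ltr_pdivrMr// ltr_pMr// ltr1n.
have xE : x = q by apply/le_anti; rewrite xq qx.
pose t := Num.max p (x - e / 2).
have xt : t < x by rewrite /t gt_max xE pq ltrBlDr ltrDl divr_gt0.
apply: (H t); last 2 first.
- by rewrite lt_eqF.
- by rewrite /= in_itv/= /t le_max lexx/= -/t -xE ltW.
rewrite /= gtr0_norm ?subr_gt0// ltrBlDr -ltrBlDl.
apply: (@lt_le_trans _ _ (x - e / 2)); last by rewrite /t le_max lexx orbT.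
by rewrite ltrD2l ltrN2 ltr_pdivrMr// ltr_pMr// ltr1n.
Qed.

Lemma derivable_within_has D f x : derivable_within D f x ->
  has_derive_within D f x (derive_within D f x).
Proof. by []. Qed.

Lemma has_derive_within_derivable D f x d : has_derive_within D f x d ->
  derivable_within D f x.
Proof. by move=> h; apply/cvg_ex; exists d. Qed.

Lemma has_derive_within_unique p q f x d d' : p < q -> p <= x <= q ->
  has_derive_within `[p, q] f x d -> has_derive_within `[p, q] f x d' -> d = d'.
Proof.
move=> pq xpq h h'; have PF := within_dnbhs_itv_proper pq xpq.
exact: (cvg_unique (@norm_hausdorff _ _) h h').
Qed.

Lemma has_derive_withinE p q f x d : p < q -> p <= x <= q ->
  has_derive_within `[p, q] f x d -> derive_within `[p, q] f x = d.
Proof.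
move=> pq xpq h; apply: (has_derive_within_unique pq xpq _ h).
exact: (derivable_within_has (has_derive_within_derivable h)).
Qed.

(** A smaller set refines the filter. Thus a derivative within [a, B] can be read within [A, B] or
    [a, A], becoming one-sided at [A] with the same value. *)
Lemma has_derive_withinS D S f x d : S `<=` D ->
  has_derive_within D f x d -> has_derive_within S f x d.
Proof.
move=> SD h A /h; rewrite /has_derive_within /nbhs/= /within/= /nbhs/=.
by apply: filterS => t H /SD.
Qed.

Lemma eq_has_derive_within D f h x d : {in D, f =1 h} -> D x ->
  has_derive_within D f x d -> has_derive_within D h x d.
Proof.
move=> fh Dx; apply: cvg_trans; apply: near_eq_cvg.
rewrite near_withinE; near=> t => Dt.
by rewrite /diff_quotient !fh ?inE.
Unshelve. all: by end_near. Qed.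

Lemma has_derive_within_lin D f h x r s d d' :
  has_derive_within D f x d -> has_derive_within D h x d' ->
  has_derive_within D (fun t => r * f t + s * h t) x (r * d + s * d').
Proof.
move=> hf hh.
rewrite /has_derive_within (_ : diff_quotient _ x =
  (fun t => r * diff_quotient f x t + s * diff_quotient h x t)).
  by apply: cvgD; apply: cvgMl_tmp.
by apply/funext => t; rewrite /diff_quotient; ring.
Qed.

Lemma has_derive_within_cst D c x : has_derive_within D (fun=> c) x 0.
Proof.
rewrite /has_derive_within (_ : diff_quotient _ x = fun=> 0); first exact: cvg_cst.
by apply/funext => t; rewrite /diff_quotient subrr mul0r.
Qed.

Lemma is_derive_has_derive_within D f x d : is_derive x 1 f d -> has_derive_within D f x d.
Proof.
move=> [df <-]; apply/cvgrPdist_lt => e e0.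
have /cvgrPdist_lt/(_ _ e0)[n /= n0 H] := df.
rewrite near_withinE; exists n => //= t xt tx _.
have := H (t - x); rewrite /= sub0r normrN distrC => /(_ xt).
rewrite subr_eq0 => /(_ tx); rewrite /diff_quotient /GRing.scale/= mulr1 subrK mulrC.
exact.
Qed.

End DeriveWithin.

(** * Euler-Lagrange equations *)

Section EulerEquations.
Context {R : realType}.
Local Notation mu := (@lebesgue_measure R).
Variables (a b A B alpha beta : R).
Hypotheses (hab : a < b) (haA : a <= A) (hAB : A < B) (hBb : B <= b).
Hypotheses (halpha : 0 <= alpha < 1) (hbeta : 0 <= beta < 1).
Implicit Types (f : R -> R) (x t c : R).

Local Notation ca := (1 / Gamma (1 - alpha)).
Local Notation cb := (-1 / Gamma (1 - beta)).

(** At order 0 the right integral is the ordinary integral from [x] to [B]; for the clamped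
    extension of [f] the fundamental theorem is two-sided even at [A] and [B]. *)
Lemma has_derive_within_Rintegral f x : {within `[A, B], continuous f} ->
  A <= x <= B -> has_derive_within `[A, B] (fint_right A B 0 f) x (- f x).
Proof.
move=> cf xAB; pose fc := f \o clamp A B.
have cfc : continuous fc by apply: continuous_comp_clamp => //; exact: ltW.
have Dx : `[A, B]%classic x by rewrite /= in_itv.
have fE t : t \in (`[A, B]%classic : set R) ->
    1 * prim A fc B + -1 * prim A fc t = fint_right A B 0 f t.
  rewrite inE/= in_itv/= => /andP[At tB]; rewrite mul1r mulN1r primB//.
  rewrite fint_right_in ?At//; apply: eq_Rintegral => s; rewrite inE/= in_itv/= => /andP[ts sB].
  by rewrite oppr0 powRr0 mul1r /fc/= clamp_id// sB (le_trans At).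
apply: (eq_has_derive_within fE Dx).
have /andP[Ax _] := xAB; have A1 : A - 1 < x by rewrite ltrBlDr (le_lt_trans Ax)// ltrDl.
have := has_derive_within_lin (r := 1) (s := (-1)) (@has_derive_within_cst R `[A, B] (prim A fc B) x)
  (@is_derive_has_derive_within R `[A, B] _ _ _ (is_derive_prim cfc A1)).
by rewrite mulr0 add0r mulN1r /fc/= clamp_id.
Qed.

Variables (f2 f3 f4 : R -> R) (c : R).
Hypotheses (hf2 : {within `[A, B], continuous f2}).
Hypotheses (hf3 : bounded_mfun `[a, b] f3) (hf4 : bounded_mfun `[a, b] f4).
Hypothesis hW : forall x, a <= x <= b ->
  fint_right a b 0 (f2 \_ `[A, B]) x + ca * fint_right a b alpha (f3 \_ `[A, B]) x +
  cb * fint_left a b beta (f4 \_ `[A, B]) x = c.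
Hypothesis he3 : forall x, a <= x <= B -> RLright_exists a alpha B f3 x.
Hypothesis he4 : forall x, A <= x <= b -> RLleft_exists A beta b f4 x.

Lemma euler_equation_inner x : A <= x <= B ->
  f2 x + RLright a alpha B f3 x + RLleft A beta b f4 x = 0.
Proof.
move=> xAB; have /andP[Ax xB] := xAB.
have Dx : `[A, B]%classic x by rewrite /= in_itv.
have H2 := has_derive_within_Rintegral hf2 xAB.
have H3 : has_derive_within `[A, B] (RLright_int alpha B f3) x
    (derive_within `[a, B] (RLright_int alpha B f3) x).
  apply: (has_derive_withinS (D := `[a, B])); first by apply: subset_itvr; rewrite bnd_simp.
  by apply: derivable_within_has; apply: he3; rewrite (le_trans haA).
have H4 : has_derive_within `[A, B] (RLleft_int A beta f4) x
    (derive_within `[A, b] (RLleft_int A beta f4) x).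
  apply: (has_derive_withinS (D := `[A, b])); first by apply: subset_itvl; rewrite bnd_simp.
  by apply: derivable_within_has; apply: he4; rewrite Ax (le_trans xB).
have H := has_derive_within_lin (r := 1) (s := cb) (has_derive_within_lin (r := 1) (s := ca) H2 H3) H4.
have H0 : has_derive_within `[A, B] (fun t => 1 * (1 * fint_right A B 0 f2 t +
    ca * RLright_int alpha B f3 t) + cb * RLleft_int A beta f4 t) x 0.
  apply: (eq_has_derive_within _ Dx (@has_derive_within_cst R `[A, B] c x)) => t.
  rewrite inE/= in_itv/= => /andP[At tB].
  rewrite -(hW (x := t)); last by rewrite (le_trans haA)//= (le_trans tB).
  rewrite !(fint_right_restrict _ _ _ haA hBb) (fint_left_restrict _ _ _ haA hBb).
  by rewrite (@fint_right_in _ _ _ alpha) ?At// (@fint_left_in _ _ _ beta) ?At// !mul1r.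
have := has_derive_within_unique hAB xAB H H0.
rewrite /RLright /RLleft.
set d3 := derive_within _ _ x; set d4 := derive_within _ _ x.
(* The constants of [RLright] and [RLleft] are [- ca] and [- cb], so the derivative found is minus
   the required sum. *)
move=> E; rewrite -[RHS]oppr0 -E; ring.
Qed.

(** On [a, A] the integrals ending at [B] and at [A] differ by a constant. Derivability of the one
    ending at [A] is therefore obtained together with the equality; isolating it takes a division by
    [ca]. *)
Lemma euler_equation_left x : Gamma (1 - alpha) != 0 -> a < A -> a <= x <= A ->
  RLright_exists a alpha A f3 x /\
  RLright a alpha B f3 x - RLright a alpha A f3 x = 0.
Proof.
move=> G0 aA xaA; have /andP[ax xA] := xaA.
have Dx : `[a, A]%classic x by rewrite /= in_itv.
have ca0 : ca != 0 by rewrite mul1r invr_eq0.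
have H3 : has_derive_within `[a, A] (RLright_int alpha B f3) x
    (derive_within `[a, B] (RLright_int alpha B f3) x).
  apply: (has_derive_withinS (D := `[a, B])).
    by apply: subset_itvl; rewrite bnd_simp ltW.
  by apply: derivable_within_has; apply: he3; rewrite ax (le_trans xA)// ltW.
(* Left of [A], the order 0 term is the whole integral of [f2], independent of [t]. *)
pose m := \int[mu]_(s in `[A, B]) f2 s.
have E t : t \in (`[a, A]%classic : set R) ->
    1 * RLright_int alpha B f3 t + 1 * (- ((c - m) / ca)) = RLright_int alpha A f3 t.
  rewrite inE/= in_itv/= => /andP[at_ tA].
  have tb : a <= t <= b by rewrite at_ (le_trans tA)// (le_trans (ltW hAB)).
  have K2 : fint_right A B 0 f2 t = m.
    apply: eq_Rintegral => s; rewrite inE/= in_itv/= => /andP[As sB].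
    by rewrite frac_kerE ?subr_ge0 ?(le_trans tA)// oppr0 powRr0 mul1r.
  have b3 : bounded_mfun `[t, B] f3.
    by apply: bounded_mfunS hf3 => //; apply: subset_itv; rewrite bnd_simp.
  have := hW tb.
  rewrite !(fint_right_restrict _ _ _ haA hBb) (fint_left_restrict _ _ _ haA hBb).
  rewrite K2 (fint_left_out _ _ _ tA) mulr0 addr0 (fint_right_split halpha tA (ltW hAB) b3).
  move=> <-; rewrite [m + _]addrC addrK [ca * _ / _]mulrAC divff//.
  by rewrite !mul1r opprB addrC subrK.
have H3' : has_derive_within `[a, A] (RLright_int alpha A f3) x
    (derive_within `[a, B] (RLright_int alpha B f3) x).
  apply: (eq_has_derive_within E Dx).
  have := has_derive_within_lin (r := 1) (s := 1) H3 (@has_derive_within_cst R `[a, A] (- ((c - m) / ca)) x).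
  by rewrite [X in has_derive_within _ _ _ X -> _](_ : _ =
    derive_within `[a, B] (RLright_int alpha B f3) x)// mulr0 addr0 mul1r.
split; first exact: has_derive_within_derivable H3'.
by rewrite /RLright (has_derive_withinE aA xaA H3') subrr.
Qed.

(** Beyond [B] both right integrals vanish, so the constant is [c / cb], with no contribution of
    [f2]. *)
Lemma euler_equation_right x : Gamma (1 - beta) != 0 -> B < b -> B <= x <= b ->
  RLleft_exists B beta b f4 x /\
  RLleft A beta b f4 x - RLleft B beta b f4 x = 0.
Proof.
move=> G0 Bb xBb; have /andP[Bx xb] := xBb.
have Dx : `[B, b]%classic x by rewrite /= in_itv.
have cb0 : cb != 0 by rewrite mulf_neq0 ?invr_eq0// oppr_eq0 oner_eq0.
have H4 : has_derive_within `[B, b] (RLleft_int A beta f4) x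
    (derive_within `[A, b] (RLleft_int A beta f4) x).
  apply: (has_derive_withinS (D := `[A, b])).
    by apply: subset_itvr; rewrite bnd_simp ltW.
  by apply: derivable_within_has; apply: he4; rewrite xb (le_trans (ltW hAB)).
have E t : t \in (`[B, b]%classic : set R) ->
    1 * RLleft_int A beta f4 t + 1 * (- (c / cb)) = RLleft_int B beta f4 t.
  rewrite inE/= in_itv/= => /andP[Bt tb].
  have tab : a <= t <= b by rewrite tb (le_trans haA)// (le_trans (ltW hAB)).
  have b4 : bounded_mfun `[A, t] f4.
    by apply: bounded_mfunS hf4 => //; apply: subset_itv; rewrite bnd_simp.
  have := hW tab.
  rewrite !(fint_right_restrict _ _ _ haA hBb) (fint_left_restrict _ _ _ haA hBb).
  rewrite !(fint_right_out _ _ _ Bt) mulr0 addr0 add0r (fint_left_split hbeta (ltW hAB) Bt b4).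
  move=> <-; rewrite [cb * _ / _]mulrAC divff//.
  by rewrite !mul1r opprB addrC subrK.
have H4' : has_derive_within `[B, b] (RLleft_int B beta f4) x
    (derive_within `[A, b] (RLleft_int A beta f4) x).
  apply: (eq_has_derive_within E Dx).
  have := has_derive_within_lin (r := 1) (s := 1) H4 (@has_derive_within_cst R `[B, b] (- (c / cb)) x).
  by rewrite [X in has_derive_within _ _ _ X -> _](_ : _ =
    derive_within `[A, b] (RLleft_int A beta f4) x)// mulr0 addr0 mul1r.
split; first exact: has_derive_within_derivable H4'.
by rewrite /RLleft (has_derive_withinE Bb xBb H4') subrr.
Qed.

End EulerEquations.

(** * Linearity in the Lagrangian *)

Section MultiplierLagrangian.
Context {R : realType}.
Implicit Types (L g : R -> R -> R -> R -> R) (a b A B x y u v lambda : R).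

Lemma derive1_lin (f h : R -> R) c x : derivable f x 1 -> derivable h x 1 ->
  derive1 (fun s => f s + c * h s) x = derive1 f x + c * derive1 h x.
Proof.
move=> df dh; have dch : derivable (c \*: h) x 1 by exact: derivableZ.
by rewrite !derive1E (deriveD df dch) deriveZ.
Qed.

Lemma partial_lin a b L g lambda x y u v : classC1 a b L -> classC1 a b g ->
  a <= x <= b -> let F := fun x y u v => L x y u v + lambda * g x y u v in
  [/\ partial2 F x y u v = partial2 L x y u v + lambda * partial2 g x y u v,
      partial3 F x y u v = partial3 L x y u v + lambda * partial3 g x y u v &
      partial4 F x y u v = partial4 L x y u v + lambda * partial4 g x y u v].
Proof.
move=> [dL _] [dg _] xab; have xab' : x \in `[a, b] by rewrite in_itv.
have [_ L2 L3 L4] := dL x y u v xab'; have [_ g2 g3 g4] := dg x y u v xab'.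
split; [exact: (derive1_lin lambda L2 g2)|exact: (derive1_lin lambda L3 g3)|
  exact: (derive1_lin lambda L4 g4)].
Qed.

Lemma within_lin (S : set R) (f h k : R -> R) lambda :
  {in S, (fun x => f x + lambda * h x) =1 k} ->
  {within S, continuous f} -> {within S, continuous h} -> {within S, continuous k}.
Proof.
move=> E cf ch; apply: (subspace_eq_continuous E).
exact: (within_continuousD_fun cf (within_continuousZ_fun (c := lambda) ch)).
Qed.

(** Equality is asked on [a, b] only: the partial derivatives of [F] are known to split just for [x]
    in [a, b], where [L] and [g] are of class C1. *)
Lemma fint_left_lin_eq a b (gam : R) (f h k : R -> R) lambda x : 0 <= gam < 1 ->
  bounded_mfun `[a, b] f -> bounded_mfun `[a, b] h ->
  {in `[a, b]%classic, (fun x => f x + lambda * h x) =1 k} -> a <= x <= b ->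
  fint_left a b gam k x = fint_left a b gam f x + lambda * fint_left a b gam h x.
Proof.
move=> g01 bf bh E xab.
have := fint_left_lin 1 lambda g01 bf bh xab; rewrite [X in _ = X + _ -> _]mul1r => <-.
by apply: eq_Rintegral => t tab; rewrite mul1r -E.
Qed.

Lemma fint_right_lin_eq a b (gam : R) (f h k : R -> R) lambda x : 0 <= gam < 1 ->
  bounded_mfun `[a, b] f -> bounded_mfun `[a, b] h ->
  {in `[a, b]%classic, (fun x => f x + lambda * h x) =1 k} -> a <= x <= b ->
  fint_right a b gam k x = fint_right a b gam f x + lambda * fint_right a b gam h x.
Proof.
move=> g01 bf bh E xab.
have := fint_right_lin 1 lambda g01 bf bh xab; rewrite [X in _ = X + _ -> _]mul1r => <-.
by apply: eq_Rintegral => t tab; rewrite mul1r -E.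
Qed.

Lemma restrict_lin (S D : set R) (f h k : R -> R) lambda :
  {in S, (fun x => f x + lambda * h x) =1 k} ->
  {in S, (fun x => (f \_ D) x + lambda * (h \_ D) x) =1 (k \_ D)}.
Proof.
move=> E x xS; rewrite /= !patchE; case: ifP => _; first exact: E.
by rewrite mulr0 addr0.
Qed.

Lemma RLright_exists_lin a B (alpha : R) (f h k : R -> R) lambda x : 0 <= alpha < 1 ->
  bounded_mfun `[a, B] f -> bounded_mfun `[a, B] h ->
  {in `[a, B]%classic, (fun x => f x + lambda * h x) =1 k} -> a <= x <= B ->
  RLright_exists a alpha B f x -> RLright_exists a alpha B h x ->
  RLright_exists a alpha B k x.
Proof.
move=> a01 bf bh E xaB /derivable_within_has df /derivable_within_has dh.
have Dx : `[a, B]%classic x by rewrite /= in_itv.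
have EI t : t \in (`[a, B]%classic : set R) ->
    1 * RLright_int alpha B f t + lambda * RLright_int alpha B h t = RLright_int alpha B k t.
  rewrite inE/= in_itv/= => taB; rewrite mul1r -!(fint_right_in _ _ taB).
  by rewrite -(fint_right_lin_eq a01 bf bh E taB).
exact: (has_derive_within_derivable (eq_has_derive_within EI Dx
  (has_derive_within_lin (r := 1) (s := lambda) df dh))).
Qed.

Lemma RLleft_exists_lin A b (beta : R) (f h k : R -> R) lambda x : 0 <= beta < 1 ->
  bounded_mfun `[A, b] f -> bounded_mfun `[A, b] h ->
  {in `[A, b]%classic, (fun x => f x + lambda * h x) =1 k} -> A <= x <= b ->
  RLleft_exists A beta b f x -> RLleft_exists A beta b h x ->
  RLleft_exists A beta b k x.
Proof.
move=> b01 bf bh E xAb /derivable_within_has df /derivable_within_has dh.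
have Dx : `[A, b]%classic x by rewrite /= in_itv.
have EI t : t \in (`[A, b]%classic : set R) ->
    1 * RLleft_int A beta f t + lambda * RLleft_int A beta h t = RLleft_int A beta k t.
  rewrite inE/= in_itv/= => tAb; rewrite mul1r -!(fint_left_in _ _ tAb).
  by rewrite -(fint_left_lin_eq b01 bf bh E tAb).
exact: (has_derive_within_derivable (eq_has_derive_within EI Dx
  (has_derive_within_lin (r := 1) (s := lambda) df dh))).
Qed.

End MultiplierLagrangian.

(** As [derive_within] is a [lim], an equation has its intended meaning only when the derivatives
    exist, so each line also asserts their existence. The guards [a < A] and [B < b] express that
    the second and third lines are void otherwise. *)
Theorem theorem3p6 (R : realType) (a b A B alpha beta ya yb l : R)
  (L g : R -> R -> R -> R -> R) (N : (R -> R) -> R) (y : R -> R)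
  (hab : a < b) (haA : a <= A) (hAB : A < B) (hBb : B <= b)
  (halpha : 0 < alpha < 1) (hbeta : 0 < beta < 1)
  (hL : classC1 a b L) (hg : classC1 a b g)
  (hN : is_norm_on a b (Espace a b alpha beta) N)
  (hmin : local_minimum N (functional a b A B alpha beta L)
            (admissible a b A B alpha beta g ya yb l) y)
  (hL3 : continuous_RLright a alpha B (along a b alpha beta (partial3 L) y))
  (hg3 : continuous_RLright a alpha B (along a b alpha beta (partial3 g) y))
  (hL4 : continuous_RLleft A beta b (along a b alpha beta (partial4 L) y))
  (hg4 : continuous_RLleft A beta b (along a b alpha beta (partial4 g) y))
  (hext : ~ extremal a b A B alpha beta g y) :
  exists lambda : R,
    let F := fun x y u v : R => L x y u v + lambda * g x y u v in
    let F2 := along a b alpha beta (partial2 F) y in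
    let F3 := along a b alpha beta (partial3 F) y in
    let F4 := along a b alpha beta (partial4 F) y in
    [/\ forall x, x \in `[A, B] ->
          [/\ RLright_exists a alpha B F3 x,
              RLleft_exists A beta b F4 x &
              F2 x + RLright a alpha B F3 x + RLleft A beta b F4 x = 0],
        a < A -> forall x, x \in `[a, A] ->
          [/\ RLright_exists a alpha B F3 x,
              RLright_exists a alpha A F3 x &
              RLright a alpha B F3 x - RLright a alpha A F3 x = 0] &
        B < b -> forall x, x \in `[B, b] ->
          [/\ RLleft_exists A beta b F4 x,
              RLleft_exists B beta b F4 x &
              RLleft A beta b F4 x - RLleft B beta b F4 x = 0]].
Proof.
have a01 : 0 <= alpha < 1 by case/andP: halpha => /ltW -> ->.
have b01 : 0 <= beta < 1 by case/andP: hbeta => /ltW -> ->.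
have h0 : 0 <= (0 : R) < 1 by rewrite lexx ltr01.
have hy : Espace a b alpha beta y by case: hmin => -[].
have subAB : `[A, B] `<=` (`[a, b]%classic : set R) by apply: subset_itv; rewrite bnd_simp.
have subaB : `[a, B] `<=` (`[a, b]%classic : set R) by apply: subset_itvl; rewrite bnd_simp.
have subAb : `[A, b] `<=` (`[a, b]%classic : set R) by apply: subset_itvr; rewrite bnd_simp.
have [_ [_ /continuous4_cont4 cL2 /continuous4_cont4 cL3 /continuous4_cont4 cL4]] := hL.
have [_ [_ /continuous4_cont4 cg2 /continuous4_cont4 cg3 /continuous4_cont4 cg4]] := hg.
have wAB G : cont4 a b G -> {within `[A, B], continuous (along a b alpha beta G y)}.
  by move=> cG; apply: (continuous_subspaceW subAB); exact: along_within.
have bd G := bounded_along (G := G) hy.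
have bdR G := bounded_along_restrict A B hy (G := G).
have [|lambda [c hc]] := lagrange_multiplier hab haA hAB hBb a01 b01 hL hg hN hmin.
  (* A constant [euler_fun] for [g] would make [y] an extremal, by the same differentiation that
     later yields the first equation for [F]. *)
  move=> [c hc]; apply: hext => x xAB.
  apply: (euler_equation_inner haA hAB hBb (wAB _ cg2) hc).
  - by move=> z zaB; apply: hg3.1; rewrite in_itv.
  - by move=> z zAb; apply: hg4.1; rewrite in_itv.
  - by rewrite in_itv in xAB.
exists lambda => F F2 F3 F4.
have FE x : x \in (`[a, b]%classic : set R) ->
    [/\ along a b alpha beta (partial2 L) y x + lambda * along a b alpha beta (partial2 g) y x = F2 x,
        along a b alpha beta (partial3 L) y x + lambda * along a b alpha beta (partial3 g) y x = F3 x &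
        along a b alpha beta (partial4 L) y x + lambda * along a b alpha beta (partial4 g) y x = F4 x].
  rewrite inE/= in_itv/= => xab.
  by have [] := partial_lin lambda (y x) (Cleft a alpha y x) (Cright beta b y x) hL hg xab.
have F2E : {in `[a, b]%classic, (fun x => along a b alpha beta (partial2 L) y x +
    lambda * along a b alpha beta (partial2 g) y x) =1 F2} by move=> x /FE[].
have F3E : {in `[a, b]%classic, (fun x => along a b alpha beta (partial3 L) y x +
    lambda * along a b alpha beta (partial3 g) y x) =1 F3} by move=> x /FE[].
have F4E : {in `[a, b]%classic, (fun x => along a b alpha beta (partial4 L) y x +
    lambda * along a b alpha beta (partial4 g) y x) =1 F4} by move=> x /FE[].
have cF2 : {within `[A, B], continuous F2}.
  apply: (within_lin (lambda := lambda) _ (wAB _ cL2) (wAB _ cg2)) => x.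
  by rewrite inE => /subAB xab; apply: F2E; rewrite inE.
have bF3 : bounded_mfun `[a, b] F3.
  apply: eq_bounded_mfun F3E _.
  by apply: bounded_mfunD; [exact: bd|apply: bounded_mfunZ; exact: bd].
have bF4 : bounded_mfun `[a, b] F4.
  apply: eq_bounded_mfun F4E _.
  by apply: bounded_mfunD; [exact: bd|apply: bounded_mfunZ; exact: bd].
have hW x : a <= x <= b ->
    fint_right a b 0 (F2 \_ `[A, B]) x +
    1 / Gamma (1 - alpha) * fint_right a b alpha (F3 \_ `[A, B]) x +
    -1 / Gamma (1 - beta) * fint_left a b beta (F4 \_ `[A, B]) x = c.
  move=> xab; rewrite -(hc x xab).
  rewrite (fint_right_lin_eq h0 (bdR _ cL2) (bdR _ cg2) (restrict_lin `[A, B] F2E) xab).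
  rewrite (fint_right_lin_eq a01 (bdR _ cL3) (bdR _ cg3) (restrict_lin `[A, B] F3E) xab).
  rewrite (fint_left_lin_eq b01 (bdR _ cL4) (bdR _ cg4) (restrict_lin `[A, B] F4E) xab).
  have idE (p q r p' q' r' k k' : R) :
    (p + lambda * p') + k * (q + lambda * q') + k' * (r + lambda * r') =
    (p + k * q + k' * r) + lambda * (p' + k * q' + k' * r') by ring.
  exact: idE.
have he3 x : a <= x <= B -> RLright_exists a alpha B F3 x.
  move=> xaB; have xaB' : x \in `[a, B] by rewrite in_itv.
  apply: (RLright_exists_lin (lambda := lambda) a01 _ _ _ xaB (hL3.1 x xaB') (hg3.1 x xaB')).
  - by apply: (bounded_mfunS _ subaB (bd _ cL3)).
  - by apply: (bounded_mfunS _ subaB (bd _ cg3)).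
  - by move=> z; rewrite inE => /subaB zab; apply: F3E; rewrite inE.
have he4 x : A <= x <= b -> RLleft_exists A beta b F4 x.
  move=> xAb; have xAb' : x \in `[A, b] by rewrite in_itv.
  apply: (RLleft_exists_lin (lambda := lambda) b01 _ _ _ xAb (hL4.1 x xAb') (hg4.1 x xAb')).
  - by apply: (bounded_mfunS _ subAb (bd _ cL4)).
  - by apply: (bounded_mfunS _ subAb (bd _ cg4)).
  - by move=> z; rewrite inE => /subAb zab; apply: F4E; rewrite inE.
have Ga : Gamma (1 - alpha) != 0 by rewrite gt_eqF// Gamma_gt0.
have Gb : Gamma (1 - beta) != 0 by rewrite gt_eqF// Gamma_gt0.
split.
- move=> x; rewrite in_itv/= => xAB; have /andP[Ax xB] := xAB; split.
  + by apply: he3; rewrite xB (le_trans haA).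
  + by apply: he4; rewrite Ax (le_trans xB).
  + exact: (euler_equation_inner haA hAB hBb cF2 hW he3 he4 xAB).
- move=> aA x; rewrite in_itv/= => xaA; have /andP[ax xA] := xaA.
  have [e1 e2] := euler_equation_left haA hAB hBb a01 bF3 hW he3 Ga aA xaA.
  by split; [apply: he3; rewrite ax (le_trans xA)// ltW|exact: e1|exact: e2].
- move=> Bb x; rewrite in_itv/= => xBb; have /andP[Bx xb] := xBb.
  have [e1 e2] := euler_equation_right haA hAB hBb b01 bF4 hW he4 Gb Bb xBb.
  by split; [apply: he4; rewrite xb (le_trans (ltW hAB))|exact: e1|exact: e2].
Qed.
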